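(* The theory $\mathrm{CT}_0^+$ proves the Global Reflection Principle $\forall\phi\,(\mathrm{Pr}_T(\phi)\rightarrow T(\phi))$ and the Axiom Soundness Property for $\mathrm{PA}$, $\forall\phi\,(\mathrm{Ax}_{\mathrm{PA}}(\phi)\rightarrow T(\phi))$, where $\phi$ ranges over (codes of) $\mathcal{L}^+$-sentences.
   Context: $\mathcal{L}_{\mathrm{PA}}$ is the language of Peano Arithmetic with function symbols $0,S,+,\times$ and equality as the only predicate symbol; connectives and quantifiers are $\neg,\wedge,\vee,\exists,\forall$. $\mathcal{L}^+=\mathcal{L}_{\mathrm{PA}}\cup\{(x)_y\}$, where $(x)_y$ is a two-argument function symbol. Let $\pi(x,y,z)$ be a fixed natural $\mathcal{L}_{\mathrm{PA}}$-formula expressing that $z$ is the $y$-th element of the sequence $x$ (provably defining a total function of $x,y$, with some default value when $x$ has no $y$-th element). $\mathrm{PA}^+$ is the theory in $\mathcal{L}^+$ with the usual axioms of $\mathrm{PA}$, induction being allowed for all $\mathcal{L}^+$-formulae, plus $\forall x,y,z\,((x)_y=z\leftrightarrow\pi(x,y,z))$. Arithmetization (applied to $\mathcal{L}^+$): fix a Gödel coding, identify syntactic objects with their codes, and express syntactic notions by natural arithmetical formulae. $\underline{x}$ is the numeral $SS\ldots S0$ ($x$ occurrences of $S$). For a closed $\mathcal{L}^+$-term $t$, $t^{\circ}$ is its value, with $((t)_s)^{\circ}=(t^{\circ})_{s^{\circ}}$. $\mathrm{TermSeq}(x)$ says that $x$ is a (coded) sequence of closed $\mathcal{L}^+$-terms;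 for such $x$, $(x)^{\circ}$ is the sequence of values of its terms. For an $\mathcal{L}^+$-formula $\phi$ and a sequence $\tau$ of closed terms, $\phi(\tau)$ is the result of substituting, for every $z$, the $z$-th element of $\tau$ for the free variable $x_z$ in $\phi$; $\tau$ is required to be long enough that every free variable $x_z$ of $\phi$ receives a term (so $\phi(\tau)$ is a sentence). For a single closed term $t$ and a formula $\phi(v)$ with at most one free variable $v$, $\phi(t)$ is ordinary substitution. $\mathrm{CT}_0^+$ is the theory in $\mathcal{L}^+\cup\{T\}$ ($T$ a unary predicate) with axioms: (i) $\mathrm{PA}^+$; (ii) compositional axioms for $\mathcal{L}^+$, for $\otimes\in\{\wedge,\vee\}$, $Q\in\{\forall,\exists\}$, with $s,t$ ranging over closed $\mathcal{L}^+$-terms, $\phi,\psi$ over $\mathcal{L}^+$-sentences, $\phi(v)$ over $\mathcal{L}^+$-formulae with at most the free variable $v$: $T(s=t)\leftrightarrow s^{\circ}=t^{\circ}$; $T(\phi\otimes\psi)\leftrightarrow T\phi\otimes T\psi$; $T(\neg\phi)\leftrightarrow\neg T\phi$; $T(Qv\,\phi(v))\leftrightarrow Qx\,T(\phi(\underline{x}))$; (iii) induction for all $\Delta_0$ formulae of $\mathcal{L}^+\cup\{T\}$; (iv) the Generalized regularity principle: for all $\mathcal{L}^+$-formulae $\phi$ and all $x,y$ (for which the substitutions are defined), $\mathrm{TermSeq}(x)\wedge\mathrm{TermSeq}(y)\wedge (x)^{\circ}=(y)^{\circ}\rightarrow (T(\phi(x))\leftrightarrow T(\phi(y)))$. $\mathrm{Pr}_T(x)$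 formalizes ''there is a proof of the sentence $x$ in the sequent calculus for first-order logic (in $\mathcal{L}^+$) in which additional initial sequents $\longrightarrow\phi$ are allowed for all sentences $\phi$ with $T(\phi)$''. $\mathrm{Ax}_{\mathrm{PA}}(x)$ represents the set of axioms of $\mathrm{PA}$ (axioms being sentences). *)

(* Defs.v *)
From Stdlib Require Import List Arith.
Import ListNotations.

(** * Syntax of L+ with a truth predicate *)

(* [Elt x y] is the sequence-element function symbol (x)_y.  Variables are
   named: [Var i] is x_i, and quantifiers bind a variable index. *)
Inductive term : Type :=
| Var (i : nat)
| Zero
| Succ (t : term)
| Add (s t : term)
| Mul (s t : term)
| Elt (s t : term).

Inductive form : Type :=
| FEq (s t : term)
| FTr (t : term)
| FNeg (p : form)
| FAnd (p q : form)
| FOr (p q : form)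
| FEx (v : nat) (p : form)
| FAll (v : nat) (p : form).

Definition FImp (p q : form) : form := FOr (FNeg p) q.
Definition FIff (p q : form) : form := FAnd (FImp p q) (FImp q p).

Fixpoint num (n : nat) : term :=
  match n with 0 => Zero | S m => Succ (num m) end.

Fixpoint occurs (v : nat) (t : term) : Prop :=
  match t with
  | Var i => i = v
  | Zero => False
  | Succ s => occurs v s
  | Add s u | Mul s u | Elt s u => occurs v s \/ occurs v u
  end.

Fixpoint free (v : nat) (p : form) : Prop :=
  match p with
  | FEq s t => occurs v s \/ occurs v t
  | FTr t => occurs v t
  | FNeg a => free v a
  | FAnd a b | FOr a b => free v a \/ free v b
  | FEx w a | FAll w a => v <> w /\ free v a
  end.

Definition sentence (p : form) : Prop := forall v, ~ free v p.

Fixpoint subst_term (v : nat) (r t : term) : term :=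
  match t with
  | Var i => if i =? v then r else Var i
  | Zero => Zero
  | Succ s => Succ (subst_term v r s)
  | Add s u => Add (subst_term v r s) (subst_term v r u)
  | Mul s u => Mul (subst_term v r s) (subst_term v r u)
  | Elt s u => Elt (subst_term v r s) (subst_term v r u)
  end.

(* Bound variables are not renamed; [free_for] is the side condition that
   excludes capture. *)
Fixpoint subst (v : nat) (r : term) (p : form) : form :=
  match p with
  | FEq s t => FEq (subst_term v r s) (subst_term v r t)
  | FTr t => FTr (subst_term v r t)
  | FNeg a => FNeg (subst v r a)
  | FAnd a b => FAnd (subst v r a) (subst v r b)
  | FOr a b => FOr (subst v r a) (subst v r b)
  | FEx w a => FEx w (if w =? v then a else subst v r a)
  | FAll w a => FAll w (if w =? v then a else subst v r a)
  end.

Fixpoint free_for (r : term) (v : nat) (p : form) : Prop :=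
  match p with
  | FEq _ _ | FTr _ => True
  | FNeg a => free_for r v a
  | FAnd a b | FOr a b => free_for r v a /\ free_for r v b
  | FEx w a | FAll w a =>
      v <> w /\ free v a -> ~ occurs w r /\ free_for r v a
  end.

Fixpoint Lplus_form (p : form) : Prop :=
  match p with
  | FEq _ _ => True
  | FTr _ => False
  | FNeg a => Lplus_form a
  | FAnd a b | FOr a b => Lplus_form a /\ Lplus_form b
  | FEx _ a | FAll _ a => Lplus_form a
  end.

Definition atomic (p : form) : Prop :=
  match p with FEq _ _ | FTr _ => True | _ => False end.

(** * Sequent calculus with equality *)

(* Initial sequents [-> p] are allowed for p in [Th].  Exchange, weakening and
   contraction are merged into [LK_struct]. *)
Inductive LK (Th : form -> Prop) : list form -> list form -> Prop :=
| LK_id p : LK Th [p] [p]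
| LK_ax p : Th p -> LK Th [] [p]
| LK_refl t : LK Th [] [FEq t t]
| LK_leibniz s t v p : atomic p ->
    LK Th [FEq s t; subst v s p] [subst v t p]
| LK_struct G D G' D' :
    LK Th G' D' -> incl G' G -> incl D' D -> LK Th G D
| LK_cut G D p : LK Th G (p :: D) -> LK Th (p :: G) D -> LK Th G D
| LK_negL G D p : LK Th G (p :: D) -> LK Th (FNeg p :: G) D
| LK_negR G D p : LK Th (p :: G) D -> LK Th G (FNeg p :: D)
| LK_andL G D p q : LK Th (p :: q :: G) D -> LK Th (FAnd p q :: G) D
| LK_andR G D p q :
    LK Th G (p :: D) -> LK Th G (q :: D) -> LK Th G (FAnd p q :: D)
| LK_orL G D p q :
    LK Th (p :: G) D -> LK Th (q :: G) D -> LK Th (FOr p q :: G) D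
| LK_orR G D p q : LK Th G (p :: q :: D) -> LK Th G (FOr p q :: D)
| LK_allL G D v p t : free_for t v p ->
    LK Th (subst v t p :: G) D -> LK Th (FAll v p :: G) D
| LK_allR G D v p w : free_for (Var w) v p ->
    (forall q, In q (FAll v p :: G ++ D) -> ~ free w q) ->
    LK Th G (subst v (Var w) p :: D) -> LK Th G (FAll v p :: D)
| LK_exL G D v p w : free_for (Var w) v p ->
    (forall q, In q (FEx v p :: G ++ D) -> ~ free w q) ->
    LK Th (subst v (Var w) p :: G) D -> LK Th (FEx v p :: G) D
| LK_exR G D v p t : free_for t v p ->
    LK Th G (subst v t p :: D) -> LK Th G (FEx v p :: D).

Definition proves (Th : form -> Prop) (p : form) : Prop := LK Th [] [p].

(** * Notation for writing object-language formulae *)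

(* A [fm] is a formula awaiting the least index not yet used by an enclosing
   quantifier: at level n a quantifier binds x_n and its body is at level n+1,
   so no capture occurs as long as free variables have index below the level.
   A closed formula is read off at level 0. *)
Definition fm : Type := nat -> form.

Definition mEq (s t : term) : fm := fun _ => FEq s t.
Definition mTr (t : term) : fm := fun _ => FTr t.
Definition mNeg (p : fm) : fm := fun n => FNeg (p n).
Definition mAnd (p q : fm) : fm := fun n => FAnd (p n) (q n).
Definition mOr (p q : fm) : fm := fun n => FOr (p n) (q n).
Definition mImp (p q : fm) : fm := fun n => FImp (p n) (q n).
Definition mIff (p q : fm) : fm := fun n => FIff (p n) (q n).
Definition mEx (p : term -> fm) : fm := fun n => FEx n (p (Var n) (S n)).
Definition mAll (p : term -> fm) : fm := fun n => FAll n (p (Var n) (S n)).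

Declare Scope fm_scope.
Delimit Scope fm_scope with fm.
Bind Scope fm_scope with fm.
Local Open Scope fm_scope.

Notation "s == t" := (mEq s t) (at level 70, no associativity) : fm_scope.
Notation "s <<>> t" := (mNeg (mEq s t))
  (at level 70, no associativity) : fm_scope.
Notation "~ p" := (mNeg p) : fm_scope.
Notation "p /\ q" := (mAnd p q) : fm_scope.
Notation "p \/ q" := (mOr p q) : fm_scope.
Notation "p --> q" := (mImp p q) (at level 90, right associativity) : fm_scope.
Notation "p <--> q" := (mIff p q) (at level 95, no associativity) : fm_scope.
Notation "\ex x .. y , p" := (mEx (fun x => .. (mEx (fun y => p%fm)) ..))
  (at level 10, x binder, y binder, p at level 200) : fm_scope.
Notation "\all x .. y , p" := (mAll (fun x => .. (mAll (fun y => p%fm)) ..))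
  (at level 10, x binder, y binder, p at level 200) : fm_scope.

Definition le (s t : term) : fm := \ex z, Add s z == t.
Definition lt (s t : term) : fm := le (Succ s) t.

(* The injective pairing (s + t)^2 + s, as an L_PA-term. *)
Definition pair (s t : term) : term := Add (Mul (Add s t) (Add s t)) s.

(** * Coded sequences and PA+ *)

(* The sequence <n, <a, b>> has length n and its i-th element, for i < n, is
   Goedel's beta function: the remainder of a modulo 1 + (i + 1) b.  The
   default value is 0. *)
Definition seq_code (x n a b : term) : fm := x == pair n (pair a b).

Definition pi (x y z : term) : fm :=
  let modulus b := Succ (Mul (Succ y) b) in
  (\ex n a b, seq_code x n a b /\ lt y n /\ lt z (modulus b) /\
     \ex q, a == Add (Mul q (modulus b)) z)
  \/ (~ (\ex n a b, seq_code x n a b /\ lt y n) /\ z == Zero).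

Definition Lh (x n : term) : fm := \ex a b, seq_code x n a b.

Definition PA_basic : list form := map (fun p : fm => p 0)
  [ \all x, Succ x <<>> Zero;
    \all x y, Succ x == Succ y --> x == y;
    \all x, Add x Zero == x;
    \all x y, Add x (Succ y) == Succ (Add x y);
    \all x, Mul x Zero == Zero;
    \all x y, Mul x (Succ y) == Add (Mul x y) x ].

Definition Ind (v : nat) (p : form) : form :=
  FImp (FAnd (subst v Zero p)
             (FAll v (FImp p (subst v (Succ (Var v)) p))))
       (FAll v p).

Inductive all_prefix (p : form) : form -> Prop :=
| all_prefix_nil : all_prefix p p
| all_prefix_cons v q : all_prefix p q -> all_prefix p (FAll v q).

Definition universal_closure (p q : form) : Prop :=
  all_prefix p q /\ sentence q.

Inductive PAplus : form -> Prop :=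
| PAplus_basic p : In p PA_basic -> PAplus p
| PAplus_induction v p q :
    Lplus_form p -> universal_closure (Ind v p) q -> PAplus q
| PAplus_elt : PAplus ((\all x y z, Elt x y == z <--> pi x y z) 0).

(* The guard of a bounded quantifier is x <= t, written with a variable z
   distinct from x and not occurring in t. *)
Definition bound (x : nat) (t : term) (z : nat) : form :=
  FEx z (FEq (Add (Var x) (Var z)) t).

Inductive Delta0 : form -> Prop :=
| Delta0_eq s t : Delta0 (FEq s t)
| Delta0_tr t : Delta0 (FTr t)
| Delta0_neg p : Delta0 p -> Delta0 (FNeg p)
| Delta0_and p q : Delta0 p -> Delta0 q -> Delta0 (FAnd p q)
| Delta0_or p q : Delta0 p -> Delta0 q -> Delta0 (FOr p q)
| Delta0_ex x t z p :
    ~ occurs x t -> ~ occurs z t -> z <> x ->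
    Delta0 p -> Delta0 (FEx x (FAnd (bound x t z) p))
| Delta0_all x t z p :
    ~ occurs x t -> ~ occurs z t -> z <> x ->
    Delta0 p -> Delta0 (FAll x (FImp (bound x t z) p)).

(** * Goedel coding of L+ *)

(* The code of an expression is a tag paired with the codes of its parts.
   The constructors below act on object-language terms denoting codes. *)
Definition qVar (i : term) : term := pair (num 1) i.
Definition qZero : term := pair (num 2) Zero.
Definition qSucc (s : term) : term := pair (num 3) s.
Definition qAdd (s t : term) : term := pair (num 4) (pair s t).
Definition qMul (s t : term) : term := pair (num 5) (pair s t).
Definition qElt (s t : term) : term := pair (num 6) (pair s t).
Definition qEq (s t : term) : term := pair (num 7) (pair s t).
Definition qNeg (p : term) : term := pair (num 8) p.
Definition qAnd (p q : term) : term := pair (num 9) (pair p q).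
Definition qOr (p q : term) : term := pair (num 10) (pair p q).
Definition qEx (v p : term) : term := pair (num 11) (pair v p).
Definition qAll (v p : term) : term := pair (num 12) (pair v p).
Definition qTr (s : term) : term := pair (num 13) s.
Definition qImp (p q : term) : term := qOr (qNeg p) q.

Fixpoint quote_term (t : term) : term :=
  match t with
  | Var i => qVar (num i)
  | Zero => qZero
  | Succ s => qSucc (quote_term s)
  | Add s u => qAdd (quote_term s) (quote_term u)
  | Mul s u => qMul (quote_term s) (quote_term u)
  | Elt s u => qElt (quote_term s) (quote_term u)
  end.

(* A closed term denoting the code of p. *)
Fixpoint quote (p : form) : term :=
  match p with
  | FEq s t => qEq (quote_term s) (quote_term t)
  | FTr t => qTr (quote_term t)
  | FNeg a => qNeg (quote a)
  | FAnd a b => qAnd (quote a) (quote b)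
  | FOr a b => qOr (quote a) (quote b)
  | FEx v a => qEx (num v) (quote a)
  | FAll v a => qAll (num v) (quote a)
  end.

(* Lists of codes, used for sets of variables and for cedents. *)
Definition qnil : term := Zero.
Definition qcons (x l : term) : term := pair (num 1) (pair x l).

(** * Arithmetized syntax *)

(* "x belongs to the least X with G X y -> X y": there is a sequence
   (s)_0, ..., (s)_n = x each of whose elements is in G of the set of the
   earlier ones.  Every G below is positive in X. *)
Definition Lfp (G : (term -> fm) -> term -> fm) (x : term) : fm :=
  \ex s n, Elt s n == x /\
    \all i, le i n -->
      G (fun y => \ex j, lt j i /\ Elt s j == y) (Elt s i).

Definition Mem (x l : term) : fm :=
  Lfp (fun X m => \ex y k, m == qcons y k /\ (x == y \/ X k)) l.

Definition IsNumeral (x c : term) : fm :=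
  Lfp (fun X p =>
    p == pair Zero qZero \/
    \ex y d, p == pair (Succ y) (qSucc d) /\ X (pair y d)) (pair x c).

Definition IsTerm_in (elt : bool) (t : term) : fm :=
  Lfp (fun X t =>
    (\ex i, t == qVar i) \/ t == qZero \/ (\ex s, t == qSucc s /\ X s) \/
    \ex s u,
      (let pa := t == qAdd s u \/ t == qMul s u in
       if elt then pa \/ t == qElt s u else pa) /\ X s /\ X u) t.

Definition IsForm_in (elt : bool) (p : term) : fm :=
  Lfp (fun X p =>
    (\ex s t, p == qEq s t /\ IsTerm_in elt s /\ IsTerm_in elt t) \/
    (\ex a, p == qNeg a /\ X a) \/
    (\ex a b, (p == qAnd a b \/ p == qOr a b) /\ X a /\ X b) \/
    \ex v a, (p == qEx v a \/ p == qAll v a) /\ X a) p.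

Definition IsTerm : term -> fm := IsTerm_in true.
Definition IsForm : term -> fm := IsForm_in true.
Definition IsForm_PA : term -> fm := IsForm_in false.

Definition Occurs (v t : term) : fm :=
  Lfp (fun X t =>
    t == qVar v \/ (\ex s, t == qSucc s /\ X s) \/
    \ex s u, (t == qAdd s u \/ t == qMul s u \/ t == qElt s u) /\
      (X s \/ X u)) t.

Definition Free (v p : term) : fm :=
  Lfp (fun X p =>
    (\ex s t, p == qEq s t /\ (Occurs v s \/ Occurs v t)) \/
    (\ex a, p == qNeg a /\ X a) \/
    (\ex a b, (p == qAnd a b \/ p == qOr a b) /\ (X a \/ X b)) \/
    \ex w a, (p == qEx w a \/ p == qAll w a) /\ v <<>> w /\ X a) p.

Definition ClTerm (t : term) : fm := IsTerm t /\ ~ \ex v, Occurs v t.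
Definition Sent (p : term) : fm := IsForm p /\ ~ \ex v, Free v p.

(* The value of the closed term t is z. *)
Definition Val (t z : term) : fm :=
  Lfp (fun X p =>
    p == pair qZero Zero \/
    (\ex s a, p == pair (qSucc s) (Succ a) /\ X (pair s a)) \/
    \ex s u a b,
      (p == pair (qAdd s u) (Add a b) \/
       p == pair (qMul s u) (Mul a b) \/
       p == pair (qElt s u) (Elt a b)) /\
      X (pair s a) /\ X (pair u b)) (pair t z).

Definition TermSeq (x : term) : fm :=
  \ex n, Lh x n /\ \all i, lt i n --> ClTerm (Elt x i).

(* w is a sequence of values of the terms of x. *)
Definition ValSeq (x w : term) : fm :=
  \ex n, Lh x n /\ Lh w n /\ \all i, lt i n --> Val (Elt x i) (Elt w i).

(* t' results from t by replacing each x_i by a term u with V i u. *)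
Definition ReplaceTerm (V : term -> term -> fm) (t t' : term) : fm :=
  Lfp (fun X p =>
    (\ex i u, p == pair (qVar i) u /\ V i u) \/
    p == pair qZero qZero \/
    (\ex s s', p == pair (qSucc s) (qSucc s') /\ X (pair s s')) \/
    \ex s s' u u',
      (p == pair (qAdd s u) (qAdd s' u') \/
       p == pair (qMul s u) (qMul s' u') \/
       p == pair (qElt s u) (qElt s' u')) /\
      X (pair s s') /\ X (pair u u')) (pair t t').

(* p' results from p by replacing each free x_i by a term u with V i u.  The
   list l collects the variables bound on the path from the root. *)
Definition Replace (V : term -> term -> fm) (p p' : term) : fm :=
  let V' l i u := (Mem i l /\ u == qVar i) \/ (~ Mem i l /\ V i u) in
  Lfp (fun X r =>
    (\ex l s s' t t', r == pair l (pair (qEq s t) (qEq s' t')) /\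
       ReplaceTerm (V' l) s s' /\ ReplaceTerm (V' l) t t') \/
    (\ex l a a', r == pair l (pair (qNeg a) (qNeg a')) /\
       X (pair l (pair a a'))) \/
    (\ex l a a' b b',
       (r == pair l (pair (qAnd a b) (qAnd a' b')) \/
        r == pair l (pair (qOr a b) (qOr a' b'))) /\
       X (pair l (pair a a')) /\ X (pair l (pair b b'))) \/
    \ex l v a a',
      (r == pair l (pair (qEx v a) (qEx v a')) \/
       r == pair l (pair (qAll v a) (qAll v a'))) /\
      X (pair (qcons v l) (pair a a'))) (pair qnil (pair p p')).

(* q is p with the term t substituted for x_v. *)
Definition Subst (v t p q : term) : fm :=
  Replace (fun i u => (i == v /\ u == t) \/ (i <<>> v /\ u == qVar i)) p q.

(* q is p(x): each free x_i of p is replaced by the i-th element of x; no such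
   q exists if x is too short. *)
Definition SubstSeq (x p q : term) : fm :=
  Replace (fun i u => \ex n, Lh x n /\ lt i n /\ u == Elt x i) p q.

Definition FreeFor (t v p : term) : fm :=
  Lfp (fun X p =>
    (\ex a b, p == qEq a b) \/
    (\ex a, p == qNeg a /\ X a) \/
    (\ex a b, (p == qAnd a b \/ p == qOr a b) /\ X a /\ X b) \/
    \ex w a, (p == qEx w a \/ p == qAll w a) /\
      (v <<>> w /\ Free v a --> ~ Occurs w t /\ X a)) p.

(** * Provability from true sentences *)

Definition FormList (l : term) : fm :=
  Lfp (fun X l => l == qnil \/ \ex p k, l == qcons p k /\ IsForm p /\ X k) l.

Definition Incl (l m : term) : fm := \all x, Mem x l --> Mem x m.
Definition NotFreeIn (v l : term) : fm := ~ \ex p, Mem p l /\ Free v p.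

(* Derivability of the sequent G -> D in L+, rule by rule as [LK], with
   [LK_ax] for the true sentences. *)
Definition Derivable (G D : term) : fm :=
  Lfp (fun X r => \ex G D, r == pair G D /\ FormList G /\ FormList D /\
    let X G D := X (pair G D) in
    (
      (\ex p, G == qcons p qnil /\ D == qcons p qnil) \/
      (\ex p, Sent p /\ mTr p /\ G == qnil /\ D == qcons p qnil) \/
      (\ex t, G == qnil /\ D == qcons (qEq t t) qnil) \/
      (\ex s t v a b p q,
         Subst v s (qEq a b) p /\ Subst v t (qEq a b) q /\
         G == qcons (qEq s t) (qcons p qnil) /\ D == qcons q qnil) \/
      (\ex G' D', X G' D' /\ Incl G' G /\ Incl D' D) \/
      (\ex p, X G (qcons p D) /\ X (qcons p G) D) \/
      (\ex H p, G == qcons (qNeg p) H /\ X H (qcons p D)) \/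
      (\ex E p, D == qcons (qNeg p) E /\ X (qcons p G) E) \/
      (\ex H p q, G == qcons (qAnd p q) H /\ X (qcons p (qcons q H)) D) \/
      (\ex E p q, D == qcons (qAnd p q) E /\
         X G (qcons p E) /\ X G (qcons q E)) \/
      (\ex H p q, G == qcons (qOr p q) H /\
         X (qcons p H) D /\ X (qcons q H) D) \/
      (\ex E p q, D == qcons (qOr p q) E /\ X G (qcons p (qcons q E))) \/
      (\ex H v p t q, G == qcons (qAll v p) H /\
         IsTerm t /\ FreeFor t v p /\ Subst v t p q /\ X (qcons q H) D) \/
      (\ex E v p w q, D == qcons (qAll v p) E /\
         FreeFor (qVar w) v p /\ NotFreeIn w G /\ NotFreeIn w D /\
         Subst v (qVar w) p q /\ X G (qcons q E)) \/
      (\ex H v p w q, G == qcons (qEx v p) H /\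
         FreeFor (qVar w) v p /\ NotFreeIn w G /\ NotFreeIn w D /\
         Subst v (qVar w) p q /\ X (qcons q H) D) \/
      (\ex E v p t q, D == qcons (qEx v p) E /\
         IsTerm t /\ FreeFor t v p /\ Subst v t p q /\ X G (qcons q E))
    )) (pair G D).

Definition Pr_T (p : term) : fm := Derivable qnil (qcons p qnil).

(** * Arithmetized axioms of PA *)

Definition AllPrefix (p q : term) : fm :=
  Lfp (fun X q => q == p \/ \ex v a, q == qAll v a /\ X a) q.

Definition IndAxiom (v p q : term) : fm :=
  \ex a b, Subst v qZero p a /\ Subst v (qSucc (qVar v)) p b /\
    q == qImp (qAnd a (qAll v (qImp p b))) (qAll v p).

Definition Ax_PA (x : term) : fm :=
  fold_right (fun p acc => x == quote p \/ acc)
    (\ex v p q, IsForm_PA p /\ IndAxiom v p q /\ AllPrefix q x /\ Sent x)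
    PA_basic.

(** * The theory CT_0^+ *)

Definition T_inst (v x p : term) : fm :=
  \ex c q, IsNumeral x c /\ Subst v c p q /\ mTr q.

Definition CT_eq : fm := \all s t, ClTerm s --> ClTerm t -->
  (mTr (qEq s t) <--> \ex z, Val s z /\ Val t z).

Definition CT_and : fm := \all p q, Sent p --> Sent q -->
  (mTr (qAnd p q) <--> mTr p /\ mTr q).

Definition CT_or : fm := \all p q, Sent p --> Sent q -->
  (mTr (qOr p q) <--> mTr p \/ mTr q).

Definition CT_neg : fm := \all p, Sent p --> (mTr (qNeg p) <--> ~ mTr p).

Definition CT_all : fm := \all v p,
  IsForm p --> (\all w, Free w p --> w == v) -->
  (mTr (qAll v p) <--> \all x, T_inst v x p).

Definition CT_ex : fm := \all v p,
  IsForm p --> (\all w, Free w p --> w == v) -->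
  (mTr (qEx v p) <--> \ex x, T_inst v x p).

(* (x)° = (y)° is expressed by a common sequence of values. *)
Definition CT_regularity : fm := \all p x y,
  IsForm p --> TermSeq x --> TermSeq y --> (\ex w, ValSeq x w /\ ValSeq y w) -->
  \all q r, SubstSeq x p q --> SubstSeq y p r --> (mTr q <--> mTr r).

Definition CT_axioms : list form := map (fun p : fm => p 0)
  [CT_eq; CT_and; CT_or; CT_neg; CT_all; CT_ex; CT_regularity].

Inductive CT0plus : form -> Prop :=
| CT0plus_PAplus p : PAplus p -> CT0plus p
| CT0plus_truth p : In p CT_axioms -> CT0plus p
| CT0plus_induction v p q :
    Delta0 p -> universal_closure (Ind v p) q -> CT0plus q.

Definition GlobalReflection : form :=
  (\all p, Sent p --> Pr_T p --> mTr p) 0.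

Definition AxiomSoundness_PA : form :=
  (\all p, Sent p --> Ax_PA p --> mTr p) 0.

(* Main.v *)
From Stdlib Require Import List Arith Lia ArithRing Classical ClassicalEpsilon Cantor.
From Stdlib Require Import FunctionalExtensionality PropExtensionality ProofIrrelevance.
Require Import Defs.
Import ListNotations.

(** Both claims are proved in models.  By the completeness theorem for the sequent
    calculus ([completeness]) it suffices that the two sentences hold in every
    countable model M of CT_0^+.  In M, syntax is possibly nonstandard, and one argues
    about it as about ordinary syntax, with one restriction: induction is available for
    predicates definable by L+-formulae with parameters, and for truth only when T
    occurs in an atom T((u)_i), with u a coded sequence of sentences.  By the beta lemma
    ([seq_exists]) every definable sequence of sentences is coded, so that one can prove
    T(F x) by induction along a derivation of x, for definable F ([T_Lfp_ind]).

    Let an assignment c be an element of M, giving x_i the value (c)_i, and let Tr(c, p)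
    be the truth of p with the numerals of these values substituted.  The compositional
    axioms give Tarski's clauses for Tr, and the regularity principle gives the
    substitution lemma ([Tr_comp]): substituting a term amounts to changing the
    assignment.  So every rule of the calculus leads from sequents valid under all
    assignments to such sequents ([rule_sound]).

    This does not yet give reflection by induction on derivations, because validity
    under all assignments is an unbounded quantification over sequences.  Here the
    function symbol for elements of sequences helps.  The formula that results from f by
    replacing each x_i by the term (v)_i has one free variable, and its generalization
    over v is a sentence which is true if and only if Tr(c, f) holds for all c
    ([T_closure]).  A sequent is expressed by the disjunction of the negations of its
    left members and of its right members; truth commutes with such disjunctions, even
    of nonstandard length ([Tr_disj]).  So the validity of a sequent is the truth of one
    sentence that depends definably on it, and induction applies.

    An induction axiom for p is true under all assignments because the sentences p(0),
    p(1), ... form a definable sequence ([Tr_induction]).  Its universal closures may have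
    a prefix of nonstandard length; they are treated by induction on the prefix, with
    closures expressed by one quantifier as above ([Tr_AllPrefix]).  The other axioms of
    PA are standard sentences, for which truth is satisfaction ([Tr_quote]). *)

(** * Tarskian semantics *)

Record model : Type := Model {
  dom :> Type;
  m0 : dom;
  mS : dom -> dom;
  mA : dom -> dom -> dom;
  mM : dom -> dom -> dom;
  mE : dom -> dom -> dom;
  mT : dom -> Prop }.

Arguments m0 {m}.
Arguments mS {m}.
Arguments mA {m}.
Arguments mM {m}.
Arguments mE {m}.
Arguments mT {m}.

Definition upd {A : Type} (e : nat -> A) (v : nat) (a : A) : nat -> A :=
  fun i => if i =? v then a else e i.

Lemma upd_same {A : Type} (e : nat -> A) v a : upd e v a v = a.
Proof. unfold upd. now rewrite Nat.eqb_refl. Qed.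

Lemma upd_other {A : Type} (e : nat -> A) v a i : i <> v -> upd e v a i = e i.
Proof. intros H. unfold upd. destruct (Nat.eqb_spec i v); [contradiction|easy]. Qed.

Fixpoint eval {M : model} (e : nat -> M) (t : term) : M :=
  match t with
  | Var i => e i
  | Zero => m0
  | Succ s => mS (eval e s)
  | Add s u => mA (eval e s) (eval e u)
  | Mul s u => mM (eval e s) (eval e u)
  | Elt s u => mE (eval e s) (eval e u)
  end.

Fixpoint sat {M : model} (e : nat -> M) (p : form) : Prop :=
  match p with
  | FEq s t => eval e s = eval e t
  | FTr t => mT (eval e t)
  | FNeg a => ~ sat e a
  | FAnd a b => sat e a /\ sat e b
  | FOr a b => sat e a \/ sat e b
  | FEx v a => exists x, sat (upd e v x) a
  | FAll v a => forall x, sat (upd e v x) a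
  end.

Lemma eval_ext {M : model} (e e' : nat -> M) t :
  (forall v, occurs v t -> e v = e' v) -> eval e t = eval e' t.
Proof.
  induction t; simpl; intros H; auto; f_equal; auto.
Qed.

Lemma sat_ext {M : model} p : forall e e' : nat -> M,
  (forall v, free v p -> e v = e' v) -> (sat e p <-> sat e' p).
Proof.
  induction p; simpl; intros e e' H.
  - rewrite (eval_ext e e' s), (eval_ext e e' t); auto. tauto.
  - rewrite (eval_ext e e' t); auto. tauto.
  - rewrite (IHp e e'); auto. tauto.
  - rewrite (IHp1 e e'), (IHp2 e e'); auto. tauto.
  - rewrite (IHp1 e e'), (IHp2 e e'); auto. tauto.
  - assert (E : forall x, sat (upd e v x) p <-> sat (upd e' v x) p).
    { intros x. apply IHp. intros i Hi. unfold upd.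
      destruct (Nat.eqb_spec i v); auto. }
    split; intros [x Hx]; exists x; now apply E.
  - assert (E : forall x, sat (upd e v x) p <-> sat (upd e' v x) p).
    { intros x. apply IHp. intros i Hi. unfold upd.
      destruct (Nat.eqb_spec i v); auto. }
    split; intros Hx x; now apply E.
Qed.

Lemma eval_subst {M : model} (e : nat -> M) v r t :
  eval e (subst_term v r t) = eval (upd e v (eval e r)) t.
Proof.
  induction t; simpl; try congruence.
  unfold upd. now destruct (Nat.eqb_spec i v).
Qed.

Lemma subst_term_not_occurs v r t : ~ occurs v t -> subst_term v r t = t.
Proof.
  induction t; simpl; intros H; f_equal; auto.
  destruct (Nat.eqb_spec i v); [contradiction|easy].
Qed.

Lemma subst_not_free v r p : ~ free v p -> subst v r p = p.
Proof.
  induction p; simpl; intros H; f_equal; auto using subst_term_not_occurs.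
  all: destruct (Nat.eqb_spec v0 v); auto.
Qed.

(** The condition [free_for] excludes capture only where v is free; elsewhere the
    substitution does nothing. *)
Lemma sat_subst_under {M : model} v w r p (e : nat -> M) x :
  (v <> w /\ free v p -> ~ occurs w r /\ free_for r v p) ->
  (forall e' : nat -> M, free_for r v p ->
    (sat e' (subst v r p) <-> sat (upd e' v (eval e' r)) p)) ->
  (sat (upd e w x) (if w =? v then p else subst v r p) <->
   sat (upd (upd e v (eval e r)) w x) p).
Proof.
  intros H IH. destruct (Nat.eqb_spec w v) as [->|Hv].
  - apply sat_ext. intros i _. unfold upd. now destruct (i =? v).
  - destruct (classic (free v p)) as [F|F].
    + destruct H as [H1 H2]; [auto|]. rewrite IH by assumption.
      apply sat_ext. intros i _. unfold upd.
      destruct (Nat.eqb_spec i v), (Nat.eqb_spec i w); subst; try easy.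
      apply eval_ext. intros j Hj. destruct (Nat.eqb_spec j w); [|easy].
      subst. contradiction.
    + rewrite subst_not_free by assumption. apply sat_ext. intros i Hi.
      unfold upd. destruct (Nat.eqb_spec i v); subst; [contradiction|easy].
Qed.

Lemma sat_subst {M : model} v r p : forall e : nat -> M, free_for r v p ->
  (sat e (subst v r p) <-> sat (upd e v (eval e r)) p).
Proof.
  induction p; simpl; intros e H.
  - rewrite !eval_subst. tauto.
  - rewrite !eval_subst. tauto.
  - rewrite IHp; tauto.
  - rewrite IHp1, IHp2; tauto.
  - rewrite IHp1, IHp2; tauto.
  - split; intros [x Hx]; exists x; now apply sat_subst_under.
  - split; intros Hx x; now apply sat_subst_under.
Qed.

(** * Completeness of the sequent calculus *)

Fixpoint maxvar_term (t : term) : nat :=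
  match t with
  | Var i => i
  | Zero => 0
  | Succ s => maxvar_term s
  | Add s u | Mul s u | Elt s u => Nat.max (maxvar_term s) (maxvar_term u)
  end.

Fixpoint maxvar (p : form) : nat :=
  match p with
  | FEq s t => Nat.max (maxvar_term s) (maxvar_term t)
  | FTr t => maxvar_term t
  | FNeg a => maxvar a
  | FAnd a b | FOr a b => Nat.max (maxvar a) (maxvar b)
  | FEx v a | FAll v a => Nat.max v (maxvar a)
  end.

Lemma occurs_maxvar v t : occurs v t -> v <= maxvar_term t.
Proof.
  induction t; simpl; intros H; try lia; auto.
  all: destruct H as [H|H]; [apply IHt1 in H|apply IHt2 in H]; lia.
Qed.

Lemma free_maxvar v p : free v p -> v <= maxvar p.
Proof.
  induction p; simpl; intros H; auto using occurs_maxvar.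
  - destruct H as [H|H]; apply occurs_maxvar in H; lia.
  - destruct H as [H|H]; [apply IHp1 in H|apply IHp2 in H]; lia.
  - destruct H as [H|H]; [apply IHp1 in H|apply IHp2 in H]; lia.
  - destruct H as [_ H]. apply IHp in H. lia.
  - destruct H as [_ H]. apply IHp in H. lia.
Qed.

Lemma free_for_fresh w v p : maxvar p < w -> free_for (Var w) v p.
Proof.
  induction p; simpl; intros H; auto.
  all: try (split; [apply IHp1|apply IHp2]; lia).
  all: intros _; split; [lia|apply IHp; lia].
Qed.

Fixpoint size (p : form) : nat :=
  match p with
  | FEq _ _ | FTr _ => 0
  | FNeg a => S (size a)
  | FAnd a b | FOr a b => S (size a + size b)
  | FEx v a | FAll v a => S (size a)
  end.

Lemma size_subst v r p : size (subst v r p) = size p.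
Proof. induction p; simpl; try destruct (_ =? _); congruence. Qed.

Fixpoint term_code (t : term) : nat :=
  match t with
  | Var i => to_nat (0, i)
  | Zero => to_nat (1, 0)
  | Succ s => to_nat (2, term_code s)
  | Add s u => to_nat (3, to_nat (term_code s, term_code u))
  | Mul s u => to_nat (4, to_nat (term_code s, term_code u))
  | Elt s u => to_nat (5, to_nat (term_code s, term_code u))
  end.

Fixpoint form_code (p : form) : nat :=
  match p with
  | FEq s u => to_nat (0, to_nat (term_code s, term_code u))
  | FTr s => to_nat (1, term_code s)
  | FNeg a => to_nat (2, form_code a)
  | FAnd a b => to_nat (3, to_nat (form_code a, form_code b))
  | FOr a b => to_nat (4, to_nat (form_code a, form_code b))
  | FEx v a => to_nat (5, to_nat (v, form_code a))
  | FAll v a => to_nat (6, to_nat (v, form_code a))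
  end.

Local Opaque to_nat.

Ltac code_inj :=
  repeat match goal with
  | H : to_nat _ = to_nat _ |- _ => apply to_nat_inj in H
  | H : (_, _) = (_, _) |- _ => inversion H; clear H; subst
  end.

Lemma term_code_inj t : forall t', term_code t = term_code t' -> t = t'.
Proof.
  induction t; intros []; simpl; intros H; code_inj; f_equal; auto.
Qed.

Lemma form_code_inj p : forall p', form_code p = form_code p' -> p = p'.
Proof.
  induction p; intros []; simpl; intros H; code_inj; f_equal;
    auto using term_code_inj.
Qed.

Definition decode {A : Type} (code : A -> nat) (d : A) (n : nat) : A :=
  epsilon (inhabits d) (fun a => code a = n).

Lemma decode_code {A : Type} (code : A -> nat) d a :
  (forall a a', code a = code a' -> a = a') -> decode code d (code a) = a.
Proof.
  intros H. apply H. unfold decode.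
  apply (epsilon_spec (inhabits d) (fun a' => code a' = code a)). now exists a.
Qed.

(** Henkin's construction.  Variables serve as Henkin constants: a sequent
    contains finitely many variables, so a fresh one is always at hand. *)
Section Completeness.

Variable Th : form -> Prop.
Variable goal : form.
Hypothesis unprovable : ~ LK Th [] [goal].

Definition fresh (G D : list form) (p : form) : nat :=
  S (fold_right Nat.max 0 (map maxvar (p :: G ++ D))).

Lemma fresh_spec G D p q : In q (p :: G ++ D) -> maxvar q < fresh G D p.
Proof.
  unfold fresh. generalize (p :: G ++ D). intros l.
  induction l as [|a l IH]; simpl; [easy|].
  intros [->|H]; [lia|]. apply IH in H. lia.
Qed.

Definition enum_form : nat -> form := decode form_code (FEq Zero Zero).

(** A formula goes to the left if that leaves the sequent underivable, and to the
    right otherwise.  Instances with a fresh variable give every existential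
    formula on the left and every universal one on the right a witness. *)
Definition step (s : list form * list form) (p : form)
    : list form * list form :=
  let (G, D) := s in
  let w := fresh G D p in
  if excluded_middle_informative (LK Th (p :: G) D) then
    (G, match p with FAll v q => [subst v (Var w) q] | _ => [] end ++ p :: D)
  else
    (match p with FEx v q => [subst v (Var w) q] | _ => [] end ++ p :: G, D).

Fixpoint stage (n : nat) : list form * list form :=
  match n with
  | 0 => ([], [goal])
  | S n => step (stage n) (enum_form n)
  end.

Lemma stage_unprovable n : ~ LK Th (fst (stage n)) (snd (stage n)).
Proof.
  induction n as [|n IH]; [exact unprovable|].
  simpl. destruct (stage n) as [G D] eqn:E; simpl in *.
  set (p := enum_form n). set (w := fresh G D p).
  assert (Fw : forall q, In q (p :: G ++ D) -> ~ free w q).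
  { intros q Hq F. apply free_maxvar in F. apply (fresh_spec G D p) in Hq.
    unfold w in F. lia. }
  assert (Fp : maxvar p < w) by (apply fresh_spec; now left).
  destruct (excluded_middle_informative _) as [L|L]; simpl.
  - assert (NR : ~ LK Th G (p :: D)) by (intros H; apply IH; eapply LK_cut; eauto).
    destruct p; auto. intros H. apply NR.
    eapply LK_struct with (G' := G) (D' := FAll v p :: FAll v p :: D);
      [|apply incl_refl|intros x; simpl; tauto].
    apply LK_allR with w; auto.
    + apply free_for_fresh. simpl in Fp. lia.
    + intros q Hq. apply Fw. simpl in *. rewrite in_app_iff in *. simpl in Hq.
      tauto.
  - destruct p; auto. intros H. apply L.
    eapply LK_struct with (D' := D) (G' := FEx v p :: FEx v p :: G);
      [|intros x; simpl; tauto|apply incl_refl].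
    apply LK_exL with w; auto.
    + apply free_for_fresh. simpl in Fp. lia.
    + intros q Hq. apply Fw. simpl in *. rewrite in_app_iff in *. tauto.
Qed.

Lemma stage_mono n m : n <= m ->
  incl (fst (stage n)) (fst (stage m)) /\ incl (snd (stage n)) (snd (stage m)).
Proof.
  induction 1 as [|m H IH]; [split; apply incl_refl|].
  assert (incl (fst (stage m)) (fst (stage (S m))) /\
          incl (snd (stage m)) (snd (stage (S m)))) as [A B].
  { simpl. destruct (stage m) as [G D]. simpl.
    destruct (excluded_middle_informative _); simpl; split;
      try apply incl_refl; apply incl_appr, incl_tl, incl_refl. }
  split; eapply incl_tran; eauto; apply IH.
Qed.

Definition holds (p : form) : Prop := exists n, In p (fst (stage n)).
Definition fails (p : form) : Prop := exists n, In p (snd (stage n)).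

(** A derivation uses finitely many formulae, and these occur at one stage. *)
Lemma separated G D : (forall p, In p G -> holds p) ->
  (forall p, In p D -> fails p) -> ~ LK Th G D.
Proof.
  intros HG HD L.
  assert (A : exists n, incl G (fst (stage n))).
  { clear L. induction G as [|p G IH]; [exists 0; easy|].
    destruct IH as [n Hn]; [auto using in_cons|].
    destruct (HG p) as [m Hm]; [now left|]. exists (Nat.max n m).
    intros q [<-|Hq]; [apply (stage_mono m); [lia|easy]|].
    apply (stage_mono n); [lia|auto]. }
  assert (B : exists n, incl D (snd (stage n))).
  { clear L. induction D as [|p D IH]; [exists 0; easy|].
    destruct IH as [n Hn]; [auto using in_cons|].
    destruct (HD p) as [m Hm]; [now left|]. exists (Nat.max n m).
    intros q [<-|Hq]; [apply (stage_mono m); [lia|easy]|].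
    apply (stage_mono n); [lia|auto]. }
  destruct A as [n A], B as [m B]. apply (stage_unprovable (Nat.max n m)).
  eapply LK_struct; [exact L| |].
  - eapply incl_tran; [exact A|]. apply stage_mono. lia.
  - eapply incl_tran; [exact B|]. apply stage_mono. lia.
Qed.

Lemma decided p : holds p \/ fails p.
Proof.
  assert (E : enum_form (form_code p) = p)
    by (apply decode_code, form_code_inj).
  destruct (excluded_middle_informative
    (LK Th (p :: fst (stage (form_code p))) (snd (stage (form_code p))))) as [L|L];
    [right|left]; exists (S (form_code p)); simpl; rewrite E;
    destruct (stage (form_code p)) as [G D]; simpl in *;
    destruct (excluded_middle_informative _); try contradiction;
    simpl; apply in_or_app; right; now left.
Qed.

Lemma holds_not_fails p : holds p -> ~ fails p.
Proof.
  intros H F. apply (separated [p] [p]); try (intros q [<-|[]]; auto).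
  apply LK_id.
Qed.

Lemma fails_iff p : fails p <-> ~ holds p.
Proof. pose proof (decided p). pose proof (holds_not_fails p). tauto. Qed.

Lemma holds_closed G p : LK Th G [p] -> (forall q, In q G -> holds q) -> holds p.
Proof.
  intros L H. destruct (decided p) as [|F]; auto. exfalso.
  apply (separated G [p]); auto. intros q [<-|[]]; auto.
Qed.

Lemma holds_witness v q : holds (FEx v q) ->
  exists w, v < w /\ maxvar q < w /\ holds (subst v (Var w) q).
Proof.
  intros H. set (p := FEx v q) in *. set (n := form_code p).
  assert (E : enum_form n = p) by (apply decode_code, form_code_inj).
  assert (V : maxvar p < fresh (fst (stage n)) (snd (stage n)) p)
    by (apply fresh_spec; now left).
  exists (fresh (fst (stage n)) (snd (stage n)) p). split; [|split].
  - simpl in V. lia.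
  - simpl in V. lia.
  - exists (S n). simpl. rewrite E. unfold step.
    destruct (stage n) as [G D] eqn:S. simpl.
    destruct (excluded_middle_informative _) as [L|L]; simpl; [|auto].
    exfalso. apply (holds_not_fails p H). exists (1 + n). simpl. rewrite E, S.
    simpl. destruct (excluded_middle_informative _) as [L'|L']; [|contradiction].
    now left.
Qed.

Lemma fails_witness v q : fails (FAll v q) ->
  exists w, v < w /\ maxvar q < w /\ fails (subst v (Var w) q).
Proof.
  intros H. set (p := FAll v q) in *. set (n := form_code p).
  assert (E : enum_form n = p) by (apply decode_code, form_code_inj).
  assert (V : maxvar p < fresh (fst (stage n)) (snd (stage n)) p)
    by (apply fresh_spec; now left).
  exists (fresh (fst (stage n)) (snd (stage n)) p). split; [|split].
  - simpl in V. lia.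
  - simpl in V. lia.
  - exists (S n). simpl. rewrite E. unfold step.
    destruct (stage n) as [G D] eqn:S. simpl.
    destruct (excluded_middle_informative _) as [L|L]; simpl; [auto|].
    exfalso. apply (fails_iff p); [exact H|]. exists (1 + n). simpl. rewrite E, S.
    simpl. destruct (excluded_middle_informative _) as [L'|L']; [contradiction|].
    now left.
Qed.

Definition sim (s t : term) : Prop := holds (FEq s t).

Lemma sim_refl t : sim t t.
Proof. apply (holds_closed []); [apply LK_refl|easy]. Qed.

Lemma sim_rewrite p v s t : atomic p ->
  sim s t -> holds (subst v s p) -> holds (subst v t p).
Proof.
  intros A E H. apply (holds_closed [FEq s t; subst v s p]).
  - now apply LK_leibniz.
  - intros q [<-|[<-|[]]]; auto.
Qed.

Lemma sim_sym s t : sim s t -> sim t s.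
Proof.
  intros E. set (v := S (maxvar_term s)).
  assert (Ns : forall r, subst_term v r s = s).
  { intros r. apply subst_term_not_occurs. intros O. apply occurs_maxvar in O.
    unfold v in O. lia. }
  pose proof (sim_rewrite (FEq (Var v) s) v s t I E) as H. simpl in H.
  rewrite Nat.eqb_refl, !Ns in H. apply H, sim_refl.
Qed.

Lemma sim_trans s t u : sim s t -> sim t u -> sim s u.
Proof.
  intros E F. set (v := S (maxvar_term s)).
  assert (Ns : forall r, subst_term v r s = s).
  { intros r. apply subst_term_not_occurs. intros O. apply occurs_maxvar in O.
    unfold v in O. lia. }
  pose proof (sim_rewrite (FEq s (Var v)) v t u I F) as H. simpl in H.
  rewrite Nat.eqb_refl, !Ns in H. now apply H.
Qed.

(** The context f[ ] is given by a term c with a variable v for the hole; the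
    atomic formula to which the equality rule applies is f(s) = c. *)
Lemma sim_cong (f : term -> term) s t :
  (forall v, maxvar_term s < v -> maxvar_term (f s) < v ->
    exists c, forall r, subst_term v r c = f r) ->
  sim s t -> sim (f s) (f t).
Proof.
  intros H E. set (v := S (Nat.max (maxvar_term s) (maxvar_term (f s)))).
  destruct (H v) as [c Hc]; [lia|lia|].
  assert (Ns : forall r, subst_term v r (f s) = f s).
  { intros r. apply subst_term_not_occurs. intros O. apply occurs_maxvar in O.
    unfold v in O. lia. }
  pose proof (sim_rewrite (FEq (f s) c) v s t I E) as R. simpl in R.
  rewrite !Ns, !Hc in R. apply R, sim_refl.
Qed.

Lemma sim_succ s t : sim s t -> sim (Succ s) (Succ t).
Proof.
  apply (sim_cong Succ). intros v _ _. exists (Succ (Var v)). intros r. simpl.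
  now rewrite Nat.eqb_refl.
Qed.

Lemma sim_binary (op : term -> term -> term) s t s' t' :
  (forall v r a b, subst_term v r (op a b) =
     op (subst_term v r a) (subst_term v r b)) ->
  (forall a b, maxvar_term (op a b) = Nat.max (maxvar_term a) (maxvar_term b)) ->
  sim s t -> sim s' t' -> sim (op s s') (op t t').
Proof.
  intros Hs Hm E E'. apply sim_trans with (op t s').
  - apply (sim_cong (fun r => op r s')); [|easy]. intros v _ Hv. exists (op (Var v) s').
    intros r. rewrite Hs. simpl. rewrite Nat.eqb_refl. f_equal.
    apply subst_term_not_occurs. intros O. apply occurs_maxvar in O.
    rewrite Hm in Hv. lia.
  - apply (sim_cong (fun r => op t r)); [|easy]. intros v _ Hv. exists (op t (Var v)).
    intros r. rewrite Hs. simpl. rewrite Nat.eqb_refl. f_equal.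
    apply subst_term_not_occurs. intros O. apply occurs_maxvar in O.
    rewrite Hm in Hv. lia.
Qed.

(** Equivalence classes of terms are represented as predicates, so that equality in
    the model is Leibniz equality. *)
Definition class : Type := {P : term -> Prop | exists t, P = sim t}.

Definition cls (t : term) : class := exist _ (sim t) (ex_intro _ t eq_refl).

Lemma cls_eq s t : cls s = cls t <-> sim s t.
Proof.
  split.
  - intros E. apply (f_equal (@proj1_sig _ _)) in E. simpl in E.
    rewrite E. apply sim_refl.
  - intros E. unfold cls. apply subset_eq_compat.
    extensionality u. apply propositional_extensionality. split; intros H.
    + eapply sim_trans; [apply sim_sym|]; eauto.
    + eapply sim_trans; eauto.
Qed.

Definition repr (a : class) : term :=
  proj1_sig (constructive_indefinite_description _ (proj2_sig a)).

Lemma cls_repr a : cls (repr a) = a.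
Proof.
  unfold repr. destruct (constructive_indefinite_description _ _) as [t Ht].
  simpl. destruct a as [P HP]. simpl in *. unfold cls.
  now apply subset_eq_compat.
Qed.

Lemma sim_repr t : sim (repr (cls t)) t.
Proof. apply cls_eq, cls_repr. Qed.

Definition term_model : model := {|
  dom := class;
  m0 := cls Zero;
  mS a := cls (Succ (repr a));
  mA a b := cls (Add (repr a) (repr b));
  mM a b := cls (Mul (repr a) (repr b));
  mE a b := cls (Elt (repr a) (repr b));
  mT a := holds (FTr (repr a)) |}.

Definition canonical_env : nat -> term_model := fun i => cls (Var i).

Lemma eval_canonical t : eval canonical_env t = cls t.
Proof.
  induction t; simpl; auto; rewrite ?IHt, ?IHt1, ?IHt2; apply cls_eq;
    auto using sim_succ, sim_binary, sim_repr.
Qed.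

(** The formulae x_k = t, prefixed by an existential quantifier over x_k, are
    infinitely many true ones, and each gets a witness beyond k.  So quantifiers
    can be instantiated by variables, without capture. *)
Lemma large_variable a n : exists w, n < w /\ cls (Var w) = a.
Proof.
  set (t := repr a). set (k := S (Nat.max n (maxvar_term t))).
  assert (Nt : forall r, subst_term k r t = t).
  { intros r. apply subst_term_not_occurs. intros O. apply occurs_maxvar in O.
    unfold k in O. lia. }
  destruct (holds_witness k (FEq (Var k) t)) as (w & Hw & _ & E).
  - apply (holds_closed []); [|easy]. apply LK_exR with t; [exact I|].
    simpl. rewrite Nat.eqb_refl, Nt. apply LK_refl.
  - exists w. split; [lia|]. simpl in E. rewrite Nat.eqb_refl, Nt in E.
    rewrite <- (cls_repr a). now apply cls_eq.
Qed.

Lemma truth_lemma n : forall p, size p < n -> (holds p <-> sat canonical_env p).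
Proof.
  induction n as [|n IH]; intros p Hp; [lia|].
  destruct p; simpl in Hp; simpl.
  - rewrite !eval_canonical, cls_eq. easy.
  - rewrite eval_canonical. split; intros H.
    + pose proof (sim_rewrite (FTr (Var 0)) 0 t (repr (cls t)) I) as R.
      apply R; auto using sim_sym, sim_repr.
    + pose proof (sim_rewrite (FTr (Var 0)) 0 (repr (cls t)) t I) as R.
      apply R; auto using sim_sym, sim_repr.
  - rewrite <- IH by lia. split.
    + intros H1 H2. apply (separated [FNeg p; p] []); [|easy|].
      * intros q [<-|[<-|[]]]; auto.
      * apply LK_negL, LK_id.
    + intros H. rewrite <- fails_iff in H. destruct (decided (FNeg p)) as [|F]; auto.
      exfalso. apply (separated [] [FNeg p; p]); [easy| |].
      * intros q [<-|[<-|[]]]; auto.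
      * apply LK_negR, LK_id.
  - rewrite <- !IH by lia. split.
    + intros H. split.
      * apply (holds_closed [FAnd p1 p2]); [|intros q [<-|[]]; auto].
        apply LK_andL. eapply LK_struct; [apply (LK_id _ p1)| |apply incl_refl].
        intros x [<-|[]]; simpl; auto.
      * apply (holds_closed [FAnd p1 p2]); [|intros q [<-|[]]; auto].
        apply LK_andL. eapply LK_struct; [apply (LK_id _ p2)| |apply incl_refl].
        intros x [<-|[]]; simpl; auto.
    + intros [H1 H2]. apply (holds_closed [p1; p2]); [|intros q [<-|[<-|[]]]; auto].
      apply LK_andR; eapply LK_struct; try apply LK_id; try apply incl_refl;
        intros x [<-|[]]; simpl; auto.
  - rewrite <- !IH by lia. split.
    + intros H. apply NNPP. intros N.
      apply (separated [FOr p1 p2] [p1; p2]).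
      * intros q [<-|[]]; auto.
      * intros q [<-|[<-|[]]]; apply fails_iff; tauto.
      * apply LK_orL; eapply LK_struct; try apply LK_id; try apply incl_refl;
          intros x [<-|[]]; simpl; auto.
    + intros [H|H].
      * apply (holds_closed [p1]); [|intros q [<-|[]]; auto].
        apply LK_orR. eapply LK_struct; try apply LK_id; try apply incl_refl;
          intros x [<-|[]]; simpl; auto.
      * apply (holds_closed [p2]); [|intros q [<-|[]]; auto].
        apply LK_orR. eapply LK_struct; try apply LK_id; try apply incl_refl;
          intros x [<-|[]]; simpl; auto.
  - assert (E : forall w, maxvar p < w ->
        (holds (subst v (Var w) p) <-> sat (upd canonical_env v (cls (Var w))) p)).
    { intros w Hw. rewrite IH by (rewrite size_subst; lia).
      rewrite sat_subst by now apply free_for_fresh. easy. }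
    split.
    + intros H. apply holds_witness in H as (w & _ & Hw & H).
      exists (cls (Var w)). apply E; auto.
    + intros [a Ha]. destruct (large_variable a (maxvar p)) as (w & Hw & <-).
      apply E in Ha; auto.
      apply (holds_closed [subst v (Var w) p]); [|intros q [<-|[]]; auto].
      apply LK_exR with (Var w); [now apply free_for_fresh|apply LK_id].
  - assert (E : forall w, maxvar p < w ->
        (holds (subst v (Var w) p) <-> sat (upd canonical_env v (cls (Var w))) p)).
    { intros w Hw. rewrite IH by (rewrite size_subst; lia).
      rewrite sat_subst by now apply free_for_fresh. easy. }
    split.
    + intros H a. destruct (large_variable a (maxvar p)) as (w & Hw & <-).
      apply E; auto.
      apply (holds_closed [FAll v p]); [|intros q [<-|[]]; auto].
      apply LK_allL with (Var w); [now apply free_for_fresh|apply LK_id].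
    + intros H. apply NNPP. intros N. apply fails_iff in N.
      apply fails_witness in N as (w & _ & Hw & N). apply fails_iff in N.
      apply N, E; auto.
Qed.

Lemma term_model_theory p : Th p -> sat canonical_env p.
Proof.
  intros H. apply (truth_lemma (S (size p))); [lia|].
  apply (holds_closed []); [now apply LK_ax|easy].
Qed.

Lemma term_model_goal : ~ sat canonical_env goal.
Proof.
  rewrite <- (truth_lemma (S (size goal))) by lia. apply fails_iff.
  exists 0. now left.
Qed.

Lemma term_model_countable : exists f : nat -> term_model, forall a, exists n, f n = a.
Proof.
  exists (fun n => cls (decode term_code Zero n)). intros a.
  exists (term_code (repr a)). rewrite decode_code by exact term_code_inj.
  apply cls_repr.
Qed.

End Completeness.

(** The model is countable so that, under a fixed enumeration, every element
    is the value of a variable, hence available as a parameter in induction. *)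
Theorem completeness (Th : form -> Prop) (p : form) :
  (forall (M : model) (e : nat -> M) (f : nat -> M),
    (forall a, exists n, f n = a) -> (forall q, Th q -> sat e q) -> sat e p) ->
  proves Th p.
Proof.
  intros H. apply NNPP. intros U. apply (term_model_goal Th p U).
  destruct (term_model_countable Th p) as [f Hf].
  apply (H _ _ f Hf). intros q. now apply term_model_theory.
Qed.

(** * Definable predicates *)

Class Enumerated (M : model) := {
  rho : nat -> M;
  rho_surj : forall a, exists n, rho n = a }.

Section Definability.

Context {M : model} {EM : Enumerated M}.

(** A context stands for the elements bound by the enclosing quantifiers.  For
    given K, the variables below K are reserved for parameters and hold the values
    given by rho, and those from K to the level hold the elements of the
    context.  The level also is the index that the next quantifier binds, as in the
    notation for object formulae. *)
Record ctx : Type := Ctx {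
  car : Type;
  lvl : nat -> nat;
  ag : nat -> (nat -> M) -> car -> Prop;
  lvl_ge : forall K, K <= lvl K;
  ag_rho : forall K e c v, ag K e c -> v < K -> e v = rho v }.

Definition base : ctx.
Proof.
  refine {| car := unit; lvl K := K; ag K e _ := forall v, v < K -> e v = rho v |}.
  - auto.
  - auto.
Defined.

Definition ext (X : ctx) : ctx.
Proof.
  refine {| car := car X * M; lvl K := S (lvl X K);
    ag K e c := e (lvl X K) = snd c /\
      exists e', ag X K e' (fst c) /\ forall v, v < lvl X K -> e v = e' v |}.
  - intros K. pose proof (lvl_ge X K). lia.
  - intros K e c v (_ & e' & A & E) Hv. pose proof (lvl_ge X K).
    rewrite E by lia. now apply (ag_rho X K e' (fst c)).
Defined.

Lemma ag_ext X K e c y : ag X K e c -> ag (ext X) K (upd e (lvl X K) y) (c, y).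
Proof.
  intros A. simpl. split; [apply upd_same|]. exists e. split; [easy|].
  intros v Hv. apply upd_other. lia.
Qed.

(** Projections from a context to a shorter one. *)
Definition Mor (Y X : ctx) (g : car Y -> car X) : Prop :=
  forall K, lvl X K <= lvl Y K /\ forall e c, ag Y K e c ->
    exists e', ag X K e' (g c) /\ forall v, v < lvl X K -> e v = e' v.

Lemma Mor_id X : Mor X X (fun c => c).
Proof. intros K. split; [easy|]. intros e c A. now exists e. Qed.

Lemma Mor_fst X Y g : Mor X (ext Y) g -> Mor X Y (fun c => fst (g c)).
Proof.
  intros H K. destruct (H K) as [L A]. simpl in L. split; [lia|].
  intros e c Ac. destruct (A e c Ac) as (e' & (_ & e'' & A' & E') & E).
  exists e''. split; [easy|]. intros v Hv. rewrite E by (simpl; lia). auto.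
Qed.

Lemma Mor_trans X Y Z g h : Mor X Y g -> Mor Y Z h -> Mor X Z (fun c => h (g c)).
Proof.
  intros G H K. destruct (G K) as [L A], (H K) as [L' A']. split; [lia|].
  intros e c Ac. destruct (A e c Ac) as (e' & Ae' & E).
  destruct (A' e' _ Ae') as (e'' & Ae'' & E'). exists e''. split; [easy|].
  intros v Hv. rewrite E by lia. auto.
Qed.

(** Definability by an L+-formula with parameters.  A formula has finitely many
    parameters, so they are among the variables below K once K is large. *)
Definition Def (X : ctx) (P : car X -> Prop) : Prop :=
  exists K0, forall K, K0 <= K -> exists p, Lplus_form p /\
    forall e c, ag X K e c -> (sat e p <-> P c).

(** A function is definable if its graph is.  Quantifying over all extensions Y of
    the context builds in weakening, which is used when functions are composed:
    composition introduces quantifiers for the intermediate values. *)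
Definition DF (X : ctx) (f : car X -> M) : Prop :=
  forall Y g, Mor Y X g -> Def (ext Y) (fun c => f (g (fst c)) = snd c).

Definition Definable1 (P : M -> Prop) : Prop :=
  forall X f, DF X f -> Def X (fun c => P (f c)).
Definition Definable2 (P : M -> M -> Prop) : Prop :=
  forall X f g, DF X f -> DF X g -> Def X (fun c => P (f c) (g c)).
Definition Definable3 (P : M -> M -> M -> Prop) : Prop :=
  forall X f g h, DF X f -> DF X g -> DF X h -> Def X (fun c => P (f c) (g c) (h c)).
Definition DefinableF (F : M -> M) : Prop :=
  forall X f, DF X f -> DF X (fun c => F (f c)).

Definition Definable4 (P : M -> M -> M -> M -> Prop) : Prop :=
  forall X f g h k, DF X f -> DF X g -> DF X h -> DF X k ->
    Def X (fun c => P (f c) (g c) (h c) (k c)).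
Definition DefinableF2 (F : M -> M -> M) : Prop :=
  forall X f g, DF X f -> DF X g -> DF X (fun c => F (f c) (g c)).

Lemma Def_app1 P X f : Definable1 P -> DF X f -> Def X (fun c => P (f c)).
Proof. auto. Qed.
Lemma Def_app2 P X f g : Definable2 P -> DF X f -> DF X g ->
  Def X (fun c => P (f c) (g c)).
Proof. auto. Qed.
Lemma Def_app3 P X f g h : Definable3 P -> DF X f -> DF X g -> DF X h ->
  Def X (fun c => P (f c) (g c) (h c)).
Proof. auto. Qed.
Lemma Def_app4 P X f g h k : Definable4 P -> DF X f -> DF X g -> DF X h ->
  DF X k -> Def X (fun c => P (f c) (g c) (h c) (k c)).
Proof. auto. Qed.
Lemma DF_app1 F X f : DefinableF F -> DF X f -> DF X (fun c => F (f c)).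
Proof. auto. Qed.
Lemma DF_app2 F X f g : DefinableF2 F -> DF X f -> DF X g ->
  DF X (fun c => F (f c) (g c)).
Proof. auto. Qed.

Lemma Def_iff X P Q : (forall c, P c <-> Q c) -> Def X P -> Def X Q.
Proof.
  intros E [K0 H]. exists K0. intros K HK. destruct (H K HK) as (p & L & S).
  exists p. split; [easy|]. intros e c A. rewrite <- E. auto.
Qed.

Lemma Def_not X P : Def X P -> Def X (fun c => ~ P c).
Proof.
  intros [K0 H]. exists K0. intros K HK. destruct (H K HK) as (p & L & S).
  exists (FNeg p). split; [easy|]. intros e c A. simpl. now rewrite (S e c A).
Qed.

Lemma Def_and X P Q : Def X P -> Def X Q -> Def X (fun c => P c /\ Q c).
Proof.
  intros [K0 H] [K1 H']. exists (Nat.max K0 K1). intros K HK.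
  destruct (H K) as (p & L & S); [lia|]. destruct (H' K) as (p' & L' & S'); [lia|].
  exists (FAnd p p'). split; [easy|]. intros e c A. simpl.
  now rewrite (S e c A), (S' e c A).
Qed.

Lemma Def_or X P Q : Def X P -> Def X Q -> Def X (fun c => P c \/ Q c).
Proof.
  intros [K0 H] [K1 H']. exists (Nat.max K0 K1). intros K HK.
  destruct (H K) as (p & L & S); [lia|]. destruct (H' K) as (p' & L' & S'); [lia|].
  exists (FOr p p'). split; [easy|]. intros e c A. simpl.
  now rewrite (S e c A), (S' e c A).
Qed.

Lemma Def_imp X P Q : Def X P -> Def X Q -> Def X (fun c => P c -> Q c).
Proof.
  intros H H'. apply Def_iff with (fun c => ~ P c \/ Q c).
  - intros c. tauto.
  - auto using Def_or, Def_not.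
Qed.

Lemma Def_equiv X P Q : Def X P -> Def X Q -> Def X (fun c => P c <-> Q c).
Proof. intros H H'. unfold iff. auto using Def_and, Def_imp. Qed.

Lemma Def_ex X (P : car X -> M -> Prop) :
  Def (ext X) (fun c => P (fst c) (snd c)) -> Def X (fun c => exists y, P c y).
Proof.
  intros [K0 H]. exists K0. intros K HK. destruct (H K HK) as (p & L & S).
  exists (FEx (lvl X K) p). split; [easy|]. intros e c A. simpl.
  split; intros [y Hy]; exists y; now apply (S _ _ (ag_ext X K e c y A)).
Qed.

Lemma Def_all X (P : car X -> M -> Prop) :
  Def (ext X) (fun c => P (fst c) (snd c)) -> Def X (fun c => forall y, P c y).
Proof.
  intros H. apply Def_iff with (fun c => ~ exists y, ~ P c y).
  - intros c. split.
    + intros N y. apply NNPP. intros Q. apply N. now exists y.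
    + intros N [y Hy]. auto.
  - auto using Def_not, Def_ex.
Qed.

Lemma Def_const X (P : Prop) : Def X (fun _ => P).
Proof.
  exists 0. intros K _. destruct (classic P).
  - exists (FEq Zero Zero). split; [easy|]. simpl. easy.
  - exists (FNeg (FEq Zero Zero)). split; [easy|]. simpl. tauto.
Qed.

Definition DT (X : ctx) (f : car X -> M) : Prop :=
  exists K0, forall K, K0 <= K -> exists t,
    (forall v, occurs v t -> v < lvl X K) /\
    forall e c, ag X K e c -> eval e t = f c.

Lemma DT_mor X Y f g : DT X f -> Mor Y X g -> DT Y (fun c => f (g c)).
Proof.
  intros [K0 H] G. exists K0. intros K HK. destruct (H K HK) as (t & L & E).
  destruct (G K) as [LG A]. exists t. split.
  - intros v Hv. apply L in Hv. lia.
  - intros e c Ac. destruct (A e c Ac) as (e' & Ae' & Ee).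
    rewrite <- (E e' _ Ae'). apply eval_ext. auto.
Qed.

Lemma DT_snd X Y g : Mor X (ext Y) g -> DT X (fun c => snd (g c)).
Proof.
  intros H. apply (DT_mor (ext Y) X (fun c => snd c)); [|easy].
  exists 0. intros K _. exists (Var (lvl Y K)). split; simpl.
  - intros v <-. lia.
  - intros e c [E _]. exact E.
Qed.

Lemma DT_const X a : DT X (fun _ => a).
Proof.
  destruct (rho_surj a) as [n Hn]. exists (S n). intros K HK. exists (Var n).
  pose proof (lvl_ge X K). split; simpl.
  - intros v <-. lia.
  - intros e c A. rewrite <- Hn. now apply (ag_rho X K e c).
Qed.

Lemma DT_succ X f : DT X f -> DT X (fun c => mS (f c)).
Proof.
  intros [K0 H]. exists K0. intros K HK. destruct (H K HK) as (t & L & E).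
  exists (Succ t). split; [easy|]. intros e c A. simpl. now rewrite (E e c A).
Qed.

Lemma DT_binary (op : term -> term -> term) (F : M -> M -> M) X f g :
  (forall v s t, occurs v (op s t) -> occurs v s \/ occurs v t) ->
  (forall (e : nat -> M) s t, eval e (op s t) = F (eval e s) (eval e t)) ->
  DT X f -> DT X g -> DT X (fun c => F (f c) (g c)).
Proof.
  intros Ho He [K0 H] [K1 H']. exists (Nat.max K0 K1). intros K HK.
  destruct (H K) as (t & L & E); [lia|]. destruct (H' K) as (t' & L' & E'); [lia|].
  exists (op t t'). split.
  - intros v Hv. apply Ho in Hv. destruct Hv; auto.
  - intros e c A. now rewrite He, (E e c A), (E' e c A).
Qed.

Lemma DT_eq X f g : DT X f -> DT X g -> Def X (fun c => f c = g c).
Proof.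
  intros [K0 H] [K1 H']. exists (Nat.max K0 K1). intros K HK.
  destruct (H K) as (t & L & E); [lia|]. destruct (H' K) as (t' & L' & E'); [lia|].
  exists (FEq t t'). split; [exact I|]. intros e c A. simpl.
  now rewrite (E e c A), (E' e c A).
Qed.

Lemma DF_term X f : DT X f -> DF X f.
Proof.
  intros H Y g G. apply (DT_eq (ext Y)).
  - apply DT_mor with (g := fun c : car (ext Y) => g (fst c)) in H; [exact H|].
    apply (Mor_trans (ext Y) Y X (fun c => fst c)); [|easy].
    apply (Mor_fst (ext Y) Y (fun c => c)), Mor_id.
  - apply (DT_snd (ext Y) Y (fun c => c)), Mor_id.
Qed.

Lemma DF_mor X Y f g : DF X f -> Mor Y X g -> DF Y (fun c => f (g c)).
Proof.
  intros H G Z h Hh. apply (H Z (fun c => g (h c))).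
  eapply Mor_trans; eauto.
Qed.

Lemma DF_snd X Y g : Mor X (ext Y) g -> DF X (fun c => snd (g c)).
Proof. intros H. eapply DF_term, DT_snd; eauto. Qed.

Lemma DF_last X : DF (ext X) snd.
Proof. exact (DF_snd (ext X) X (fun c => c) (Mor_id _)). Qed.

Lemma DF_const X a : DF X (fun _ => a).
Proof. apply DF_term, DT_const. Qed.

Lemma Def_let X f (P : car X -> M -> Prop) : DF X f ->
  Def (ext X) (fun c => P (fst c) (snd c)) -> Def X (fun c => P c (f c)).
Proof.
  intros H HP. apply Def_iff with (fun c => exists y, f c = y /\ P c y).
  - intros c. split; [intros (y & <- & Hy); exact Hy|intros Hy; now exists (f c)].
  - apply Def_ex. apply Def_and; [|exact HP].
    exact (H X (fun c => c) (Mor_id X)).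
Qed.

(** The values of definable functions may be taken to be variables. *)
Lemma Def_lift2 (P : M -> M -> Prop) :
  (forall X f g, DT X f -> DT X g -> Def X (fun c => P (f c) (g c))) -> Definable2 P.
Proof.
  intros H X f g Hf Hg. apply (Def_let X f (fun c y => P y (g c))); [easy|].
  apply (Def_let (ext X) (fun c => g (fst c)) (fun c y => P (snd c) y)).
  - apply (DF_mor X (ext X) g (fun c => fst c)); [easy|].
    apply (Mor_fst (ext X) X (fun c => c)), Mor_id.
  - apply H.
    + apply (DT_snd (ext (ext X)) X (fun c => fst c)).
      apply (Mor_fst (ext (ext X)) (ext X) (fun c => c)), Mor_id.
    + apply (DT_snd (ext (ext X)) (ext X) (fun c => c)), Mor_id.
Qed.

Lemma Def_lift3 (P : M -> M -> M -> Prop) :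
  (forall X f g h, DT X f -> DT X g -> DT X h ->
    Def X (fun c => P (f c) (g c) (h c))) -> Definable3 P.
Proof.
  intros H X f g h Hf Hg Hh.
  apply (Def_let X f (fun c y => P y (g c) (h c))); [easy|].
  assert (M1 : Mor (ext X) X (fun c => fst c))
    by (apply (Mor_fst (ext X) X (fun c => c)), Mor_id).
  assert (M2 : Mor (ext (ext X)) (ext X) (fun c => fst c))
    by (apply (Mor_fst (ext (ext X)) (ext X) (fun c => c)), Mor_id).
  assert (M3 : Mor (ext (ext (ext X))) (ext (ext X)) (fun c => fst c))
    by (apply (Mor_fst (ext (ext (ext X))) (ext (ext X)) (fun c => c)), Mor_id).
  apply (Def_let (ext X) (fun c => g (fst c)) (fun c y => P (snd c) y (h (fst c)))).
  - now apply (DF_mor X (ext X) g (fun c => fst c)).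
  - apply (Def_let (ext (ext X)) (fun c => h (fst (fst c)))
      (fun c y => P (snd (fst c)) (snd c) y)).
    + apply (DF_mor X (ext (ext X)) h (fun c => fst (fst c))); [easy|].
      now apply (Mor_trans (ext (ext X)) (ext X) X (fun c => fst c) (fun c => fst c)).
    + apply H.
      * apply (DT_snd (ext (ext (ext X))) X (fun c => fst (fst c))).
        now apply (Mor_trans (ext (ext (ext X))) (ext (ext X)) (ext X)
          (fun c => fst c) (fun c => fst c)).
      * apply (DT_snd (ext (ext (ext X))) (ext X) (fun c => fst c)). exact M3.
      * apply (DT_snd (ext (ext (ext X))) (ext (ext X)) (fun c => c)), Mor_id.
Qed.

Lemma Def_eq : Definable2 (fun x y => x = y).
Proof. apply Def_lift2. intros. now apply DT_eq. Qed.

Lemma DF_graph1 F : Definable2 (fun x y => F x = y) -> DefinableF F.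
Proof.
  intros H X f Hf Y g G.
  apply (H (ext Y) (fun c => f (g (fst c))) (fun c => snd c)).
  - apply (DF_mor X (ext Y) f (fun c => g (fst c))); [easy|].
    apply (Mor_trans (ext Y) Y X (fun c => fst c)); [|easy].
    apply (Mor_fst (ext Y) Y (fun c => c)), Mor_id.
  - apply (DF_snd (ext Y) Y (fun c => c)), Mor_id.
Qed.

Lemma DF_graph2 (F : M -> M -> M) :
  Definable3 (fun x y z => F x y = z) -> DefinableF2 F.
Proof.
  intros H X f g Hf Hg Y h G.
  assert (Mor (ext Y) X (fun c => h (fst c))).
  { apply (Mor_trans (ext Y) Y X (fun c => fst c)); [|easy].
    apply (Mor_fst (ext Y) Y (fun c => c)), Mor_id. }
  apply (H (ext Y) (fun c => f (h (fst c))) (fun c => g (h (fst c))) (fun c => snd c)).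
  - now apply (DF_mor X (ext Y) f (fun c => h (fst c))).
  - now apply (DF_mor X (ext Y) g (fun c => h (fst c))).
  - apply (DF_snd (ext Y) Y (fun c => c)), Mor_id.
Qed.

Lemma DF_succ : DefinableF mS.
Proof.
  apply DF_graph1, Def_lift2. intros. apply DT_eq; auto using DT_succ.
Qed.

Lemma DF_add X f g : DF X f -> DF X g -> DF X (fun c => mA (f c) (g c)).
Proof.
  apply DF_graph2, Def_lift3. intros. apply DT_eq; auto.
  now apply (DT_binary Add).
Qed.

Lemma DF_mul X f g : DF X f -> DF X g -> DF X (fun c => mM (f c) (g c)).
Proof.
  apply DF_graph2, Def_lift3. intros. apply DT_eq; auto.
  now apply (DT_binary Mul).
Qed.

Lemma DF_elt X f g : DF X f -> DF X g -> DF X (fun c => mE (f c) (g c)).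
Proof.
  apply DF_graph2, Def_lift3. intros. apply DT_eq; auto.
  now apply (DT_binary Elt).
Qed.

(** Definite description, with default 0; the default is part of the graph, so
    that iota of a definable relation is a definable function. *)
Definition iota (R : M -> Prop) : M :=
  epsilon (inhabits m0) (fun y => (R y /\ forall z, R z -> z = y) \/
    (~ (exists y, R y /\ forall z, R z -> z = y) /\ y = m0)).

Lemma iota_graph R y : iota R = y <-> (R y /\ forall z, R z -> z = y) \/
  (~ (exists y, R y /\ forall z, R z -> z = y) /\ y = m0).
Proof.
  assert (E : exists y, (R y /\ forall z, R z -> z = y) \/
    (~ (exists y, R y /\ forall z, R z -> z = y) /\ y = m0)).
  { destruct (classic (exists y, R y /\ forall z, R z -> z = y)) as [[x Hx]|N].
    - exists x. now left.
    - exists m0. now right. }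
  unfold iota. pose proof (epsilon_spec (inhabits m0) _ E) as S. simpl in S.
  split; [intros <-; exact S|].
  intros H. destruct S as [[S1 S2]|[S1 S2]], H as [[H1 H2]|[H1 H2]].
  - auto.
  - exfalso. eauto.
  - exfalso. eauto.
  - congruence.
Qed.

Lemma iota_eq (R : M -> Prop) y : R y -> (forall z, R z -> z = y) -> iota R = y.
Proof. intros H U. apply iota_graph. now left. Qed.

Lemma iota_spec (R : M -> Prop) :
  (exists y, R y) -> (forall y z, R y -> R z -> y = z) -> R (iota R).
Proof.
  intros [y Hy] U. rewrite (iota_eq R y); eauto.
Qed.

End Definability.

Arguments ctx M {EM}.

Create HintDb def discriminated.

Ltac mor := repeat first [ apply Mor_id | simple eapply Mor_fst ].
Ltac def_known := solve [ assumption | auto with def nocore ].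

(** Proves definability by recursion on the predicate.  Notions known to be
   definable are looked up in the context and in the database [def]. *)
Ltac def_step :=
  match goal with
  | |- Def _ (fun _ => ~ _) => apply Def_not
  | |- Def _ (fun _ => _ /\ _) => apply Def_and
  | |- Def _ (fun _ => _ \/ _) => apply Def_or
  | |- Def _ (fun _ => _ <-> _) => apply Def_equiv
  | |- Def _ (fun _ => exists _, _) => apply Def_ex; cbv beta
  | |- Def _ (fun _ => _ = _) => apply Def_eq
  | |- Def _ (fun _ => ?P _ _ _ _) => apply (Def_app4 P); [def_known| | | |]
  | |- Def _ (fun _ => ?P _ _ _) => apply (Def_app3 P); [def_known| | |]
  | |- Def _ (fun _ => ?P _ _) => apply (Def_app2 P); [def_known| |]
  | |- Def _ (fun _ => ?P _) => apply (Def_app1 P); [def_known|]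
  | |- Def _ (fun _ => _) => apply Def_const
  | |- Def _ (fun _ => _ -> _) => apply Def_imp
  | |- Def _ (fun _ => forall _, _) => apply Def_all; cbv beta
  | |- DF _ snd => apply DF_last
  | |- DF _ (fun _ => _) => apply DF_const
  | H : DF ?X ?f |- DF ?X ?f => exact H
  | |- DF _ (fun _ => snd _) => solve [eapply DF_snd; mor]
  | H : DF _ ?f |- DF _ (fun _ => ?f _) => solve [eapply (DF_mor _ _ _ _ H); mor]
  | |- DF _ (fun _ => mA _ _) => apply DF_add
  | |- DF _ (fun _ => mM _ _) => apply DF_mul
  | |- DF _ (fun _ => mE _ _) => apply DF_elt
  | |- DF _ (fun _ => ?F _ _) => apply (DF_app2 F); [def_known| |]
  | |- DF _ (fun _ => ?F _) => apply (DF_app1 F); [def_known|]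
  end.
Ltac def := intros; hnf; intros; cbv beta; repeat def_step.

#[export] Hint Resolve DF_succ : def.

(** * Arithmetic in a model *)

Declare Scope dom_scope.
Delimit Scope dom_scope with M.
Notation "0" := (@m0 _) : dom_scope.
Notation "1" := (mS m0) : dom_scope.
Notation "x + y" := (mA x y) : dom_scope.
Notation "x * y" := (mM x y) : dom_scope.

Definition mle {M : model} (x y : M) : Prop := exists z, mA x z = y.
Definition mlt {M : model} (x y : M) : Prop := mle (mS x) y.
Notation "x <= y" := (mle x y) : dom_scope.
Notation "x < y" := (mlt x y) : dom_scope.

Definition mpair {M : model} (x y : M) : M :=
  mA (mM (mA x y) (mA x y)) x.

Definition mLh {M : model} (x n : M) : Prop :=
  exists a b, x = mpair n (mpair a b).

Definition mpi {M : model} (x y z : M) : Prop :=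
  (exists n a b, x = mpair n (mpair a b) /\ mlt y n /\
     mlt z (mS (mM (mS y) b)) /\
     exists q, a = mA (mM q (mS (mM (mS y) b))) z) \/
  (~ (exists n a b, x = mpair n (mpair a b) /\ mlt y n) /\ z = m0).

Class PAmodel (M : model) {EM : Enumerated M} := {
  pa_S0 : forall x : M, mS x <> m0;
  pa_S_inj : forall x y : M, mS x = mS y -> x = y;
  pa_add0 : forall x : M, mA x m0 = x;
  pa_addS : forall x y : M, mA x (mS y) = mS (mA x y);
  pa_mul0 : forall x : M, mM x m0 = m0;
  pa_mulS : forall x y : M, mM x (mS y) = mA (mM x y) x;
  pa_ind : forall P : M -> Prop, Definable1 P ->
    P m0 -> (forall x, P x -> P (mS x)) -> forall x, P x;
  pa_elt : forall x y z : M, mE x y = z <-> mpi x y z }.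

Local Open Scope dom_scope.

Ltac ind x := pattern x; revert x; apply pa_ind; [def| |].

Section Arithmetic.

Context {M : model} {EM : Enumerated M} {PA : PAmodel M}.
Implicit Types x y z a b c m n : M.

Lemma D_le : Definable2 (@mle M).
Proof. unfold mle. def. Qed.
#[local] Hint Resolve D_le : def.
Lemma D_lt : Definable2 (@mlt M).
Proof. unfold mlt. def. Qed.
Lemma D_pair : DefinableF2 (@mpair M).
Proof. unfold mpair. def. Qed.
#[local] Hint Resolve D_lt D_pair : def.
Lemma D_Lh : Definable2 (@mLh M).
Proof. unfold mLh. def. Qed.
#[local] Hint Resolve D_Lh : def.

Lemma add_0_l x : 0 + x = x.
Proof. ind x; [apply pa_add0|]. intros x H. now rewrite pa_addS, H. Qed.

Lemma add_S_l x y : mS x + y = mS (x + y).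
Proof. ind y; [now rewrite !pa_add0|]. intros y H. now rewrite !pa_addS, H. Qed.

Lemma addC x y : x + y = y + x.
Proof.
  ind y; [now rewrite pa_add0, add_0_l|]. intros y H.
  now rewrite pa_addS, add_S_l, H.
Qed.

Lemma addA x y z : x + (y + z) = x + y + z.
Proof. ind z; [now rewrite !pa_add0|]. intros z H. now rewrite !pa_addS, H. Qed.

Lemma mul_0_l x : 0 * x = 0.
Proof. ind x; [apply pa_mul0|]. intros x H. now rewrite pa_mulS, H, pa_add0. Qed.

Lemma mul_S_l x y : mS x * y = x * y + y.
Proof.
  ind y; [now rewrite !pa_mul0, pa_add0|]. intros y H.
  rewrite !pa_mulS, H, !pa_addS, <- !addA. now rewrite (addC y x).
Qed.

Lemma mulC x y : x * y = y * x.
Proof.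
  ind y; [now rewrite pa_mul0, mul_0_l|]. intros y H. now rewrite pa_mulS, mul_S_l, H.
Qed.

Lemma mulDr x y z : x * (y + z) = x * y + x * z.
Proof.
  ind z; [now rewrite pa_mul0, !pa_add0|]. intros z H.
  now rewrite pa_addS, !pa_mulS, H, addA.
Qed.

Lemma mulA x y z : x * (y * z) = x * y * z.
Proof.
  ind z; [now rewrite !pa_mul0|]. intros z H. now rewrite !pa_mulS, mulDr, H.
Qed.

Lemma S_add1 x : mS x = x + 1.
Proof. now rewrite pa_addS, pa_add0. Qed.

Lemma dom_semiring : semi_ring_theory 0 1 (@mA M) (@mM M) (@eq M).
Proof.
  constructor; auto using add_0_l, addC, addA, mul_0_l, mulC, mulA.
  - intros n. now rewrite mul_S_l, mul_0_l, add_0_l.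
  - intros n m p. now rewrite mulC, mulDr, !(mulC p).
Qed.

Add Ring dom_ring : dom_semiring.

Ltac mring :=
  repeat match goal with
  | |- context [mS ?x] => lazymatch x with m0 => fail | _ => rewrite (S_add1 x) end
  end; ring.

Lemma add_cancel_l x y z : x + y = x + z -> y = z.
Proof.
  ind x; [now rewrite !add_0_l|]. intros x H E. apply H.
  rewrite !add_S_l in E. now apply pa_S_inj.
Qed.

Lemma zero_or_succ x : x = 0 \/ exists y, x = mS y.
Proof. ind x; [now left|]. intros x _. right. now exists x. Qed.

Lemma add_eq_0 x y : x + y = 0 -> x = 0 /\ y = 0.
Proof.
  intros E. destruct (zero_or_succ y) as [->|[z ->]].
  - now rewrite pa_add0 in E.
  - rewrite pa_addS in E. now apply pa_S0 in E.
Qed.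

Lemma le_refl x : x <= x.
Proof. exists 0. apply pa_add0. Qed.

Lemma le_add x y : x <= x + y.
Proof. now exists y. Qed.

Lemma le_add_l x y : x <= y + x.
Proof. exists y. mring. Qed.

Lemma le_0 x : 0 <= x.
Proof. exists x. apply add_0_l. Qed.

Lemma le_trans x y z : x <= y -> y <= z -> x <= z.
Proof. intros [u <-] [v <-]. exists (u + v). mring. Qed.

Lemma le_antisym x y : x <= y -> y <= x -> x = y.
Proof.
  intros [u <-] [v E]. rewrite <- addA in E.
  assert (E' : u + v = 0) by (apply (add_cancel_l x); now rewrite pa_add0).
  apply add_eq_0 in E' as [-> _]. now rewrite pa_add0.
Qed.

Lemma lt_irrefl x : ~ x < x.
Proof.
  intros [u E]. rewrite add_S_l, <- pa_addS in E.
  apply (pa_S0 u), (add_cancel_l x). now rewrite pa_add0.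
Qed.

Lemma lt_le x y : x < y -> x <= y.
Proof. intros [u <-]. exists (mS u). mring. Qed.

Lemma le_lt_trans x y z : x <= y -> y < z -> x < z.
Proof. intros [u <-] [v <-]. exists (u + v). mring. Qed.

Lemma lt_le_trans x y z : x < y -> y <= z -> x < z.
Proof. intros [u <-] [v <-]. exists (u + v). mring. Qed.

Lemma lt_trans x y z : x < y -> y < z -> x < z.
Proof. intros H. apply le_lt_trans. now apply lt_le. Qed.

Lemma lt_S x : x < mS x.
Proof. apply le_refl. Qed.

Lemma lt_S_le x y : x < mS y <-> x <= y.
Proof.
  split; intros [u E].
  - exists u. rewrite add_S_l in E. now apply pa_S_inj.
  - exists u. now rewrite add_S_l, E.
Qed.

Lemma le_lteq x y : x <= y -> x < y \/ x = y.
Proof.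
  intros [u <-]. destruct (zero_or_succ u) as [->|[v ->]].
  - right. now rewrite pa_add0.
  - left. exists v. mring.
Qed.

Lemma lt_S_cases x y : x < mS y -> x < y \/ x = y.
Proof. intros H. apply le_lteq, lt_S_le, H. Qed.

Lemma le_or_lt x y : x <= y \/ y < x.
Proof.
  ind x; [left; apply le_0|]. intros x [H|H].
  - destruct (le_lteq _ _ H) as [H'| ->]; [now left|right; apply lt_S].
  - right. eapply lt_trans; [exact H|apply lt_S].
Qed.

Lemma lt_not_le x y : x < y -> ~ y <= x.
Proof. intros H H'. apply (lt_irrefl x). now apply lt_le_trans with y. Qed.

Lemma not_lt_0 x : ~ x < 0.
Proof. intros H. apply (lt_not_le _ _ H), le_0. Qed.

Lemma lt_cases x y : x < y \/ x = y \/ y < x.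
Proof. destruct (le_or_lt x y) as [H|H]; auto. apply le_lteq in H. tauto. Qed.

Lemma le_0_eq x : x <= 0 -> x = 0.
Proof. intros H. apply le_antisym; [easy|apply le_0]. Qed.

Lemma add_lt_l n x y : n + x < n + y <-> x < y.
Proof.
  split; intros [d E]; exists d.
  - apply (add_cancel_l n). rewrite <- E. mring.
  - rewrite <- E. mring.
Qed.

Lemma mul_le x y u v : x <= y -> u <= v -> x * u <= y * v.
Proof. intros [a <-] [b <-]. exists (x * b + a * u + a * b). mring. Qed.

Lemma S_le x y : mS x <= mS y <-> x <= y.
Proof. apply (lt_S_le x y). Qed.

Lemma le_mul_pos x y : 0 < y -> x <= x * y.
Proof.
  intros H. apply le_trans with (x * 1).
  - replace (x * 1) with x by ring. apply le_refl.
  - now apply mul_le; [apply le_refl|].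
Qed.

(** ** Induction and the least number principle *)

Lemma strong_ind (P : M -> Prop) : Definable1 P ->
  (forall x, (forall y, y < x -> P y) -> P x) -> forall x, P x.
Proof.
  intros D H. cut (forall x y, y <= x -> P y).
  { intros Q x. apply (Q x), le_refl. }
  intros x. ind x.
  - intros y L. apply H. intros z Hz. apply le_0_eq in L. subst.
    now apply not_lt_0 in Hz.
  - intros x IH y Hy. apply H. intros z Hz. apply IH. apply lt_S_le.
    now apply lt_le_trans with y.
Qed.

(** ** Pairing *)

Lemma mpair_bounds x y :
  (x + y) * (x + y) <= mpair x y /\ mpair x y < mS (x + y) * mS (x + y).
Proof.
  split; [apply le_add|]. exists (x + y + y). unfold mpair. mring.
Qed.

Lemma square_lt x y : x < y -> mS x * mS x <= y * y.
Proof. intros H. now apply mul_le. Qed.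

(** The sum s of the components is determined by s^2 <= (x, y) < (s + 1)^2. *)
Lemma mpair_inj x y x' y' : mpair x y = mpair x' y' -> x = x' /\ y = y'.
Proof.
  intros E. assert (ES : x + y = x' + y').
  { destruct (mpair_bounds x y) as [L U], (mpair_bounds x' y') as [L' U'].
    destruct (lt_cases (x + y) (x' + y')) as [H|[H|H]]; auto; exfalso.
    - apply (lt_irrefl (mpair x y)). apply (lt_le_trans _ _ _ U).
      rewrite E. apply le_trans with ((x' + y') * (x' + y')); auto using square_lt.
    - apply (lt_irrefl (mpair x y)). rewrite E at 1. apply (lt_le_trans _ _ _ U').
      apply le_trans with ((x + y) * (x + y)); auto using square_lt. }
  assert (Ex : x = x').
  { apply (add_cancel_l ((x + y) * (x + y))). unfold mpair in E. rewrite E. now rewrite ES. }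
  subst x'. split; [easy|]. now apply add_cancel_l in ES.
Qed.

Lemma le_square x : x <= x * x.
Proof.
  destruct (zero_or_succ x) as [->|[y ->]]; [apply le_0|].
  apply le_mul_pos. apply lt_S_le, le_0.
Qed.

Lemma le_pair_l x y : x <= mpair x y.
Proof. apply le_add_l. Qed.

Lemma le_pair_r x y : y <= mpair x y.
Proof.
  apply le_trans with (x + y); [apply le_add_l|].
  apply le_trans with ((x + y) * (x + y)); [apply le_square|apply le_add].
Qed.

(** ** Coded sequences *)

Definition beta_mod (b i : M) : M := mS (mS i * b).

Lemma D_beta_mod : DefinableF2 beta_mod.
Proof. unfold beta_mod. def. Qed.
#[local] Hint Resolve D_beta_mod : def.

Definition dvd (m x : M) : Prop := exists q, x = m * q.

Lemma D_dvd : Definable2 dvd.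
Proof. unfold dvd. def. Qed.
#[local] Hint Resolve D_dvd : def.

Lemma dvd_cancel m u v : dvd m (u + v) -> dvd m u -> dvd m v.
Proof.
  intros [p Hp] [q ->]. destruct (le_or_lt q p) as [[d <-]|H].
  - exists d. apply (add_cancel_l (m * q)). rewrite Hp. mring.
  - apply lt_le in H as [d <-]. exists 0. rewrite pa_mul0.
    replace (m * (p + d) + v) with (m * p + (m * d + v)) in Hp by ring.
    assert (E : m * d + v = 0).
    { apply (add_cancel_l (m * p)). now rewrite Hp, pa_add0. }
    now apply add_eq_0 in E as [_ ->].
Qed.

Lemma dvd_mul_r m x y : dvd m x -> dvd m (x * y).
Proof. intros [q ->]. exists (q * y). mring. Qed.

Lemma dvd_add m x y : dvd m x -> dvd m y -> dvd m (x + y).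
Proof. intros [p ->] [q ->]. exists (p + q). mring. Qed.

(** P is invertible modulo m: some multiple of P is -1 modulo m.  Taking -1 in
    place of 1 avoids subtraction. *)
Definition invertible (P m : M) : Prop := exists x, dvd m (P * x + 1).

Lemma D_invertible : Definable2 invertible.
Proof. unfold invertible. def. Qed.
#[local] Hint Resolve D_invertible : def.

Lemma invertible_mul P Q m : invertible P m -> invertible Q m -> invertible (P * Q) m.
Proof.
  intros [x Hx] [y Hy]. exists (x * y * (Q * y)).
  apply dvd_cancel with ((Q * y + 1) * (Q * y)); [|now apply dvd_mul_r].
  replace ((Q * y + 1) * (Q * y) + (P * Q * (x * y * (Q * y)) + 1))
    with ((P * x + 1) * (Q * y * (Q * y)) + (Q * y + 1)) by mring.
  apply dvd_add; [now apply dvd_mul_r|easy].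
Qed.

(** Write b = (d + 1) c and let m, m' be the moduli of i and j = i + d + 1.  Then
    (j + 1) m - (i + 1) m' = d + 1 gives (j + 1)^2 c m = -1 modulo m'. *)
Lemma beta_mod_invertible b i d : dvd (mS d) b ->
  invertible (beta_mod b i) (beta_mod b (i + mS d)).
Proof.
  intros [c ->]. set (j := i + mS d). exists (mS j * mS j * c).
  exists (1 + mS j * mS i * c). unfold beta_mod, j. mring.
Qed.

(** With P x = -1 modulo m, the choice t = x (A - F) solves A + P t = F modulo m;
    here - F is replaced by F (m - 1). *)
Lemma crt_step A P m b' F : m = mS b' -> F < m -> invertible P m ->
  exists t q, A + P * t = q * m + F.
Proof.
  intros -> HF [x [y Hy]].
  set (t := x * (A + F * b')). set (Y := y * (A + F * b')).
  assert (E : A + P * t + F * mS b' = mS b' * Y + F).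
  { transitivity (A + F + F * b' + P * x * (A + F * b')).
    - unfold t. mring.
    - transitivity ((P * x + 1) * (A + F * b') + F); [mring|].
      rewrite Hy. unfold Y. mring. }
  exists t. destruct (le_or_lt F Y) as [[d HY]|H].
  - exists d. apply (add_cancel_l (F * mS b')). rewrite addC, E, <- HY. mring.
  - exfalso. destruct H as [d H]. apply (lt_irrefl F).
    eapply lt_le_trans; [exact HF|].
    exists (A + P * t + mS b' * d). apply (add_cancel_l (mS b' * Y)).
    rewrite <- E. clearbody t. rewrite <- H. mring.
Qed.

Lemma bounded_values (F : M -> M) n : DefinableF F ->
  exists B, forall i, i < n -> F i <= B.
Proof.
  intros D. ind n.
  - exists 0. intros i H. now apply not_lt_0 in H.
  - intros n [B H]. exists (B + F n). intros i Hi.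
    apply lt_S_cases in Hi as [Hi| ->]; [|apply le_add_l].
    eapply le_trans; [now apply H|apply le_add].
Qed.

Lemma common_multiple n :
  exists L, 0 < L /\ forall k, k < n -> dvd (mS k) L.
Proof.
  ind n.
  - exists 1. split; [apply lt_S|]. intros i H. now apply not_lt_0 in H.
  - intros n (L & HL & H). exists (L * mS n). split.
    + eapply lt_le_trans; [exact HL|]. apply le_mul_pos. apply lt_S_le, le_0.
    + intros k Hk. apply lt_S_cases in Hk as [Hk| ->].
      * now apply dvd_mul_r, H.
      * exists L. mring.
Qed.

(** Simultaneous congruences, solved one modulus at a time.  P is the product of the
    moduli treated so far, so adding multiples of P to A preserves the congruences
    already obtained. *)
Lemma chinese_remainder (F : M -> M) b n : DefinableF F ->
  (forall k, k < n -> dvd (mS k) b) -> (forall i, i < n -> F i < beta_mod b i) ->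
  forall k, k <= n -> exists A P,
    (forall i, i < k -> dvd (beta_mod b i) P /\
      exists q, A = q * beta_mod b i + F i) /\
    (forall j, k <= j -> j < n -> invertible P (beta_mod b j)).
Proof.
  intros D Hb HF k. ind k.
  - intros _. exists 0, 1. split.
    + intros i H. now apply not_lt_0 in H.
    + intros j _ _. exists (mS j * b). exists 1. unfold beta_mod. mring.
  - intros k IH Hk. destruct IH as (A & P & H1 & H2); [now apply lt_le|].
    destruct (crt_step A P (beta_mod b k) (mS k * b) (F k)) as (t & q & E); auto.
    { apply H2; [apply le_refl|easy]. }
    exists (A + P * t), (P * beta_mod b k). split.
    + intros i Hi. apply lt_S_cases in Hi as [Hi| ->].
      * destruct (H1 i Hi) as [[r ->] [s ->]]. split; [now apply dvd_mul_r; exists r|].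
        exists (s + r * t). mring.
      * split; [exists P; mring|]. now exists q.
    + intros j Hkj Hj. apply invertible_mul.
      * apply H2; [now apply lt_le|easy].
      * destruct Hkj as [d Hd]. rewrite add_S_l, <- pa_addS in Hd. subst j.
        apply beta_mod_invertible. apply Hb.
        eapply le_lt_trans; [|exact Hj]. eapply le_trans; [|apply le_add_l].
        apply lt_le, lt_S.
Qed.

Lemma elt_in n a b i z q : i < n -> z < beta_mod b i ->
  a = q * beta_mod b i + z -> mE (mpair n (mpair a b)) i = z.
Proof.
  intros Hi Hz E. apply pa_elt. left. exists n, a, b. repeat split; auto.
  now exists q.
Qed.

Lemma elt_out s n i : mLh s n -> n <= i -> mE s i = 0.
Proof.
  intros (a & b & ->) H. apply pa_elt. right. split; [|easy].
  intros (n' & a' & b' & E & L). apply mpair_inj in E as [<- _].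
  now apply lt_not_le in L.
Qed.

(** Goedel's beta lemma: definable sequences are coded.  The parameter b of the
    moduli is divisible by 1, ..., n, which makes them coprime, and exceeds all
    values. *)
Lemma seq_exists (F : M -> M) n : DefinableF F ->
  exists s, mLh s n /\ forall i, i < n -> mE s i = F i.
Proof.
  intros D. destruct (bounded_values F n D) as [B HB].
  destruct (common_multiple n) as (L & HL & H). set (b := L * mS B).
  assert (HF : forall i, i < n -> F i < beta_mod b i).
  { intros i Hi. apply lt_S_le. eapply le_trans; [now apply HB|].
    apply le_trans with b.
    - unfold b. rewrite mulC. eapply le_trans; [apply lt_le, lt_S|].
      now apply le_mul_pos.
    - rewrite mulC. apply le_mul_pos. apply lt_S_le, le_0. }
  destruct (chinese_remainder F b n D) with (k := n) as (A & P & HA & _); auto.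
  - intros k Hk. now apply dvd_mul_r, H.
  - apply le_refl.
  - exists (mpair n (mpair A b)). split; [now exists A, b|].
    intros i Hi. destruct (HA i Hi) as [_ [q E]]. eapply elt_in; eauto.
Qed.

Lemma elt_eventually_0 s : exists n, forall i, n <= i -> mE s i = 0.
Proof.
  destruct (classic (exists n, mLh s n)) as [[n Hn]|N].
  - exists n. intros i. now apply elt_out.
  - exists 0. intros i _. apply pa_elt. right. split; [|easy].
    intros (n & a & b & -> & _). apply N. now exists n, a, b.
Qed.

End Arithmetic.

#[export] Hint Resolve D_le D_lt D_pair D_Lh : def.

(** * Inductive definitions inside a model *)

Definition mLfp {M : model} (G : (M -> Prop) -> M -> Prop) (x : M) : Prop :=
  exists s n, mE s n = x /\
    forall i, i <= n -> G (fun y => exists j, j < i /\ mE s j = y) (mE s i).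

Section Fixpoints.

Context {M : model} {EM : Enumerated M} {PA : PAmodel M}.

Lemma D_iota (R : M -> M -> Prop) :
  Definable2 R -> DefinableF (fun x => iota (R x)).
Proof.
  intros D. apply DF_graph1. intros X f g Hf Hg.
  apply (Def_iff X (fun c => (R (f c) (g c) /\ forall z, R (f c) z -> z = g c) \/
    (~ (exists y, R (f c) y /\ forall z, R (f c) z -> z = y) /\ g c = m0))).
  - intros c. symmetry. apply iota_graph.
  - repeat def_step.
Qed.

Lemma D_iota2 (R : M -> M -> M -> Prop) :
  Definable3 R -> DefinableF2 (fun x y => iota (R x y)).
Proof.
  intros D. apply DF_graph2. intros X f h g Hf Hh Hg.
  apply (Def_iff X (fun c => (R (f c) (h c) (g c) /\ forall z, R (f c) (h c) z -> z = g c) \/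
    (~ (exists y, R (f c) (h c) y /\ forall z, R (f c) (h c) z -> z = y) /\ g c = m0))).
  - intros c. symmetry. apply iota_graph.
  - repeat def_step.
Qed.

Lemma seq_exists_rel (R : M -> M -> Prop) n : Definable2 R ->
  (forall i, i < n -> exists y, R i y) ->
  (forall i y z, i < n -> R i y -> R i z -> y = z) ->
  exists s, mLh s n /\ forall i, i < n -> R i (mE s i).
Proof.
  intros D HE HU. destruct (seq_exists _ n (D_iota R D)) as (s & L & H).
  exists s. split; [easy|]. intros i Hi. rewrite H by easy.
  apply iota_spec; auto. intros y z. now apply HU.
Qed.

(** An instance of a positive operator holds because of finitely many
    elements.  Finite means finite in the metatheory, which is what makes the
    union of the corresponding derivations a coded sequence. *)
Definition Pos (G : (M -> Prop) -> Prop) : Prop :=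
  forall X, G X -> exists l, Forall X l /\ forall Y, Forall Y l -> G Y.

Lemma Pos_const P : Pos (fun _ => P).
Proof. intros X H. now exists []. Qed.

Lemma Pos_elem t : Pos (fun X => X t).
Proof.
  intros X H. exists [t]. split; [now repeat constructor|].
  intros Y HY. now inversion HY.
Qed.

Lemma Pos_and G H : Pos G -> Pos H -> Pos (fun X => G X /\ H X).
Proof.
  intros PG PH X [A B]. destruct (PG X A) as (l & F & E), (PH X B) as (l' & F' & E').
  exists (l ++ l'). split; [now apply Forall_app|].
  intros Y HY. apply Forall_app in HY as [HY HY']. auto.
Qed.

Lemma Pos_or G H : Pos G -> Pos H -> Pos (fun X => G X \/ H X).
Proof.
  intros PG PH X [A|A].
  - destruct (PG X A) as (l & F & E). exists l. auto.
  - destruct (PH X A) as (l & F & E). exists l. auto.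
Qed.

Lemma Pos_ex (G : (M -> Prop) -> M -> Prop) :
  (forall y, Pos (fun X => G X y)) -> Pos (fun X => exists y, G X y).
Proof.
  intros PG X [y A]. destruct (PG y X A) as (l & F & E). exists l. eauto.
Qed.

Lemma Pos_imp (P : Prop) G : Pos G -> Pos (fun X => P -> G X).
Proof.
  intros PG X A. destruct (classic P) as [H|H].
  - destruct (PG X (A H)) as (l & F & E). exists l. auto.
  - now exists [].
Qed.

Lemma Pos_mono G (X Y : M -> Prop) : Pos G -> (forall x, X x -> Y x) -> G X -> G Y.
Proof.
  intros PG H A. destruct (PG X A) as (l & F & E). apply E.
  eapply Forall_impl; eauto.
Qed.

Section Operator.

Context (G : (M -> Prop) -> M -> Prop).
Hypothesis PG : forall x, Pos (fun X => G X x).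

Lemma Lfp_unfold x : mLfp G x -> G (mLfp G) x.
Proof.
  intros (s & n & <- & H).
  eapply (Pos_mono (fun X => G X _)); [apply PG| |apply H, le_refl].
  intros y (j & Hj & <-). exists s, j. split; [easy|].
  intros i Hi. apply H. apply le_trans with j; [easy|now apply lt_le].
Qed.

(** Derivations of length n, without a designated last element. *)
Let chain s n :=
  forall i, i < n -> G (fun y => exists j, j < i /\ mE s j = y) (mE s i).

Lemma chain_app s n t m : chain s n -> chain t m -> exists u, chain u (n + m) /\
  (forall i, i < n -> mE u i = mE s i) /\ (forall i, i < m -> mE u (n + i) = mE t i).
Proof.
  intros C C'.
  destruct (seq_exists_rel (fun i y => (i < n /\ y = mE s i) \/
     exists k, i = n + k /\ y = mE t k) (n + m)) as (u & _ & Hu).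
  - def.
  - intros i _. destruct (le_or_lt n i) as [[k <-]|H].
    + exists (mE t k). right. now exists k.
    + exists (mE s i). now left.
  - intros i y z _ [[A ->]|(k & -> & ->)] [[A' ->]|(k' & E & ->)]; auto.
    + subst i. exfalso; apply (lt_not_le _ _ A), le_add.
    + exfalso; apply (lt_not_le _ _ A'), le_add.
    + now apply add_cancel_l in E as ->.
  - assert (U1 : forall i, i < n -> mE u i = mE s i).
    { intros i Hi. destruct (Hu i) as [[_ E]|(k & -> & _)]; auto.
      - eapply lt_le_trans; [exact Hi|apply le_add].
      - exfalso; apply (lt_not_le _ _ Hi), le_add. }
    assert (U2 : forall i, i < m -> mE u (n + i) = mE t i).
    { intros i Hi. destruct (Hu (n + i)) as [[A _]|(k & E & E')].
      - now apply add_lt_l.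
      - exfalso; apply (lt_not_le _ _ A), le_add.
      - now apply add_cancel_l in E as <-. }
    exists u. repeat split; auto. intros i Hi. destruct (le_or_lt n i) as [[k <-]|H].
    + assert (Hk : k < m).
      { now apply add_lt_l in Hi. }
      rewrite U2 by easy. eapply (Pos_mono (fun X => G X _)); [apply PG| |now apply C'].
      intros y (j & Hj & <-). exists (n + j). split.
      * now apply add_lt_l.
      * apply U2. now apply lt_trans with k.
    + rewrite U1 by easy. eapply (Pos_mono (fun X => G X _)); [apply PG| |now apply C].
      intros y (j & Hj & <-). exists j. split; [easy|]. apply U1.
      now apply lt_trans with i.
Qed.

Lemma chain_all l : Forall (mLfp G) l -> exists s n, chain s n /\
  Forall (fun y => exists i, i < n /\ mE s i = y) l.
Proof.
  induction 1 as [|x l (s & n & <- & H) _ (t & m & C & F)].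
  - exists m0, m0. split; [|constructor]. intros i Hi. now apply not_lt_0 in Hi.
  - destruct (chain_app s (mS n) t m) as (u & Cu & U1 & U2); auto.
    { intros i Hi. now apply H, lt_S_le. }
    exists u, (mS n + m). split; [easy|]. constructor.
    + exists n. split; [|now apply U1, lt_S].
      eapply lt_le_trans; [apply lt_S|apply le_add].
    + eapply Forall_impl; [|exact F]. intros y (i & Hi & <-).
      exists (mS n + i). split; [|now apply U2].
      now apply add_lt_l.
Qed.

(** Finitely many derivations are concatenated and x is put at the end. *)
Lemma Lfp_fold x : G (mLfp G) x -> mLfp G x.
Proof.
  intros A. destruct (PG x _ A) as (l & F & E).
  destruct (chain_all l F) as (s & n & C & F').
  destruct (seq_exists_rel (fun i y => (i < n /\ y = mE s i) \/ (i = n /\ y = x))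
    (mS n)) as (u & _ & Hu).
  - def.
  - intros i Hi. apply lt_S_cases in Hi as [Hi|Hi].
    + exists (mE s i). now left.
    + exists x. now right.
  - intros i y z _ [[B ->]|[-> ->]] [[B' ->]|[E' ->]]; auto.
    + subst. now apply lt_irrefl in B.
    + now apply lt_irrefl in B'.
  - assert (U : forall i, i < n -> mE u i = mE s i).
    { intros i Hi. destruct (Hu i) as [[_ E']|[-> _]]; auto.
      - apply lt_trans with n; [easy|apply lt_S].
      - now apply lt_irrefl in Hi. }
    assert (Un : mE u n = x).
    { destruct (Hu n (lt_S n)) as [[B _]|[_ E']]; auto. now apply lt_irrefl in B. }
    exists u, n. split; [easy|]. intros i Hi. apply le_lteq in Hi as [Hi| ->].
    + rewrite U by easy. eapply (Pos_mono (fun X => G X _)); [apply PG| |now apply C].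
      intros y (j & Hj & <-). exists j. split; [easy|]. apply U. now apply lt_trans with i.
    + rewrite Un. apply E. eapply Forall_impl; [|exact F'].
      intros y (j & Hj & <-). exists j. auto.
Qed.

Lemma Lfp_iff x : mLfp G x <-> G (mLfp G) x.
Proof. split; [apply Lfp_unfold|apply Lfp_fold]. Qed.

(** Strong induction along the sequence that witnesses membership. *)
Lemma Lfp_ind (P : M -> Prop) : Definable1 P ->
  (forall x, G (fun y => mLfp G y /\ P y) x -> P x) -> forall x, mLfp G x -> P x.
Proof.
  intros D H x (s & n & <- & C).
  assert (A : forall i, i <= n -> P (mE s i)); [|apply A, le_refl].
  intros i. pattern i. revert i. apply strong_ind; [def|]. intros i IH Hi.
  apply H. eapply (Pos_mono (fun X => G X _)); [apply PG| |now apply C].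
  intros y (j & Hj & <-). assert (Hjn : j <= n) by
    (apply le_trans with i; [now apply lt_le|easy]). split; [|auto].
  exists s, j. split; [easy|]. intros k Hk. apply C. now apply le_trans with j.
Qed.

End Operator.

(** ** Codes *)

Fixpoint nm (k : nat) : M := match k with 0%nat => m0 | S k => mS (nm k) end.

Lemma nm_inj j : forall k, nm j = nm k -> j = k.
Proof.
  induction j; intros []; simpl; intros H; auto.
  - symmetry in H. now apply pa_S0 in H.
  - now apply pa_S0 in H.
  - f_equal. now apply IHj, pa_S_inj.
Qed.

(** All codes of expressions are a tag paired with one or two components; treating
    the tag as an argument lets constructors of the same kind share their lemmas. *)
Definition cUn (k : nat) (s : M) : M := mpair (nm k) s.
Definition cBin (k : nat) (s u : M) : M := mpair (nm k) (mpair s u).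

Lemma D_cUn k : DefinableF (cUn k).
Proof. unfold cUn. def. Qed.
Lemma D_cBin k : DefinableF2 (cBin k).
Proof. unfold cBin. def. Qed.

Lemma cUn_inj j k a b : cUn j a = cUn k b -> j = k /\ a = b.
Proof. intros H. apply mpair_inj in H as [H ->]. apply nm_inj in H. auto. Qed.

Lemma cBin_inj j k a b a' b' :
  cBin j a b = cBin k a' b' -> j = k /\ a = a' /\ b = b'.
Proof.
  intros H. apply mpair_inj in H as [H H']. apply nm_inj in H.
  apply mpair_inj in H'. tauto.
Qed.

Lemma cUn_cBin j k a b c : cUn j a = cBin k b c -> j = k.
Proof. intros H. apply mpair_inj in H as [H _]. now apply nm_inj. Qed.

Lemma cBin_pos k a b : cBin (S k) a b <> m0.
Proof.
  intros H. apply (not_lt_0 (nm k)). rewrite <- H. apply le_pair_l.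
Qed.

Lemma cUn_gt k a : a <= cUn k a.
Proof. apply le_pair_r. Qed.

Lemma cBin_gt_l k a b : a <= cBin k a b.
Proof. eapply le_trans; [apply le_pair_l|apply le_pair_r]. Qed.

Lemma cBin_gt_r k a b : b <= cBin k a b.
Proof. eapply le_trans; [apply le_pair_r|apply le_pair_r]. Qed.

End Fixpoints.

#[export] Hint Resolve D_cUn D_cBin : def.

Ltac pos :=
  repeat match goal with
  | |- Pos (fun _ => exists _, _) => apply Pos_ex; intro
  | |- Pos (fun _ => _ /\ _) => apply Pos_and
  | |- Pos (fun _ => _ \/ _) => apply Pos_or
  | |- Pos (fun _ => _) => apply Pos_const
  | |- Pos (fun X => X _) => apply Pos_elem
  | |- Pos (fun _ => _ -> _) => apply Pos_imp
  end.

Ltac inv_code :=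
  repeat match goal with
  | H : cUn _ _ = cUn _ _ |- _ =>
      apply cUn_inj in H; destruct H as [? ?]; try lia
  | H : cBin _ _ _ = cBin _ _ _ |- _ =>
      apply cBin_inj in H; destruct H as (? & ? & ?); try lia
  | H : cUn _ _ = cBin _ _ _ |- _ => apply cUn_cBin in H; try lia
  | H : cBin _ _ _ = cUn _ _ |- _ => symmetry in H; apply cUn_cBin in H; try lia
  | H : mpair _ _ = mpair _ _ |- _ => apply mpair_inj in H; destruct H as [? ?]
  | H : cBin _ _ _ = m0 |- _ => now apply cBin_pos in H
  end; subst; try lia.

(** * Arithmetized syntax in a model *)

(** Tags of the binary function symbols, the binary connectives and the
    quantifiers. *)
Definition tk (k : nat) : Prop := k = 4 \/ k = 5 \/ k = 6.
Definition fk (k : nat) : Prop := k = 9 \/ k = 10.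
Definition qk (k : nat) : Prop := k = 11 \/ k = 12.

Ltac kinds := unfold tk, fk, qk in *; lia.

Ltac lfp_iff :=
  match goal with |- mLfp ?G ?x <-> _ => refine (Lfp_iff G _ x); intro; pos end.

Ltac destr H :=
  cbv beta iota in H;
  repeat match type of H with
  | _ \/ _ => destruct H as [H|H]
  | exists _, _ => let x := fresh "x" in destruct H as [x H]
  | _ /\ _ => let H' := fresh H in destruct H as [H' H]; destr H'
  end.

Ltac kcases H :=
  unfold tk, fk, qk in H;
  repeat match type of H with _ \/ _ => destruct H as [H|H] end; subst.

Notation cVar := (cUn 1).
Notation cZero := (cUn 2 m0).
Notation cSucc := (cUn 3).
Notation cEq := (cBin 7).
Notation cNeg := (cUn 8).
Notation cNil := m0 (only parsing).
Notation cCons := (cBin 1).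

(** A name with prefix m denotes the meaning in the model of the arithmetical formula
    with that name. *)

Section Syntax.

Context {M : model} {EM : Enumerated M} {PA : PAmodel M}.
Implicit Types t s u p q a b v w i j l m : M.


Definition mMem x l : Prop :=
  mLfp (fun X m => exists y k, m = cCons y k /\ (x = y \/ X k)) l.

Definition mIsNumeral x c : Prop :=
  mLfp (fun X p => p = mpair m0 cZero \/
    exists y d, p = mpair (mS y) (cSucc d) /\ X (mpair y d)) (mpair x c).

Definition mIsTerm (elt : bool) t : Prop :=
  mLfp (fun X t =>
    (exists i, t = cVar i) \/ t = cZero \/ (exists s, t = cSucc s /\ X s) \/
    exists s u,
      (if elt then (t = cBin 4 s u \/ t = cBin 5 s u) \/ t = cBin 6 s u
       else t = cBin 4 s u \/ t = cBin 5 s u) /\ X s /\ X u) t.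

Definition mIsForm (elt : bool) p : Prop :=
  mLfp (fun X p =>
    (exists s t, p = cEq s t /\ mIsTerm elt s /\ mIsTerm elt t) \/
    (exists a, p = cNeg a /\ X a) \/
    (exists a b, (p = cBin 9 a b \/ p = cBin 10 a b) /\ X a /\ X b) \/
    exists v a, (p = cBin 11 v a \/ p = cBin 12 v a) /\ X a) p.

Definition mOccurs v t : Prop :=
  mLfp (fun X t =>
    t = cVar v \/ (exists s, t = cSucc s /\ X s) \/
    exists s u, (t = cBin 4 s u \/ t = cBin 5 s u \/ t = cBin 6 s u) /\
      (X s \/ X u)) t.

Definition mFree v p : Prop :=
  mLfp (fun X p =>
    (exists s t, p = cEq s t /\ (mOccurs v s \/ mOccurs v t)) \/
    (exists a, p = cNeg a /\ X a) \/
    (exists a b, (p = cBin 9 a b \/ p = cBin 10 a b) /\ (X a \/ X b)) \/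
    exists w a, (p = cBin 11 w a \/ p = cBin 12 w a) /\ v <> w /\ X a) p.

Definition mClTerm t : Prop := mIsTerm true t /\ ~ exists v, mOccurs v t.
Definition mSent p : Prop := mIsForm true p /\ ~ exists v, mFree v p.

Definition mVal t z : Prop :=
  mLfp (fun X p =>
    p = mpair cZero m0 \/
    (exists s a, p = mpair (cSucc s) (mS a) /\ X (mpair s a)) \/
    exists s u a b,
      (p = mpair (cBin 4 s u) (a + b) \/ p = mpair (cBin 5 s u) (a * b) \/
       p = mpair (cBin 6 s u) (mE a b)) /\
      X (mpair s a) /\ X (mpair u b)) (mpair t z).

(** Replacement relations V carry a parameter c, so that the result of a replacement
    is definable as a function of c, too.  Variables in the list l of bound variables
    are left alone. *)
Definition mUnder (V : M -> M -> M -> Prop) c l i u : Prop :=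
  (mMem i l /\ u = cVar i) \/ (~ mMem i l /\ V c i u).

Definition mRT (V : M -> M -> M -> Prop) c l t t' : Prop :=
  mLfp (fun X p =>
    (exists i u, p = mpair (cVar i) u /\ mUnder V c l i u) \/
    p = mpair cZero cZero \/
    (exists s s', p = mpair (cSucc s) (cSucc s') /\ X (mpair s s')) \/
    exists s s' u u',
      (p = mpair (cBin 4 s u) (cBin 4 s' u') \/
       p = mpair (cBin 5 s u) (cBin 5 s' u') \/
       p = mpair (cBin 6 s u) (cBin 6 s' u')) /\
      X (mpair s s') /\ X (mpair u u')) (mpair t t').

Definition mRep (V : M -> M -> M -> Prop) c l p p' : Prop :=
  mLfp (fun X r =>
    (exists l s s' t t', r = mpair l (mpair (cEq s t) (cEq s' t')) /\
       mRT V c l s s' /\ mRT V c l t t') \/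
    (exists l a a', r = mpair l (mpair (cNeg a) (cNeg a')) /\
       X (mpair l (mpair a a'))) \/
    (exists l a a' b b',
       (r = mpair l (mpair (cBin 9 a b) (cBin 9 a' b')) \/
        r = mpair l (mpair (cBin 10 a b) (cBin 10 a' b'))) /\
       X (mpair l (mpair a a')) /\ X (mpair l (mpair b b'))) \/
    exists l v a a',
      (r = mpair l (mpair (cBin 11 v a) (cBin 11 v a')) \/
       r = mpair l (mpair (cBin 12 v a) (cBin 12 v a'))) /\
      X (mpair (cCons v l) (mpair a a'))) (mpair l (mpair p p')).

Lemma D_Mem : Definable2 mMem.
Proof. unfold mMem, mLfp. def. Qed.
#[local] Hint Resolve D_Mem : def.
Lemma D_IsNumeral : Definable2 mIsNumeral.
Proof. unfold mIsNumeral, mLfp. def. Qed.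
Lemma D_IsTerm (b : bool) : Definable1 (mIsTerm b).
Proof. unfold mIsTerm, mLfp. destruct b; def. Qed.
#[local] Hint Resolve D_IsTerm : def.
Lemma D_IsForm (b : bool) : Definable1 (mIsForm b).
Proof. unfold mIsForm, mLfp. def. Qed.
Lemma D_Occurs : Definable2 mOccurs.
Proof. unfold mOccurs, mLfp. def. Qed.
#[local] Hint Resolve D_IsForm D_Occurs : def.
Lemma D_Free : Definable2 mFree.
Proof. unfold mFree, mLfp. def. Qed.
#[local] Hint Resolve D_Free : def.
Lemma D_ClTerm : Definable1 mClTerm.
Proof. unfold mClTerm. def. Qed.
Lemma D_Sent : Definable1 mSent.
Proof. unfold mSent. def. Qed.
Lemma D_Val : Definable2 mVal.
Proof. unfold mVal, mLfp. def. Qed.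
Lemma D_Under V : Definable3 V -> Definable4 (mUnder V).
Proof. unfold mUnder. def. Qed.
#[local] Hint Resolve D_Under : def.
Lemma D_RT V : Definable3 V -> Definable4 (mRT V).
Proof. unfold mRT, mLfp. def. Qed.
#[local] Hint Resolve D_RT : def.
Lemma D_Rep V : Definable3 V -> Definable4 (mRep V).
Proof. unfold mRep, mLfp. def. Qed.
#[local] Hint Resolve D_Rep : def.


(** ** Unfolding *)

Lemma Mem_iff x l : mMem x l <-> exists y k, l = cCons y k /\ (x = y \/ mMem x k).
Proof. unfold mMem. lfp_iff. Qed.

Lemma Mem_nil x : ~ mMem x cNil.
Proof. rewrite Mem_iff. intros (y & k & E & _). symmetry in E. inv_code. Qed.

Lemma Mem_cons x y k : mMem x (cCons y k) <-> x = y \/ mMem x k.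
Proof.
  rewrite Mem_iff. split.
  - intros (y' & k' & E & H). inv_code. exact H.
  - intros H. now exists y, k.
Qed.

Lemma IsNumeral_iff x c : mIsNumeral x c <-> mpair x c = mpair m0 cZero \/
    exists y d, mpair x c = mpair (mS y) (cSucc d) /\ mIsNumeral y d.
Proof. unfold mIsNumeral. lfp_iff. Qed.

Lemma IsTerm_iff (b : bool) t : mIsTerm b t <->
    (exists i, t = cVar i) \/ t = cZero \/ (exists s, t = cSucc s /\ mIsTerm b s) \/
    exists s u,
      (if b then (t = cBin 4 s u \/ t = cBin 5 s u) \/ t = cBin 6 s u
       else t = cBin 4 s u \/ t = cBin 5 s u) /\ mIsTerm b s /\ mIsTerm b u.
Proof. unfold mIsTerm. lfp_iff. Qed.

Lemma IsForm_iff (b : bool) p : mIsForm b p <->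
    (exists s t, p = cEq s t /\ mIsTerm b s /\ mIsTerm b t) \/
    (exists a, p = cNeg a /\ mIsForm b a) \/
    (exists a c, (p = cBin 9 a c \/ p = cBin 10 a c) /\ mIsForm b a /\ mIsForm b c) \/
    exists v a, (p = cBin 11 v a \/ p = cBin 12 v a) /\ mIsForm b a.
Proof. unfold mIsForm. lfp_iff. Qed.

Lemma Occurs_iff v t : mOccurs v t <->
    t = cVar v \/ (exists s, t = cSucc s /\ mOccurs v s) \/
    exists s u, (t = cBin 4 s u \/ t = cBin 5 s u \/ t = cBin 6 s u) /\
      (mOccurs v s \/ mOccurs v u).
Proof. unfold mOccurs. lfp_iff. Qed.

Lemma Free_iff v p : mFree v p <->
    (exists s t, p = cEq s t /\ (mOccurs v s \/ mOccurs v t)) \/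
    (exists a, p = cNeg a /\ mFree v a) \/
    (exists a b, (p = cBin 9 a b \/ p = cBin 10 a b) /\ (mFree v a \/ mFree v b)) \/
    exists w a, (p = cBin 11 w a \/ p = cBin 12 w a) /\ v <> w /\ mFree v a.
Proof. unfold mFree. lfp_iff. Qed.

Lemma Val_iff t z : mVal t z <->
    mpair t z = mpair cZero m0 \/
    (exists s a, mpair t z = mpair (cSucc s) (mS a) /\ mVal s a) \/
    exists s u a b,
      (mpair t z = mpair (cBin 4 s u) (a + b) \/
       mpair t z = mpair (cBin 5 s u) (a * b) \/
       mpair t z = mpair (cBin 6 s u) (mE a b)) /\ mVal s a /\ mVal u b.
Proof. unfold mVal. lfp_iff. Qed.

Lemma RT_iff V c l t t' : mRT V c l t t' <->
    (exists i u, mpair t t' = mpair (cVar i) u /\ mUnder V c l i u) \/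
    mpair t t' = mpair cZero cZero \/
    (exists s s', mpair t t' = mpair (cSucc s) (cSucc s') /\ mRT V c l s s') \/
    exists s s' u u',
      (mpair t t' = mpair (cBin 4 s u) (cBin 4 s' u') \/
       mpair t t' = mpair (cBin 5 s u) (cBin 5 s' u') \/
       mpair t t' = mpair (cBin 6 s u) (cBin 6 s' u')) /\
      mRT V c l s s' /\ mRT V c l u u'.
Proof. unfold mRT. lfp_iff. Qed.

Lemma Rep_iff V c l p p' : mRep V c l p p' <->
    (exists k s s' t t', mpair l (mpair p p') = mpair k (mpair (cEq s t) (cEq s' t')) /\
       mRT V c k s s' /\ mRT V c k t t') \/
    (exists k a a', mpair l (mpair p p') = mpair k (mpair (cNeg a) (cNeg a')) /\
       mRep V c k a a') \/
    (exists k a a' b b',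
       (mpair l (mpair p p') = mpair k (mpair (cBin 9 a b) (cBin 9 a' b')) \/
        mpair l (mpair p p') = mpair k (mpair (cBin 10 a b) (cBin 10 a' b'))) /\
       mRep V c k a a' /\ mRep V c k b b') \/
    exists k v a a',
      (mpair l (mpair p p') = mpair k (mpair (cBin 11 v a) (cBin 11 v a')) \/
       mpair l (mpair p p') = mpair k (mpair (cBin 12 v a) (cBin 12 v a'))) /\
      mRep V c (cCons v k) a a'.
Proof. unfold mRep. lfp_iff. Qed.

Lemma term_ind (P : M -> Prop) : Definable1 P ->
  (forall i, P (cVar i)) -> P cZero ->
  (forall s, mIsTerm true s -> P s -> P (cSucc s)) ->
  (forall k s u, tk k -> mIsTerm true s -> mIsTerm true u -> P s -> P u ->
    P (cBin k s u)) ->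
  forall t, mIsTerm true t -> P t.
Proof.
  intros D Hv H0 Hs Hb. apply Lfp_ind; [intro; pos|easy|].
  intros t [[i ->]|[->|[(s & -> & H & H')|(s & u & E & (H & H') & (K & K'))]]]; auto.
  destruct E as [[->| ->]| ->]; apply Hb; auto; kinds.
Qed.

Lemma form_ind (P : M -> Prop) : Definable1 P ->
  (forall s t, mIsTerm true s -> mIsTerm true t -> P (cEq s t)) ->
  (forall a, mIsForm true a -> P a -> P (cNeg a)) ->
  (forall k a b, fk k -> mIsForm true a -> mIsForm true b -> P a -> P b ->
    P (cBin k a b)) ->
  (forall k v a, qk k -> mIsForm true a -> P a -> P (cBin k v a)) ->
  forall p, mIsForm true p -> P p.
Proof.
  intros D He Hn Hb Hq. apply Lfp_ind; [intro; pos|easy|].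
  intros p [(s & t & -> & H & H')|[(a & -> & H & H')|
    [(a & b & E & (H & H') & (K & K'))|(v & a & E & H & H')]]]; auto.
  - destruct E as [->| ->]; apply Hb; auto; kinds.
  - destruct E as [->| ->]; apply Hq; auto; kinds.
Qed.

Lemma IsTerm_var i : mIsTerm true (cVar i).
Proof. apply IsTerm_iff. eauto. Qed.
Lemma IsTerm_zero : mIsTerm true cZero.
Proof. apply IsTerm_iff. auto. Qed.
Lemma IsTerm_succ s : mIsTerm true (cSucc s) <-> mIsTerm true s.
Proof.
  rewrite IsTerm_iff. split; [|eauto 6]. intros H. destr H; inv_code; auto.
Qed.
Lemma IsTerm_bin k s u : tk k ->
  (mIsTerm true (cBin k s u) <-> mIsTerm true s /\ mIsTerm true u).
Proof.
  intros K. rewrite IsTerm_iff. split.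
  - intros H. destr H; inv_code; auto; kinds.
  - intros H. do 3 right. exists s, u. kcases K; auto 6.
Qed.

Lemma IsForm_eq s t : mIsForm true (cEq s t) <-> mIsTerm true s /\ mIsTerm true t.
Proof.
  rewrite IsForm_iff. split; [|intros []; eauto 6]. intros H. destr H; inv_code; auto.
Qed.
Lemma IsForm_neg a : mIsForm true (cNeg a) <-> mIsForm true a.
Proof.
  rewrite IsForm_iff. split; [|eauto 6]. intros H. destr H; inv_code; auto.
Qed.
Lemma IsForm_bin k a b : fk k ->
  (mIsForm true (cBin k a b) <-> mIsForm true a /\ mIsForm true b).
Proof.
  intros K. rewrite IsForm_iff. split.
  - intros H. destr H; inv_code; auto; kinds.
  - intros H. do 2 right. left. exists a, b. kcases K; auto 6.
Qed.
Lemma IsForm_q k v a : qk k -> (mIsForm true (cBin k v a) <-> mIsForm true a).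
Proof.
  intros K. rewrite IsForm_iff. split.
  - intros H. destr H; inv_code; auto; kinds.
  - intros H. do 3 right. exists v, a. kcases K; auto 6.
Qed.

Lemma Occurs_var v i : mOccurs v (cVar i) <-> v = i.
Proof.
  rewrite Occurs_iff. split; [|intros ->; auto]. intros H. destr H; inv_code; auto.
Qed.
Lemma Occurs_zero v : ~ mOccurs v cZero.
Proof. rewrite Occurs_iff. intros H. destr H; inv_code. Qed.
Lemma Occurs_succ v s : mOccurs v (cSucc s) <-> mOccurs v s.
Proof.
  rewrite Occurs_iff. split; [|eauto 6]. intros H. destr H; inv_code; auto.
Qed.
Lemma Occurs_bin k v s u : tk k ->
  (mOccurs v (cBin k s u) <-> mOccurs v s \/ mOccurs v u).
Proof.
  intros K. rewrite Occurs_iff. split.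
  - intros H. destr H; inv_code; auto; kinds.
  - intros H. do 2 right. exists s, u. kcases K; auto 6.
Qed.

Lemma Free_eq v s t : mFree v (cEq s t) <-> mOccurs v s \/ mOccurs v t.
Proof.
  rewrite Free_iff. split; [|eauto 6]. intros H. destr H; inv_code; auto.
Qed.
Lemma Free_neg v a : mFree v (cNeg a) <-> mFree v a.
Proof.
  rewrite Free_iff. split; [|eauto 6]. intros H. destr H; inv_code; auto.
Qed.
Lemma Free_bin k v a b : fk k ->
  (mFree v (cBin k a b) <-> mFree v a \/ mFree v b).
Proof.
  intros K. rewrite Free_iff. split.
  - intros H. destr H; inv_code; auto; kinds.
  - intros H. do 2 right. left. exists a, b. kcases K; auto 6.
Qed.
Lemma Free_q k v w a : qk k -> (mFree v (cBin k w a) <-> v <> w /\ mFree v a).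
Proof.
  intros K. rewrite Free_iff. split.
  - intros H. destr H; inv_code; auto; kinds.
  - intros H. do 3 right. exists w, a. kcases K; auto 6.
Qed.

Definition op (k : nat) a b : M :=
  match k with 4%nat => a + b | 5%nat => a * b | _ => mE a b end.

Lemma Val_var i z : ~ mVal (cVar i) z.
Proof. rewrite Val_iff. intros H. destr H; inv_code. Qed.
Lemma Val_zero z : mVal cZero z <-> z = m0.
Proof.
  rewrite Val_iff. split; [|intros ->; auto]. intros H. destr H; inv_code; auto.
Qed.
Lemma Val_succ s z : mVal (cSucc s) z <-> exists a, z = mS a /\ mVal s a.
Proof.
  rewrite Val_iff. split; [|intros (a & -> & H); eauto 6].
  intros H. destr H; inv_code; eauto.
Qed.
Lemma Val_bin k s u z : tk k ->
  (mVal (cBin k s u) z <-> exists a b, z = op k a b /\ mVal s a /\ mVal u b).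
Proof.
  intros K. rewrite Val_iff. split.
  - intros H. destr H; inv_code; try kinds; (eexists _, _; split; [reflexivity|auto]).
  - intros (a & b & -> & H). do 2 right. exists s, u, a, b. kcases K; auto 6.
Qed.

Lemma RT_var V c l i u : mRT V c l (cVar i) u <-> mUnder V c l i u.
Proof.
  rewrite RT_iff. split; [|eauto 6]. intros H. destr H; inv_code; auto.
Qed.
Lemma RT_zero V c l u : mRT V c l cZero u <-> u = cZero.
Proof.
  rewrite RT_iff. split; [|intros ->; auto]. intros H. destr H; inv_code; auto.
Qed.
Lemma RT_succ V c l s u :
  mRT V c l (cSucc s) u <-> exists s', u = cSucc s' /\ mRT V c l s s'.
Proof.
  rewrite RT_iff. split; [|intros (s' & -> & H); eauto 8].
  intros H. destr H; inv_code; eauto.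
Qed.
Lemma RT_bin k V c l s u r : tk k -> (mRT V c l (cBin k s u) r <->
  exists s' u', r = cBin k s' u' /\ mRT V c l s s' /\ mRT V c l u u').
Proof.
  intros K. rewrite RT_iff. split.
  - intros H. destr H; inv_code; eauto 6; kinds.
  - intros (s' & u' & -> & H). do 3 right. exists s, s', u, u'. kcases K; auto 6.
Qed.

Lemma Rep_eq V c l s t q : mRep V c l (cEq s t) q <->
  exists s' t', q = cEq s' t' /\ mRT V c l s s' /\ mRT V c l t t'.
Proof.
  rewrite Rep_iff. split; [|intros (s' & t' & -> & H); left; exists l, s, s', t, t'; auto].
  intros H. destr H; inv_code; eauto 6.
Qed.
Lemma Rep_neg V c l a q : mRep V c l (cNeg a) q <->
  exists a', q = cNeg a' /\ mRep V c l a a'.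
Proof.
  rewrite Rep_iff. split; [|intros (a' & -> & H); right; left; exists l, a, a'; auto].
  intros H. destr H; inv_code; eauto 6.
Qed.
Lemma Rep_bin k V c l a b q : fk k -> (mRep V c l (cBin k a b) q <->
  exists a' b', q = cBin k a' b' /\ mRep V c l a a' /\ mRep V c l b b').
Proof.
  intros K. rewrite Rep_iff. split.
  - intros H. destr H; inv_code; eauto 6; kinds.
  - intros (a' & b' & -> & H). do 2 right. left. exists l, a, a', b, b'.
    kcases K; auto 6.
Qed.
Lemma Rep_q k V c l v a q : qk k -> (mRep V c l (cBin k v a) q <->
  exists a', q = cBin k v a' /\ mRep V c (cCons v l) a a').
Proof.
  intros K. rewrite Rep_iff. split.
  - intros H. destr H; inv_code; eauto 6; kinds.
  - intros (a' & -> & H). do 3 right. exists l, v, a, a'. kcases K; auto 6.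
Qed.

End Syntax.

#[export] Hint Resolve D_Mem D_IsNumeral D_IsTerm D_IsForm D_Occurs D_Free D_ClTerm
  D_Sent D_Val D_Under D_RT D_Rep : def.

(** * Replacement of variables *)

Ltac term_induct :=
  match goal with |- forall t, mIsTerm true t -> @?P t => apply (term_ind P) end.
Ltac form_induct :=
  match goal with |- forall p, mIsForm true p -> @?P p => apply (form_ind P) end.

Section Replacement.

Context {M : model} {EM : Enumerated M} {PA : PAmodel M}.
Implicit Types t s u p q a b v w i j l m c : M.
Implicit Types V : M -> M -> M -> Prop.

Lemma Under_cons V c w l i u : mUnder V c (cCons w l) i u <->
  (i = w /\ u = cVar w) \/ (i <> w /\ mUnder V c l i u).
Proof.
  unfold mUnder. rewrite Mem_cons. destruct (classic (i = w)) as [->|N]; tauto.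
Qed.

Lemma Under_total V c l i : (exists u, V c i u) -> exists u, mUnder V c l i u.
Proof.
  intros [u Hu]. destruct (classic (mMem i l)) as [H|H].
  - exists (cVar i). now left.
  - exists u. now right.
Qed.

Lemma Under_fun V c l i u u' : (forall u u', V c i u -> V c i u' -> u = u') ->
  mUnder V c l i u -> mUnder V c l i u' -> u = u'.
Proof. intros H [[A ->]|[A B]] [[A' ->]|[A' B']]; auto; contradiction. Qed.

Lemma RT_total V c l t : Definable3 V -> (forall i, exists u, V c i u) ->
  mIsTerm true t -> exists t', mRT V c l t t'.
Proof.
  intros DV H. revert t. term_induct; [def| | | |].
  - intros i. destruct (Under_total V c l i (H i)) as [u Hu]. exists u.
    now apply RT_var.
  - exists cZero. now apply RT_zero.
  - intros s _ [s' Hs]. exists (cSucc s'). apply RT_succ. eauto.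
  - intros k s u K _ _ [s' Hs] [u' Hu]. exists (cBin k s' u').
    apply RT_bin; eauto.
Qed.

Lemma Rep_total V c l p : Definable3 V -> (forall i, exists u, V c i u) ->
  mIsForm true p -> exists q, mRep V c l p q.
Proof.
  intros DV H F. revert l. revert p F. form_induct; [def| | | |].
  - intros s t Hs Ht l. destruct (RT_total V c l s DV H Hs) as [s' Es],
      (RT_total V c l t DV H Ht) as [t' Et].
    exists (cEq s' t'). apply Rep_eq. eauto.
  - intros a _ IH l. destruct (IH l) as [a' E]. exists (cNeg a').
    apply Rep_neg. eauto.
  - intros k a b K _ _ IH IH' l. destruct (IH l) as [a' E], (IH' l) as [b' E'].
    exists (cBin k a' b'). apply Rep_bin; eauto.
  - intros k v a K _ IH l. destruct (IH (cCons v l)) as [a' E].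
    exists (cBin k v a'). apply Rep_q; eauto.
Qed.

Lemma RT_fun V c l t : Definable3 V ->
  (forall i u u', V c i u -> V c i u' -> u = u') -> mIsTerm true t ->
  forall t1 t2, mRT V c l t t1 -> mRT V c l t t2 -> t1 = t2.
Proof.
  intros DV H. revert t. term_induct; [def| | | |].
  - intros i t1 t2. rewrite !RT_var. apply Under_fun. eauto.
  - intros t1 t2. rewrite !RT_zero. congruence.
  - intros s _ IH t1 t2. rewrite !RT_succ. intros (s1 & -> & H1) (s2 & -> & H2).
    f_equal. auto.
  - intros k s u K _ _ IH IH' t1 t2. rewrite !RT_bin by easy.
    intros (s1 & u1 & -> & H1 & H1') (s2 & u2 & -> & H2 & H2'). f_equal; auto.
Qed.

Lemma Rep_fun V c l p : Definable3 V ->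
  (forall i u u', V c i u -> V c i u' -> u = u') -> mIsForm true p ->
  forall q1 q2, mRep V c l p q1 -> mRep V c l p q2 -> q1 = q2.
Proof.
  intros DV H F. revert l. revert p F.
  form_induct; [def| | | |].
  - intros s t Hs Ht l q1 q2. rewrite !Rep_eq.
    intros (s1 & t1 & -> & H1 & H1') (s2 & t2 & -> & H2 & H2').
    f_equal; eauto using RT_fun.
  - intros a _ IH l q1 q2. rewrite !Rep_neg. intros (a1 & -> & H1) (a2 & -> & H2).
    f_equal. eauto.
  - intros k a b K _ _ IH IH' l q1 q2. rewrite !Rep_bin by easy.
    intros (a1 & b1 & -> & H1 & H1') (a2 & b2 & -> & H2 & H2'). f_equal; eauto.
  - intros k v a K _ IH l q1 q2. rewrite !Rep_q by easy.
    intros (a1 & -> & H1) (a2 & -> & H2). f_equal. eauto.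
Qed.

Lemma RT_congr V V' c c' l l' t : Definable3 V -> Definable3 V' -> mIsTerm true t ->
  (forall i u, mOccurs i t -> mUnder V c l i u -> mUnder V' c' l' i u) ->
  forall t', mRT V c l t t' -> mRT V' c' l' t t'.
Proof.
  intros DV DV'. revert t. term_induct; [def| | | |].
  - intros i H t'. rewrite !RT_var. apply H. now apply Occurs_var.
  - intros _ t'. now rewrite !RT_zero.
  - intros s _ IH H t'. rewrite !RT_succ. intros (s' & -> & Hs). exists s'.
    split; [easy|]. apply IH; auto. intros i u O. apply H. now apply Occurs_succ.
  - intros k s u K _ _ IH IH' H t'. rewrite !RT_bin by easy.
    intros (s' & u' & -> & Hs & Hu). exists s', u'. split; [easy|]. split.
    + apply IH; auto. intros i r O. apply H. apply Occurs_bin; auto.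
    + apply IH'; auto. intros i r O. apply H. apply Occurs_bin; auto.
Qed.

(** Only the free variables of p matter.  The lists may differ: under a binder both
    grow by the same variable, so the hypothesis is preserved. *)
Lemma Rep_congr V V' c c' l l' p : Definable3 V -> Definable3 V' -> mIsForm true p ->
  (forall i u, mFree i p -> mUnder V c l i u -> mUnder V' c' l' i u) ->
  forall q, mRep V c l p q -> mRep V' c' l' p q.
Proof.
  intros DV DV' F. revert l l'. revert p F.
  form_induct; [def| | | |].
  - intros s t Hs Ht l l' H q. rewrite !Rep_eq. intros (s' & t' & -> & H1 & H2).
    exists s', t'. split; [easy|]. split; eapply RT_congr with (V := V); eauto;
      intros i u O; apply H, Free_eq; auto.
  - intros a _ IH l l' H q. rewrite !Rep_neg. intros (a' & -> & Ha). exists a'.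
    split; [easy|]. eapply IH; eauto. intros i u O. apply H. now apply Free_neg.
  - intros k a b K _ _ IH IH' l l' H q. rewrite !Rep_bin by easy.
    intros (a' & b' & -> & Ha & Hb). exists a', b'. split; [easy|]. split.
    + eapply IH; eauto. intros i u O. apply H, Free_bin; auto.
    + eapply IH'; eauto. intros i u O. apply H, Free_bin; auto.
  - intros k v a K _ IH l l' H q. rewrite !Rep_q by easy.
    intros (a' & -> & Ha). exists a'. split; [easy|]. eapply IH; eauto.
    intros i u O. rewrite !Under_cons. intros [A|[A B]]; auto. right.
    split; [easy|]. apply H; [|easy]. now apply Free_q.
Qed.

Lemma RT_id V c l t : Definable3 V -> mIsTerm true t ->
  (forall i u, mOccurs i t -> mUnder V c l i u -> u = cVar i) ->
  forall t', mRT V c l t t' -> t' = t.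
Proof.
  intros DV. revert t. term_induct; [def| | | |].
  - intros i H t'. rewrite !RT_var. apply H. now apply Occurs_var.
  - intros _ t'. now rewrite !RT_zero.
  - intros s _ IH H t'. rewrite !RT_succ. intros (s' & -> & Hs). f_equal.
    apply IH; auto. intros i u O. apply H. now apply Occurs_succ.
  - intros k s u K _ _ IH IH' H t'. rewrite !RT_bin by easy.
    intros (s' & u' & -> & Hs & Hu). f_equal.
    + apply IH; auto. intros i r O. apply H. apply Occurs_bin; auto.
    + apply IH'; auto. intros i r O. apply H. apply Occurs_bin; auto.
Qed.

Lemma Rep_id V c l p : Definable3 V -> mIsForm true p ->
  (forall i u, mFree i p -> mUnder V c l i u -> u = cVar i) ->
  forall q, mRep V c l p q -> q = p.
Proof.
  intros DV F. revert l. revert p F.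
  form_induct; [def| | | |].
  - intros s t Hs Ht l H q. rewrite !Rep_eq. intros (s' & t' & -> & H1 & H2).
    f_equal; eapply RT_id with (V := V); eauto;
      intros i u O; apply H, Free_eq; auto.
  - intros a _ IH l H q. rewrite !Rep_neg. intros (a' & -> & Ha). f_equal.
    eapply IH; eauto. intros i u O. apply H. now apply Free_neg.
  - intros k a b K _ _ IH IH' l H q. rewrite !Rep_bin by easy.
    intros (a' & b' & -> & Ha & Hb). f_equal.
    + eapply IH; eauto. intros i u O. apply H, Free_bin; auto.
    + eapply IH'; eauto. intros i u O. apply H, Free_bin; auto.
  - intros k v a K _ IH l H q. rewrite !Rep_q by easy.
    intros (a' & -> & Ha). f_equal. eapply IH; eauto.
    intros i u O. rewrite !Under_cons. intros [[-> A]|[A B]]; auto.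
    apply H; [|easy]. now apply Free_q.
Qed.

Lemma RT_IsTerm V c l t : Definable3 V -> (forall i u, V c i u -> mIsTerm true u) ->
  mIsTerm true t -> forall t', mRT V c l t t' -> mIsTerm true t'.
Proof.
  intros DV H. revert t. term_induct; [def| | | |].
  - intros i t'. rewrite !RT_var. intros [[_ ->]|[_ A]]; [apply IsTerm_var|eauto].
  - intros t'. rewrite !RT_zero. intros ->. apply IsTerm_zero.
  - intros s _ IH t'. rewrite !RT_succ. intros (s' & -> & Hs).
    apply IsTerm_succ. auto.
  - intros k s u K _ _ IH IH' t'. rewrite !RT_bin by easy.
    intros (s' & u' & -> & Hs & Hu). apply IsTerm_bin; auto.
Qed.

Lemma Rep_IsForm V c l p : Definable3 V -> (forall i u, V c i u -> mIsTerm true u) ->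
  mIsForm true p -> forall q, mRep V c l p q -> mIsForm true q.
Proof.
  intros DV H F. revert l. revert p F.
  form_induct; [def| | | |].
  - intros s t Hs Ht l q. rewrite !Rep_eq. intros (s' & t' & -> & H1 & H2).
    apply IsForm_eq. eauto using RT_IsTerm.
  - intros a _ IH l q. rewrite !Rep_neg. intros (a' & -> & Ha).
    apply IsForm_neg. eauto.
  - intros k a b K _ _ IH IH' l q. rewrite !Rep_bin by easy.
    intros (a' & b' & -> & Ha & Hb). apply IsForm_bin; eauto.
  - intros k v a K _ IH l q. rewrite !Rep_q by easy.
    intros (a' & -> & Ha). apply IsForm_q; eauto.
Qed.

(** The clauses of the replacement relation follow the formation of terms. *)
Lemma RT_source V c l t t' : Definable3 V -> mRT V c l t t' -> mIsTerm true t.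
Proof.
  intros DV H. unfold mRT in H. remember (mpair t t') as x eqn:E.
  revert t t' E. revert x H.
  match goal with |- forall x, mLfp ?G x -> @?Q x => refine (Lfp_ind G _ Q _ _) end;
    [intro; pos|def|].
  intros x R s s' ->. destruct R as [R|[R|[R|R]]].
  - destruct R as (i & u & E & _). inv_code. apply IsTerm_var.
  - inv_code. apply IsTerm_zero.
  - destruct R as (r & r' & E & _ & R). inv_code. apply IsTerm_succ. eauto.
  - destruct R as (r & r' & u & u' & E & (_ & R) & (_ & U)).
    destruct E as [E|[E|E]]; inv_code; (apply IsTerm_bin; [kinds|eauto]).
Qed.

Lemma RT_Occurs V c l j t : Definable3 V -> mIsTerm true t ->
  forall t', mRT V c l t t' -> mOccurs j t' ->
  exists i u, mOccurs i t /\ mUnder V c l i u /\ mOccurs j u.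
Proof.
  intros DV. revert t. term_induct; [def| | | |].
  - intros i t'. rewrite !RT_var. intros A O. exists i, t'.
    rewrite Occurs_var. auto.
  - intros t'. rewrite !RT_zero. intros -> O. now apply Occurs_zero in O.
  - intros s _ IH t'. rewrite !RT_succ. intros (s' & -> & Hs).
    rewrite Occurs_succ. intros O. destruct (IH s') as (i & u & A); auto.
    exists i, u. now rewrite Occurs_succ.
  - intros k s u K _ _ IH IH' t'. rewrite !RT_bin by easy.
    intros (s' & u' & -> & Hs & Hu). rewrite Occurs_bin by easy. intros [O|O].
    + destruct (IH s') as (i & r & A); auto.
      exists i, r. rewrite Occurs_bin by easy. tauto.
    + destruct (IH' u') as (i & r & A); auto.
      exists i, r. rewrite Occurs_bin by easy. tauto.
Qed.

Lemma Rep_Free V c l j p : Definable3 V -> mIsForm true p ->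
  forall q, mRep V c l p q -> mFree j q ->
  exists i u, mFree i p /\ mUnder V c l i u /\ mOccurs j u.
Proof.
  intros DV F. revert l. revert p F.
  form_induct; [def| | | |].
  - intros s t Hs Ht l q. rewrite !Rep_eq. intros (s' & t' & -> & H1 & H2).
    rewrite Free_eq. intros [O|O].
    + destruct (RT_Occurs V c l j s DV Hs s' H1 O) as (i & u & A).
      exists i, u. rewrite Free_eq. tauto.
    + destruct (RT_Occurs V c l j t DV Ht t' H2 O) as (i & u & A).
      exists i, u. rewrite Free_eq. tauto.
  - intros a _ IH l q. rewrite !Rep_neg. intros (a' & -> & Ha).
    rewrite Free_neg. intros O. destruct (IH l a') as (i & u & A); auto.
    exists i, u. now rewrite Free_neg.
  - intros k a b K _ _ IH IH' l q. rewrite !Rep_bin by easy.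
    intros (a' & b' & -> & Ha & Hb). rewrite Free_bin by easy. intros [O|O].
    + destruct (IH l a') as (i & u & A); auto.
      exists i, u. rewrite Free_bin by easy. tauto.
    + destruct (IH' l b') as (i & u & A); auto.
      exists i, u. rewrite Free_bin by easy. tauto.
  - intros k v a K _ IH l q. rewrite !Rep_q by easy.
    intros (a' & -> & Ha). rewrite Free_q by easy. intros [N O].
    destruct (IH (cCons v l) a') as (i & u & A & B & C); auto.
    apply Under_cons in B as [[-> ->]|[B B']].
    + now apply Occurs_var in C.
    + exists i, u. rewrite Free_q by easy. tauto.
Qed.

Lemma RT_comp V1 V2 V3 c1 c2 c3 l1 l2 l3 t :
  Definable3 V1 -> Definable3 V2 -> Definable3 V3 -> mIsTerm true t ->
  (forall i u r, mOccurs i t -> mUnder V1 c1 l1 i u -> mRT V2 c2 l2 u r ->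
    mUnder V3 c3 l3 i r) ->
  forall t' r, mRT V1 c1 l1 t t' -> mRT V2 c2 l2 t' r -> mRT V3 c3 l3 t r.
Proof.
  intros D1 D2 D3. revert t.
  term_induct; [def| | | |].
  - intros i H t' r. rewrite !RT_var. intros A B. apply H with t'; auto.
    now apply Occurs_var.
  - intros _ t' r. rewrite !RT_zero. intros ->. now rewrite RT_zero.
  - intros s _ IH H t' r. rewrite !RT_succ. intros (s' & -> & Hs).
    rewrite RT_succ. intros (s'' & -> & Hs'). exists s''. split; [easy|].
    apply IH with s'; auto. intros i u z O. apply H. now apply Occurs_succ.
  - intros k s u K _ _ IH IH' H t' r. rewrite !RT_bin by easy.
    intros (s' & u' & -> & Hs & Hu). rewrite RT_bin by easy.
    intros (s'' & u'' & -> & Hs' & Hu'). exists s'', u''. split; [easy|]. split.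
    + apply IH with s'; auto. intros i x z O. apply H, Occurs_bin; auto.
    + apply IH' with u'; auto. intros i x z O. apply H, Occurs_bin; auto.
Qed.

(** Successive replacements compose if no variable of a replacing term is
    captured.  Capture-freeness enters as a relation S between the list of
    variables bound so far and the rest of the formula, since the substitutions
    in use avoid capture for different reasons. *)
Lemma Rep_comp (S : M -> M -> Prop) V1 V2 V3 c1 c2 c3 l1 l2 l3 p :
  Definable2 S -> Definable3 V1 -> Definable3 V2 -> Definable3 V3 ->
  (forall i u, V1 c1 i u -> mIsTerm true u) ->
  (forall l a, S l (cNeg a) -> S l a) ->
  (forall k l a b, fk k -> S l (cBin k a b) -> S l a /\ S l b) ->
  (forall k l w a, qk k -> S l (cBin k w a) -> S (cCons w l) a /\
    forall i u, mFree i a -> i <> w -> mUnder V1 c1 l i u -> ~ mOccurs w u) ->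
  mIsForm true p -> S l1 p ->
  (forall i u r, mFree i p -> mUnder V1 c1 l1 i u -> mRT V2 c2 l2 u r ->
    mUnder V3 c3 l3 i r) ->
  forall q r, mRep V1 c1 l1 p q -> mRep V2 c2 l2 q r -> mRep V3 c3 l3 p r.
Proof.
  intros DS D1 D2 D3 HV Sn Sb Sq F. revert l1 l2 l3. revert p F.
  form_induct; [def| | | |].
  - intros s t Hs Ht l1 l2 l3 _ H q r. rewrite !Rep_eq.
    intros (s' & t' & -> & H1 & H2). rewrite Rep_eq.
    intros (s'' & t'' & -> & H1' & H2'). exists s'', t''. split; [easy|].
    split; eapply RT_comp with (V1 := V1) (V2 := V2); eauto;
      intros i u z O; apply H, Free_eq; auto.
  - intros a _ IH l1 l2 l3 HS H q r. rewrite !Rep_neg. intros (a' & -> & Ha).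
    rewrite Rep_neg. intros (a'' & -> & Ha'). exists a''. split; [easy|].
    eapply IH; eauto. intros i u z O. apply H. now apply Free_neg.
  - intros k a b K _ _ IH IH' l1 l2 l3 HS H q r. rewrite !Rep_bin by easy.
    intros (a' & b' & -> & Ha & Hb). rewrite Rep_bin by easy.
    intros (a'' & b'' & -> & Ha' & Hb'). exists a'', b''. split; [easy|].
    apply Sb in HS as [Sa Sb']; auto. split.
    + eapply IH; eauto. intros i u z O. apply H, Free_bin; auto.
    + eapply IH'; eauto. intros i u z O. apply H, Free_bin; auto.
  - intros k w a K _ IH l1 l2 l3 HS H q r. rewrite !Rep_q by easy.
    intros (a' & -> & Ha). rewrite Rep_q by easy. intros (a'' & -> & Ha').
    exists a''. split; [easy|]. apply Sq in HS as [Sa Sc]; auto.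
    eapply IH; eauto. intros i u z O. rewrite !Under_cons.
    intros [[-> ->]|[N A]] B.
    + left. split; [easy|]. apply RT_var, Under_cons in B as [[_ B]|[N _]]; auto.
      congruence.
    + right. split; [easy|]. apply H with u; auto; [now apply Free_q|].
      apply (RT_congr V2 V2 c2 c2 (cCons w l2) l2); auto.
      * destruct A as [[_ ->]|[_ A]]; [apply IsTerm_var|eauto].
      * intros j x Oj. rewrite Under_cons. intros [[-> _]|[_ C]]; auto.
        exfalso. revert Oj. now apply (Sc i).
Qed.

End Replacement.

(** * Truth *)

Definition Vsub {M : model} (v t c i u : M) : Prop :=
  (i = v /\ u = t) \/ (i <> v /\ u = cVar i).
Definition Vseq {M : model} (x i u : M) : Prop :=
  exists n, mLh x n /\ i < n /\ u = mE x i.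

Definition mSubst {M : model} (v t p q : M) : Prop := mRep (Vsub v t) m0 m0 p q.
Definition mSubstSeq {M : model} (x p q : M) : Prop := mRep Vseq x m0 p q.

Definition mTermSeq {M : model} (x : M) : Prop :=
  exists n, mLh x n /\ forall i, i < n -> mClTerm (mE x i).
Definition mValSeq {M : model} (x w : M) : Prop :=
  exists n, mLh x n /\ mLh w n /\ forall i, i < n -> mVal (mE x i) (mE w i).

Definition mT_inst {M : model} (v x p : M) : Prop :=
  exists c q, mIsNumeral x c /\ mSubst v c p q /\ mT q.

(** The axioms on truth as they read in a model.  Bounded induction is used for the
    formula: all j <= x with j <= n satisfy T((u)_j). *)
Class CTmodel (M : model) := {
  ct_eq : forall s t : M, mClTerm s -> mClTerm t ->
    (mT (cEq s t) <-> exists z, mVal s z /\ mVal t z);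
  ct_and : forall p q : M, mSent p -> mSent q ->
    (mT (cBin 9 p q) <-> mT p /\ mT q);
  ct_or : forall p q : M, mSent p -> mSent q ->
    (mT (cBin 10 p q) <-> mT p \/ mT q);
  ct_neg : forall p : M, mSent p -> (mT (cNeg p) <-> ~ mT p);
  ct_all : forall v p : M, mIsForm true p -> (forall w, mFree w p -> w = v) ->
    (mT (cBin 12 v p) <-> forall x, mT_inst v x p);
  ct_ex : forall v p : M, mIsForm true p -> (forall w, mFree w p -> w = v) ->
    (mT (cBin 11 v p) <-> exists x, mT_inst v x p);
  ct_reg : forall p x y : M, mIsForm true p -> mTermSeq x -> mTermSeq y ->
    (exists w, mValSeq x w /\ mValSeq y w) ->
    forall q r, mSubstSeq x p q -> mSubstSeq y p r -> (mT q <-> mT r);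
  ct_ind : forall u n : M,
    let P x := forall j, j <= x -> (exists w, w <= n /\ w = j) -> mT (mE u j) in
    P m0 -> (forall x, P x -> P (mS x)) -> forall x, P x }.

Section Truth.

Context {M : model} {EM : Enumerated M} {PA : PAmodel M}.
Implicit Types t s u p q a b v w i j l m c x y z : M.

(** ** Numerals and values *)

Lemma IsNumeral_zero c : mIsNumeral m0 c <-> c = cZero.
Proof.
  rewrite IsNumeral_iff. split.
  - intros [H|(y & d & H & _)]; apply mpair_inj in H as [H H']; auto.
    symmetry in H. now apply pa_S0 in H.
  - intros ->. now left.
Qed.

Lemma IsNumeral_succ x c :
  mIsNumeral (mS x) c <-> exists d, c = cSucc d /\ mIsNumeral x d.
Proof.
  rewrite IsNumeral_iff. split.
  - intros [H|(y & d & H & D)]; apply mpair_inj in H as [H H'].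
    + now apply pa_S0 in H.
    + apply pa_S_inj in H as ->. eauto.
  - intros (d & -> & H). right. now exists x, d.
Qed.

Lemma IsNumeral_unique x : exists c, forall d, mIsNumeral x d <-> d = c.
Proof.
  ind x.
  - exists cZero. exact IsNumeral_zero.
  - intros x [c H]. exists (cSucc c). intros d. rewrite IsNumeral_succ. split.
    + intros (d' & -> & D). now rewrite (proj1 (H d') D).
    + intros ->. exists c. split; [easy|]. now apply H.
Qed.

Definition mnum x : M := iota (mIsNumeral x).

Lemma IsNumeral_num x c : mIsNumeral x c <-> c = mnum x.
Proof.
  destruct (IsNumeral_unique x) as [d H]. rewrite H.
  assert (E : mnum x = d); [|now rewrite E].
  apply iota_eq; [now apply H|]. intros z. apply H.
Qed.

Lemma D_num : DefinableF mnum.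
Proof. apply (D_iota mIsNumeral D_IsNumeral). Qed.

Lemma num_zero : mnum m0 = cZero.
Proof. symmetry. apply IsNumeral_num. now apply IsNumeral_zero. Qed.

Lemma num_succ x : mnum (mS x) = cSucc (mnum x).
Proof.
  symmetry. apply IsNumeral_num, IsNumeral_succ. exists (mnum x).
  split; [easy|]. now apply IsNumeral_num.
Qed.

#[local] Hint Resolve D_num : def.

Lemma num_term x : mIsTerm true (mnum x).
Proof.
  ind x.
  - rewrite num_zero. apply IsTerm_zero.
  - intros x. rewrite num_succ, IsTerm_succ. auto.
Qed.

Lemma num_closed x v : ~ mOccurs v (mnum x).
Proof.
  ind x.
  - rewrite num_zero. apply Occurs_zero.
  - intros x. rewrite num_succ, Occurs_succ. auto.
Qed.

Lemma num_ClTerm x : mClTerm (mnum x).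
Proof. split; [apply num_term|]. intros [v H]. now apply num_closed in H. Qed.

Lemma Val_num x : mVal (mnum x) x.
Proof.
  ind x.
  - rewrite num_zero. now apply Val_zero.
  - intros x H. rewrite num_succ. apply Val_succ. eauto.
Qed.

Lemma Val_total t : mIsTerm true t -> (forall v, ~ mOccurs v t) -> exists z, mVal t z.
Proof.
  revert t. term_induct; [def| | | |].
  - intros i H. exfalso. apply (H i). now apply Occurs_var.
  - intros _. exists m0. now apply Val_zero.
  - intros s _ IH H. destruct IH as [z Hz].
    + intros v O. apply (H v). now apply Occurs_succ.
    + exists (mS z). apply Val_succ. eauto.
  - intros k s u K _ _ IH IH' H. destruct IH as [a Ha].
    { intros v O. apply (H v). apply Occurs_bin; auto. }
    destruct IH' as [b Hb].
    { intros v O. apply (H v). apply Occurs_bin; auto. }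
    exists (op k a b). apply Val_bin; eauto 6.
Qed.

Lemma Val_fun t : mIsTerm true t -> forall y z, mVal t y -> mVal t z -> y = z.
Proof.
  revert t. term_induct; [def| | | |].
  - intros i y z H. now apply Val_var in H.
  - intros y z. rewrite !Val_zero. congruence.
  - intros s _ IH y z. rewrite !Val_succ. intros (a & -> & A) (b & -> & B).
    f_equal. auto.
  - intros k s u K _ _ IH IH' y z. rewrite !Val_bin by easy.
    intros (a & b & -> & A & B) (a' & b' & -> & A' & B'). f_equal; auto.
Qed.

Definition mval t : M := iota (mVal t).

Lemma D_val : DefinableF mval.
Proof. apply (D_iota mVal D_Val). Qed.

Lemma Val_val t z : mClTerm t -> (mVal t z <-> z = mval t).
Proof.
  intros [T C]. assert (H : mVal t (mval t)).
  { apply (iota_spec (mVal t)); [|now apply Val_fun]. apply Val_total; [easy|].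
    intros v O. apply C. now exists v. }
  split; [|now intros ->]. intros H'. now apply Val_fun with t.
Qed.

Lemma val_num x : mval (mnum x) = x.
Proof. symmetry. apply Val_val; [apply num_ClTerm|apply Val_num]. Qed.

(** ** Closed instances *)

Definition Vnum c i u : Prop := u = mnum (mE c i).

Lemma D_Vnum : Definable3 Vnum.
Proof. unfold Vnum. def. Qed.
Lemma D_Vsub v t : Definable3 (Vsub v t).
Proof. unfold Vsub. def. Qed.
Lemma D_Vseq3 : Definable3 (@Vseq M).
Proof. unfold Vseq. def. Qed.
#[local] Hint Resolve D_Vnum D_Vsub D_Vseq3 D_val : def.

Definition msub c p : M := iota (mRep Vnum c m0 p).
Definition msubt c t : M := iota (mRT Vnum c m0 t).

Lemma D_sub : DefinableF2 msub.
Proof. apply (D_iota2 (fun c p q => mRep Vnum c m0 p q)). def. Qed.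
Lemma D_subt : DefinableF2 msubt.
Proof. apply (D_iota2 (fun c p q => mRT Vnum c m0 p q)). def. Qed.
#[local] Hint Resolve D_sub D_subt : def.

Lemma Vnum_total c i : exists u, Vnum c i u.
Proof. now exists (mnum (mE c i)). Qed.

Lemma Vnum_fun c i u u' : Vnum c i u -> Vnum c i u' -> u = u'.
Proof. unfold Vnum. congruence. Qed.

Lemma Vnum_term c i u : Vnum c i u -> mIsTerm true u.
Proof. intros ->. apply num_term. Qed.

Lemma Rep_sub c p q : mIsForm true p -> (mRep Vnum c m0 p q <-> q = msub c p).
Proof.
  intros F. assert (U := fun l => Rep_fun Vnum c l p D_Vnum (Vnum_fun c) F).
  assert (H : mRep Vnum c m0 p (msub c p)).
  { apply (iota_spec (mRep Vnum c m0 p)); [|now apply U]. apply Rep_total; auto using D_Vnum, Vnum_total. }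
  split; [|now intros ->]. intros H'. now apply (U m0).
Qed.

Lemma RT_subt c t u : mIsTerm true t -> (mRT Vnum c m0 t u <-> u = msubt c t).
Proof.
  intros F. assert (U := RT_fun Vnum c m0 t D_Vnum (Vnum_fun c) F).
  assert (H : mRT Vnum c m0 t (msubt c t)).
  { apply (iota_spec (mRT Vnum c m0 t)); [|now apply U]. apply RT_total; auto using D_Vnum, Vnum_total. }
  split; [|now intros ->]. intros H'. now apply U.
Qed.

Lemma Under_nil V c i u : mUnder V c m0 i u <-> V c i u.
Proof.
  unfold mUnder. pose proof (Mem_nil i). tauto.
Qed.

Lemma subt_ClTerm c t : mIsTerm true t -> mClTerm (msubt c t).
Proof.
  intros T. assert (R : mRT Vnum c m0 t (msubt c t)) by now apply RT_subt.
  split.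
  - eapply RT_IsTerm; eauto using D_Vnum, Vnum_term.
  - intros [v O]. eapply RT_Occurs in O as (i & u & _ & A & O); eauto using D_Vnum.
    apply Under_nil in A as ->. now apply num_closed in O.
Qed.

Lemma sub_Sent c p : mIsForm true p -> mSent (msub c p).
Proof.
  intros T. assert (R : mRep Vnum c m0 p (msub c p)) by now apply Rep_sub.
  split.
  - eapply Rep_IsForm; eauto using D_Vnum, Vnum_term.
  - intros [v O]. eapply Rep_Free in O as (i & u & _ & A & O); eauto using D_Vnum.
    apply Under_nil in A as ->. now apply num_closed in O.
Qed.

Lemma sub_id c p : mSent p -> msub c p = p.
Proof.
  intros [F C]. assert (R : mRep Vnum c m0 p (msub c p)) by now apply Rep_sub.
  eapply Rep_id; eauto using D_Vnum. intros i u O. exfalso. apply C. now exists i.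
Qed.

Lemma sub_ext c c' p : mIsForm true p ->
  (forall i, mFree i p -> mE c i = mE c' i) -> msub c p = msub c' p.
Proof.
  intros F H. apply Rep_sub; [easy|].
  apply (Rep_congr Vnum Vnum c c' m0 m0); auto using D_Vnum.
  - intros i u O. rewrite !Under_nil. unfold Vnum. rewrite H; auto.
  - now apply Rep_sub.
Qed.

Lemma sub_eq c s t : mIsTerm true s -> mIsTerm true t ->
  msub c (cEq s t) = cEq (msubt c s) (msubt c t).
Proof.
  intros S T. symmetry. apply Rep_sub; [now apply IsForm_eq|]. apply Rep_eq.
  exists (msubt c s), (msubt c t). repeat split; now apply RT_subt.
Qed.

Lemma sub_neg c a : mIsForm true a -> msub c (cNeg a) = cNeg (msub c a).
Proof.
  intros A. symmetry. apply Rep_sub; [now apply IsForm_neg|]. apply Rep_neg.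
  exists (msub c a). split; [easy|]. now apply Rep_sub.
Qed.

Lemma sub_bin k c a b : fk k -> mIsForm true a -> mIsForm true b ->
  msub c (cBin k a b) = cBin k (msub c a) (msub c b).
Proof.
  intros K A B. symmetry. apply Rep_sub; [now apply IsForm_bin|]. apply Rep_bin; [easy|].
  exists (msub c a), (msub c b). repeat split; now apply Rep_sub.
Qed.

Definition tval c t : M := mval (msubt c t).

Lemma tval_var c i : tval c (cVar i) = mE c i.
Proof.
  unfold tval. assert (E : msubt c (cVar i) = mnum (mE c i)).
  { symmetry. apply RT_subt; [apply IsTerm_var|]. now apply RT_var, Under_nil. }
  now rewrite E, val_num.
Qed.

Lemma tval_zero c : tval c cZero = m0.
Proof.
  unfold tval. assert (E : msubt c cZero = mnum m0).
  { symmetry. apply RT_subt; [apply IsTerm_zero|]. apply RT_zero, num_zero. }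
  now rewrite E, val_num.
Qed.

Lemma tval_succ c s : mIsTerm true s -> tval c (cSucc s) = mS (tval c s).
Proof.
  intros S. unfold tval. assert (E : msubt c (cSucc s) = cSucc (msubt c s)).
  { symmetry. apply RT_subt; [now apply IsTerm_succ|]. apply RT_succ.
    exists (msubt c s). split; [easy|]. now apply RT_subt. }
  symmetry. apply Val_val; [apply subt_ClTerm; now apply IsTerm_succ|].
  rewrite E. apply Val_succ. exists (mval (msubt c s)). split; [easy|].
  apply Val_val; auto using subt_ClTerm.
Qed.

Lemma tval_bin k c s u : tk k -> mIsTerm true s -> mIsTerm true u ->
  tval c (cBin k s u) = op k (tval c s) (tval c u).
Proof.
  intros K S U. unfold tval.
  assert (E : msubt c (cBin k s u) = cBin k (msubt c s) (msubt c u)).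
  { symmetry. apply RT_subt; [now apply IsTerm_bin|]. apply RT_bin; [easy|].
    exists (msubt c s), (msubt c u). repeat split; now apply RT_subt. }
  symmetry. apply Val_val; [apply subt_ClTerm; now apply IsTerm_bin|].
  rewrite E. apply Val_bin; [easy|]. exists (mval (msubt c s)), (mval (msubt c u)).
  repeat split; apply Val_val; auto using subt_ClTerm.
Qed.

Lemma tval_num c x : tval c (mnum x) = x.
Proof.
  unfold tval. assert (E : msubt c (mnum x) = mnum x).
  { apply (RT_id Vnum c m0); auto using D_Vnum, num_term.
    - intros i u O. now apply num_closed in O.
    - apply RT_subt; auto using num_term. }
  now rewrite E, val_num.
Qed.

(** An assignment is any element c, giving x_i the value (c)_i; beyond the length of
    c this is 0, so assignments are total. *)
Definition Upd c v x c' : Prop :=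
  mE c' v = x /\ forall i, i <> v -> mE c' i = mE c i.

Lemma Upd_exists c v x : exists c', Upd c v x c'.
Proof.
  destruct (elt_eventually_0 c) as [n Hn].
  destruct (seq_exists_rel (fun i y => (i = v /\ y = x) \/ (i <> v /\ y = mE c i))
    (n + mS v)) as (s & L & H).
  - def.
  - intros i _. destruct (classic (i = v)).
    + exists x. now left.
    + exists (mE c i). now right.
  - intros i y z _ [[A ->]|[A ->]] [[A' ->]|[A' ->]]; auto; contradiction.
  - assert (Hv : v < n + mS v) by apply le_add_l. exists s. split.
    + destruct (H v Hv) as [[_ E]|[N _]]; auto. contradiction.
    + intros i N. destruct (le_or_lt (n + mS v) i) as [B|B].
      * rewrite (elt_out s _ i L B). symmetry. apply Hn.
        apply le_trans with (n + mS v); [apply le_add|easy].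
      * destruct (H i B) as [[E _]|[_ E]]; auto. contradiction.
Qed.

(** ** Induction for the truth predicate *)

Context {CT : CTmodel M}.

Lemma T_strong u n :
  (forall i, i <= n -> (forall j, j < i -> mT (mE u j)) -> mT (mE u i)) -> mT (mE u n).
Proof.
  intros H. apply (ct_ind u n) with (x := n) (j := n); try apply le_refl.
  - intros j Hj _. apply le_0_eq in Hj as ->. apply H; [apply le_0|].
    intros j Hj. now apply not_lt_0 in Hj.
  - intros x IH j Hj (w & Hw & ->). apply H; [easy|].
    intros i Hi. apply IH.
    + apply lt_S_le. now apply lt_le_trans with j.
    + exists i. split; [|easy]. apply le_trans with j; [now apply lt_le|easy].
  - exists n. split; [apply le_refl|easy].
Qed.

(** Induction for truth along a derivation.  The sentences F x for the members x of
    the derivation form a coded sequence u, because F does not involve T; so the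
    induction formula contains T only in the atom T((u)_i). *)
Lemma T_Lfp_ind (G : (M -> Prop) -> M -> Prop) (F : M -> M) :
  (forall x, Pos (fun X => G X x)) -> DefinableF F ->
  (forall x, G (fun y => mLfp G y /\ mT (F y)) x -> mT (F x)) ->
  forall x, mLfp G x -> mT (F x).
Proof.
  intros PG D H x (s & n & <- & C).
  destruct (seq_exists (fun i => F (mE s i)) (mS n)) as (u & _ & Hu); [def|].
  rewrite <- (Hu n (lt_S n)). apply T_strong. intros i Hi IH.
  rewrite Hu by now apply S_le. apply H.
  eapply (Pos_mono (fun X => G X _)); [apply PG| |now apply C].
  intros y (j & Hj & <-). assert (Hjn : j <= n).
  { apply le_trans with i; [now apply lt_le|easy]. }
  split.
  - exists s, j. split; [easy|]. intros k Hk. apply C. now apply le_trans with j.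
  - rewrite <- Hu by now apply S_le. auto.
Qed.

(** ** Tarski's clauses for nonstandard formulae *)

Definition Tr c p : Prop := mT (msub c p).

Lemma Tr_sent c p : mSent p -> (Tr c p <-> mT p).
Proof. intros S. unfold Tr. now rewrite sub_id. Qed.

Lemma Tr_ext c c' p : mIsForm true p ->
  (forall i, mFree i p -> mE c i = mE c' i) -> (Tr c p <-> Tr c' p).
Proof. intros F H. unfold Tr. now rewrite (sub_ext c c' p F H). Qed.

Lemma Tr_eq c s t : mIsTerm true s -> mIsTerm true t ->
  (Tr c (cEq s t) <-> tval c s = tval c t).
Proof.
  intros S T. unfold Tr. rewrite sub_eq, ct_eq; auto using subt_ClTerm.
  unfold tval. split.
  - intros (z & A & B). apply Val_val in A, B; auto using subt_ClTerm. congruence.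
  - intros E. exists (mval (msubt c s)).
    split; apply Val_val; auto using subt_ClTerm.
Qed.

Lemma Tr_neg c a : mIsForm true a -> (Tr c (cNeg a) <-> ~ Tr c a).
Proof. intros A. unfold Tr. rewrite sub_neg, ct_neg; auto using sub_Sent. easy. Qed.

Lemma Tr_and c a b : mIsForm true a -> mIsForm true b ->
  (Tr c (cBin 9 a b) <-> Tr c a /\ Tr c b).
Proof.
  intros A B. unfold Tr. rewrite sub_bin, ct_and; auto using sub_Sent; [easy|kinds].
Qed.

Lemma Tr_or c a b : mIsForm true a -> mIsForm true b ->
  (Tr c (cBin 10 a b) <-> Tr c a \/ Tr c b).
Proof.
  intros A B. unfold Tr. rewrite sub_bin, ct_or; auto using sub_Sent; [easy|kinds].
Qed.

(** Replacing first the other variables and then v by numerals is one replacement by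
    the numerals of the changed assignment. *)
Lemma T_inst_Upd c v x p p' c' : mIsForm true p -> mRep Vnum c (cCons v m0) p p' ->
  Upd c v x c' -> (mT_inst v x p' <-> Tr c' p).
Proof.
  intros F R [Hv Ho].
  assert (F' : mIsForm true p') by (eapply Rep_IsForm; eauto using D_Vnum, Vnum_term).
  assert (E : forall q, mSubst v (mnum x) p' q -> q = msub c' p).
  { intros q S. apply Rep_sub; [easy|].
    apply (Rep_comp (fun _ _ => True) Vnum (Vsub v (mnum x)) Vnum c m0 c'
      (cCons v m0) m0 m0) with p'; auto using D_Vnum, D_Vsub.
    - def.
    - apply Vnum_term.
    - intros k l w a _ _. split; [easy|].
      intros i u _ N [[_ ->]|[_ ->]] O; [apply Occurs_var in O; congruence|].
      now apply num_closed in O.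
    - intros i u r _. rewrite Under_cons, !Under_nil. intros [[-> ->]|[N ->]].
      + rewrite RT_var, Under_nil. intros [[_ ->]|[N _]]; [|contradiction].
        unfold Vnum. now rewrite Hv.
      + intros A. unfold Vnum. rewrite Ho by easy.
        eapply RT_id; eauto using D_Vsub, num_term.
        intros j y O. now apply num_closed in O. }
  split.
  - intros (d & q & N & S & T). apply IsNumeral_num in N as ->.
    apply E in S as ->. exact T.
  - intros T. destruct (Rep_total (Vsub v (mnum x)) m0 m0 p') as [q S]; auto using D_Vsub.
    + intros i. destruct (classic (i = v)).
      * exists (mnum x). now left.
      * exists (cVar i). now right.
    + exists (mnum x), q. split; [now apply IsNumeral_num|]. split; [exact S|].
      apply E in S as ->. exact T.
Qed.

Lemma sub_q k c v p : qk k -> mIsForm true p ->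
  exists p', msub c (cBin k v p) = cBin k v p' /\ mRep Vnum c (cCons v m0) p p' /\
    mIsForm true p' /\ forall w, mFree w p' -> w = v.
Proof.
  intros K F. destruct (Rep_total Vnum c (cCons v m0) p) as [p' R];
    auto using D_Vnum, Vnum_total.
  exists p'. repeat split; auto.
  - symmetry. apply Rep_sub; [now apply IsForm_q|]. apply Rep_q; eauto.
  - eapply Rep_IsForm; eauto using D_Vnum, Vnum_term.
  - intros w O. eapply Rep_Free in O as (i & u & _ & A & O); eauto using D_Vnum.
    apply Under_cons in A as [[_ ->]|[_ A]].
    + now apply Occurs_var in O.
    + apply Under_nil in A as ->. now apply num_closed in O.
Qed.

Lemma Tr_all c v p : mIsForm true p ->
  (Tr c (cBin 12 v p) <-> forall x c', Upd c v x c' -> Tr c' p).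
Proof.
  intros F. destruct (sub_q 12 c v p) as (p' & E & R & F' & C); [kinds|easy|].
  unfold Tr at 1. rewrite E, ct_all by auto. split.
  - intros H x c' U. now apply (T_inst_Upd c v x p p' c').
  - intros H x. destruct (Upd_exists c v x) as [c' U].
    apply (T_inst_Upd c v x p p' c'); eauto.
Qed.

Lemma Tr_ex c v p : mIsForm true p ->
  (Tr c (cBin 11 v p) <-> exists x c', Upd c v x c' /\ Tr c' p).
Proof.
  intros F. destruct (sub_q 11 c v p) as (p' & E & R & F' & C); [kinds|easy|].
  unfold Tr at 1. rewrite E, ct_ex by auto. split.
  - intros [x H]. destruct (Upd_exists c v x) as [c' U]. exists x, c'.
    split; [easy|]. now apply (T_inst_Upd c v x p p' c').
  - intros (x & c' & U & H). exists x. now apply (T_inst_Upd c v x p p' c').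
Qed.

(** ** Substitution *)

Lemma Occurs_le v t : mIsTerm true t -> mOccurs v t -> v <= t.
Proof.
  revert t. term_induct; [def| | | |].
  - intros i O. apply Occurs_var in O as ->. apply cUn_gt.
  - intros O. now apply Occurs_zero in O.
  - intros s _ IH O. rewrite Occurs_succ in O. eapply le_trans; [now apply IH|apply cUn_gt].
  - intros k s u K _ _ IH IH' O. rewrite Occurs_bin in O by easy. destruct O as [O|O].
    + eapply le_trans; [now apply IH|apply cBin_gt_l].
    + eapply le_trans; [now apply IH'|apply cBin_gt_r].
Qed.

Lemma Free_le v p : mIsForm true p -> mFree v p -> v <= p.
Proof.
  revert p. form_induct; [def| | | |].
  - intros s t S T O. apply Free_eq in O as [O|O].
    + eapply le_trans; [now apply (Occurs_le v s)|apply cBin_gt_l].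
    + eapply le_trans; [now apply (Occurs_le v t)|apply cBin_gt_r].
  - intros a _ IH O. rewrite Free_neg in O. eapply le_trans; [now apply IH|apply cUn_gt].
  - intros k a b K _ _ IH IH' O. rewrite Free_bin in O by easy. destruct O as [O|O].
    + eapply le_trans; [now apply IH|apply cBin_gt_l].
    + eapply le_trans; [now apply IH'|apply cBin_gt_r].
  - intros k w a K _ IH O. rewrite Free_q in O by easy. destruct O as [_ O].
    eapply le_trans; [now apply IH|apply cBin_gt_r].
Qed.

(** Regularity for replacement relations in place of sequences of terms: the free
    variables of p are at most p, so sequences of length p + 1 suffice. *)
Lemma regularity V V' c c' p q r : Definable3 V -> Definable3 V' ->
  (forall i, exists u u', V c i u /\ V' c' i u' /\ mClTerm u /\ mClTerm u' /\
    mval u = mval u') ->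
  (forall i u u', V c i u -> V c i u' -> u = u') ->
  (forall i u u', V' c' i u -> V' c' i u' -> u = u') ->
  mIsForm true p -> mRep V c m0 p q -> mRep V' c' m0 p r -> (mT q <-> mT r).
Proof.
  intros DV DV' H U U' F R R'.
  destruct (seq_exists_rel (fun i u => V c i u) (mS p)) as (x & Lx & Hx); [def| | |].
  { intros i _. destruct (H i) as (u & u' & A & _). eauto. }
  { eauto. }
  destruct (seq_exists_rel (fun i u => V' c' i u) (mS p)) as (y & Ly & Hy); [def| | |].
  { intros i _. destruct (H i) as (u & u' & _ & A & _). eauto. }
  { eauto. }
  assert (Cx : forall i, i < mS p -> mClTerm (mE x i)).
  { intros i Hi. destruct (H i) as (u & u' & A & _ & C & _).
    now rewrite (U i _ u (Hx i Hi) A). }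
  assert (Cy : forall i, i < mS p -> mClTerm (mE y i)).
  { intros i Hi. destruct (H i) as (u & u' & _ & A & _ & C & _).
    now rewrite (U' i _ u' (Hy i Hi) A). }
  destruct (seq_exists (fun i => mval (mE x i)) (mS p)) as (w & Lw & Hw); [def|].
  apply (ct_reg p x y F); [now exists (mS p)|now exists (mS p)| | |].
  - exists w. split; exists (mS p); repeat split; auto; intros i Hi;
      apply Val_val; auto; rewrite Hw by easy; auto.
    destruct (H i) as (u & u' & A & A' & _ & _ & E).
    now rewrite (U i _ u (Hx i Hi) A), (U' i _ u' (Hy i Hi) A').
  - apply (Rep_congr V Vseq c x m0 m0 p); auto using D_Vseq3.
    intros i u O. rewrite !Under_nil. intros A.
    assert (Hi : i < mS p) by now apply lt_S_le, Free_le.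
    exists (mS p). repeat split; auto. exact (U i u _ A (Hx i Hi)).
  - apply (Rep_congr V' Vseq c' y m0 m0 p); auto using D_Vseq3.
    intros i u O. rewrite !Under_nil. intros A.
    assert (Hi : i < mS p) by now apply lt_S_le, Free_le.
    exists (mS p). repeat split; auto. exact (U' i u _ A (Hy i Hi)).
Qed.

(** Substitution lemma.  By composition, q with numerals substituted is p with the
    closed terms u(c) substituted; regularity exchanges these terms for the numerals
    of their values. *)
Lemma Tr_comp (S : M -> M -> Prop) V d p q c c' :
  Definable2 S -> Definable3 V ->
  (forall l a, S l (cNeg a) -> S l a) ->
  (forall k l a b, fk k -> S l (cBin k a b) -> S l a /\ S l b) ->
  (forall k l w a, qk k -> S l (cBin k w a) -> S (cCons w l) a /\
    forall i u, mFree i a -> i <> w -> mUnder V d l i u -> ~ mOccurs w u) ->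
  S m0 p -> mIsForm true p ->
  (forall i, exists u, V d i u) ->
  (forall i u u', V d i u -> V d i u' -> u = u') ->
  (forall i u, V d i u -> mIsTerm true u) ->
  (forall i u, V d i u -> tval c u = mE c' i) ->
  mRep V d m0 p q -> (Tr c q <-> Tr c' p).
Proof.
  intros DS DV Sn Sb Sq HS F Vt Vf VT Vv R.
  set (V3 := fun e i r : M => exists u, V e i u /\ mRT Vnum c m0 u r).
  assert (D3 : Definable3 V3) by (unfold V3; def).
  assert (Fq : mIsForm true q) by exact (Rep_IsForm V d m0 p DV VT F q R).
  apply (regularity V3 Vnum d c' p _ _ D3 D_Vnum).
  - intros i. destruct (Vt i) as [u Hu]. exists (msubt c u), (mnum (mE c' i)).
    split; [exists u; split; [easy|]; apply RT_subt; eauto|].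
    split; [easy|]. split; [apply subt_ClTerm; eauto|]. split; [apply num_ClTerm|].
    rewrite val_num. now apply Vv.
  - intros i u u' (y & Y & A) (y' & Y' & A'). rewrite (Vf i y' y Y' Y) in A'.
    apply RT_subt in A, A'; eauto. congruence.
  - apply Vnum_fun.
  - exact F.
  - apply (Rep_comp S V Vnum V3 d c d m0 m0 m0 p) with q; auto using D_Vnum.
    + intros i u r _. rewrite !Under_nil. intros A B. now exists u.
    + now apply Rep_sub.
  - now apply Rep_sub.
Qed.

End Truth.

#[export] Hint Resolve D_num D_val D_Vnum D_Vsub D_Vseq3 D_sub D_subt : def.

(** * Global reflection in a model *)

Notation cAnd := (cBin 9).
Notation cOr := (cBin 10).
Notation cEx := (cBin 11).
Notation cAll := (cBin 12).
Notation cImp p q := (cOr (cNeg p) q).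

Definition mFreeFor {M : model} (t v p : M) : Prop :=
  mLfp (fun X p =>
    (exists a b, p = cEq a b) \/
    (exists a, p = cNeg a /\ X a) \/
    (exists a b, (p = cAnd a b \/ p = cOr a b) /\ X a /\ X b) \/
    exists w a, (p = cEx w a \/ p = cAll w a) /\
      (v <> w /\ mFree v a -> ~ mOccurs w t /\ X a)) p.

Definition mFormList {M : model} (l : M) : Prop :=
  mLfp (fun X l => l = m0 \/
    exists p k, l = cCons p k /\ mIsForm true p /\ X k) l.

Definition mIncl {M : model} (l m : M) : Prop := forall x, mMem x l -> mMem x m.
Definition mNotFreeIn {M : model} (v l : M) : Prop :=
  ~ exists p, mMem p l /\ mFree v p.

Definition mRule {M : model} (X : M -> Prop) (r : M) : Prop :=
  exists G D, r = mpair G D /\ mFormList G /\ mFormList D /\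
    (
      (exists p, G = cCons p cNil /\ D = cCons p cNil) \/
      (exists p, mSent p /\ mT p /\ G = cNil /\ D = cCons p cNil) \/
      (exists t, G = cNil /\ D = cCons (cEq t t) cNil) \/
      (exists s t v a b p q,
         mSubst v s (cEq a b) p /\ mSubst v t (cEq a b) q /\
         G = cCons (cEq s t) (cCons p cNil) /\ D = cCons q cNil) \/
      (exists G' D', X (mpair G' D') /\ mIncl G' G /\ mIncl D' D) \/
      (exists p, X (mpair G (cCons p D)) /\ X (mpair (cCons p G) D)) \/
      (exists H p, G = cCons (cNeg p) H /\ X (mpair H (cCons p D))) \/
      (exists E p, D = cCons (cNeg p) E /\ X (mpair (cCons p G) E)) \/
      (exists H p q, G = cCons (cAnd p q) H /\ X (mpair (cCons p (cCons q H)) D)) \/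
      (exists E p q, D = cCons (cAnd p q) E /\
         X (mpair G (cCons p E)) /\ X (mpair G (cCons q E))) \/
      (exists H p q, G = cCons (cOr p q) H /\
         X (mpair (cCons p H) D) /\ X (mpair (cCons q H) D)) \/
      (exists E p q, D = cCons (cOr p q) E /\ X (mpair G (cCons p (cCons q E)))) \/
      (exists H v p t q, G = cCons (cAll v p) H /\
         mIsTerm true t /\ mFreeFor t v p /\ mSubst v t p q /\
         X (mpair (cCons q H) D)) \/
      (exists E v p w q, D = cCons (cAll v p) E /\
         mFreeFor (cVar w) v p /\ mNotFreeIn w G /\ mNotFreeIn w D /\
         mSubst v (cVar w) p q /\ X (mpair G (cCons q E))) \/
      (exists H v p w q, G = cCons (cEx v p) H /\
         mFreeFor (cVar w) v p /\ mNotFreeIn w G /\ mNotFreeIn w D /\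
         mSubst v (cVar w) p q /\ X (mpair (cCons q H) D)) \/
      (exists E v p t q, D = cCons (cEx v p) E /\
         mIsTerm true t /\ mFreeFor t v p /\ mSubst v t p q /\
         X (mpair G (cCons q E)))
    ).

Definition mDerivable {M : model} (G D : M) : Prop := mLfp mRule (mpair G D).

Definition mAllPrefix {M : model} (p q : M) : Prop :=
  mLfp (fun X q => q = p \/ exists v a, q = cAll v a /\ X a) q.

Definition mIndAxiom {M : model} (v p q : M) : Prop :=
  exists a b, mSubst v cZero p a /\ mSubst v (cSucc (cVar v)) p b /\
    q = cImp (cAnd a (cAll v (cImp p b))) (cAll v p).

Fixpoint mquote_term {M : model} (t : term) : M :=
  match t with
  | Var i => cVar (nm i)
  | Zero => cZero
  | Succ s => cSucc (mquote_term s)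
  | Add s u => cBin 4 (mquote_term s) (mquote_term u)
  | Mul s u => cBin 5 (mquote_term s) (mquote_term u)
  | Elt s u => cBin 6 (mquote_term s) (mquote_term u)
  end.

Fixpoint mquote {M : model} (p : form) : M :=
  match p with
  | FEq s t => cEq (mquote_term s) (mquote_term t)
  | FTr t => cUn 13 (mquote_term t)
  | FNeg a => cNeg (mquote a)
  | FAnd a b => cAnd (mquote a) (mquote b)
  | FOr a b => cOr (mquote a) (mquote b)
  | FEx v a => cEx (nm v) (mquote a)
  | FAll v a => cAll (nm v) (mquote a)
  end.

Definition mAx_PA {M : model} (x : M) : Prop :=
  (exists p, In p PA_basic /\ x = mquote p) \/
  exists v p q, mIsForm false p /\ mIndAxiom v p q /\ mAllPrefix q x /\ mSent x.

Section Reflection.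

Context {M : model} {EM : Enumerated M} {PA : PAmodel M} {CT : CTmodel M}.
Implicit Types t s u p q a b v w i j l m c x y z : M.

(** ** Capture *)

Lemma D_FreeFor : Definable3 (@mFreeFor M).
Proof. unfold mFreeFor, mLfp. def. Qed.
#[local] Hint Resolve D_FreeFor : def.

Lemma FreeFor_iff t v p : mFreeFor t v p <->
    (exists a b, p = cEq a b) \/
    (exists a, p = cNeg a /\ mFreeFor t v a) \/
    (exists a b, (p = cAnd a b \/ p = cOr a b) /\ mFreeFor t v a /\ mFreeFor t v b) \/
    exists w a, (p = cEx w a \/ p = cAll w a) /\
      (v <> w /\ mFree v a -> ~ mOccurs w t /\ mFreeFor t v a).
Proof. unfold mFreeFor. lfp_iff. Qed.

Lemma FreeFor_eq t v a b : mFreeFor t v (cEq a b).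
Proof. apply FreeFor_iff. eauto. Qed.
Lemma FreeFor_neg t v a : mFreeFor t v (cNeg a) <-> mFreeFor t v a.
Proof.
  rewrite FreeFor_iff. split; [|eauto 6]. intros H. destr H; inv_code; auto.
Qed.
Lemma FreeFor_bin k t v a b : fk k ->
  (mFreeFor t v (cBin k a b) <-> mFreeFor t v a /\ mFreeFor t v b).
Proof.
  intros K. rewrite FreeFor_iff. split.
  - intros H. destr H; inv_code; auto; kinds.
  - intros H. do 2 right. left. exists a, b. kcases K; auto 6.
Qed.
Lemma FreeFor_q k t v w a : qk k -> (mFreeFor t v (cBin k w a) <->
  (v <> w /\ mFree v a -> ~ mOccurs w t /\ mFreeFor t v a)).
Proof.
  intros K. rewrite FreeFor_iff. split.
  - intros H. destr H; inv_code; auto; kinds.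
  - intros H. do 3 right. exists w, a. kcases K; auto 6.
Qed.

Lemma FreeFor_intro t v p : mIsForm true p -> (forall w, w <> v -> ~ mOccurs w t) ->
  mFreeFor t v p.
Proof.
  intros F H. revert p F. form_induct; [def| | | |].
  - intros s u _ _. apply FreeFor_eq.
  - intros a _ IH. now apply FreeFor_neg.
  - intros k a b K _ _ IH IH'. now apply FreeFor_bin.
  - intros k w a K _ IH. apply FreeFor_q; [easy|]. intros [N _]. auto.
Qed.

Lemma Tr_subst c v t p q c' : mIsForm true p -> mIsTerm true t -> mFreeFor t v p ->
  mSubst v t p q -> Upd c v (tval c t) c' -> (Tr c q <-> Tr c' p).
Proof.
  intros F T FF R [Hv Ho].
  apply (Tr_comp (fun l p => mMem v l \/ (mFree v p -> mFreeFor t v p))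
    (Vsub v t) m0 p q c c'); auto using D_Vsub.
  - def.
  - intros l a [A|A]; [now left|right]. rewrite Free_neg, FreeFor_neg in A. exact A.
  - intros k l a b K [A|A]; [tauto|]. rewrite Free_bin, FreeFor_bin in A by easy.
    tauto.
  - intros k l w a K A. rewrite Free_q, FreeFor_q in A by easy. rewrite Mem_cons.
    split; [destruct (classic (v = w)); tauto|].
    intros i u Fi N [[_ ->]|[NM [[-> ->]|[_ ->]]]] O;
      try (rewrite Occurs_var in O; congruence).
    tauto.
  - intros i. destruct (classic (i = v)).
    + exists t. now left.
    + exists (cVar i). now right.
  - intros i u u' [[A ->]|[A ->]] [[A' ->]|[A' ->]]; auto; contradiction.
  - intros i u [[_ ->]|[_ ->]]; [exact T|apply IsTerm_var].
  - intros i u [[-> ->]|[A ->]]; [easy|]. rewrite tval_var. symmetry. auto.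
Qed.

(** ** Universal closure *)

Definition Vclo v i u : Prop := u = cBin 6 (cVar v) (mnum i).

Lemma D_Vclo : Definable3 Vclo.
Proof. unfold Vclo. def. Qed.
#[local] Hint Resolve D_Vclo : def.

(** The closure of f is the sentence: for all v, f with each x_i replaced by the
    term (v)_i.  One quantifier over sequences stands for possibly nonstandardly
    many quantifiers; v = f + 1 is a variable that does not occur in f. *)
Definition closure_body f : M := iota (fun q => mRep Vclo (mS f) m0 f q).
Definition closure f : M := cAll (mS f) (closure_body f).

Lemma D_closure : DefinableF closure.
Proof.
  assert (D : DefinableF closure_body).
  { apply (D_iota (fun f q => mRep Vclo (mS f) m0 f q)). def. }
  unfold closure. def.
Qed.
#[local] Hint Resolve D_closure : def.

(** Truth under all assignments, an unbounded statement, becomes an atom T(u).  Over v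
    the instance with (v)_i evaluates, by the substitution lemma, to f under the
    assignment v. *)
Lemma T_closure f : mIsForm true f -> (mT (closure f) <-> forall c, Tr c f).
Proof.
  intros F. set (v := mS f).
  assert (Vt : forall i, exists u, Vclo v i u) by (intros i; eexists; reflexivity).
  assert (Vf : forall i u u', Vclo v i u -> Vclo v i u' -> u = u').
  { intros i u u' -> ->. reflexivity. }
  assert (VT : forall i u, Vclo v i u -> mIsTerm true u).
  { intros i u ->. apply IsTerm_bin; [kinds|]. split; [apply IsTerm_var|apply num_term]. }
  assert (VO : forall i u j, Vclo v i u -> mOccurs j u -> j = v).
  { intros i u j -> O. rewrite Occurs_bin in O by kinds. destruct O as [O|O].
    - now apply Occurs_var in O.
    - now apply num_closed in O. }
  assert (R : mRep Vclo v m0 f (closure_body f)).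
  { apply (iota_spec (mRep Vclo v m0 f)).
    - apply Rep_total; auto using D_Vclo.
    - apply Rep_fun; auto using D_Vclo. }
  assert (FB : mIsForm true (closure_body f))
    by (eapply Rep_IsForm; eauto using D_Vclo).
  assert (S : mSent (closure f)).
  { split; [apply IsForm_q; [kinds|easy]|]. intros [w O].
    unfold closure in O. rewrite Free_q in O by kinds. destruct O as [N O].
    destruct (Rep_Free Vclo v m0 w f D_Vclo F _ R O) as (i & u & _ & A & O').
    rewrite Under_nil in A. exact (N (VO i u w A O')). }
  assert (E : forall c, Tr c (closure_body f) <-> Tr (mE c v) f).
  { intros c.
    apply (Tr_comp (fun _ p => p <= f) Vclo v f); try assumption.
    - def.
    - exact D_Vclo.
    - intros l a. apply le_trans, cUn_gt.
    - intros k l a b _ H. split; (eapply le_trans; [|exact H]);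
        [apply cBin_gt_l|apply cBin_gt_r].
    - intros k l w a _ H. split; [eapply le_trans; [apply cBin_gt_r|exact H]|].
      intros i u _ N [[_ ->]|[_ A]] O; [apply Occurs_var in O; congruence|].
      (* Bound variables are smaller than f, hence different from v. *)
      apply (VO i u w A) in O. apply (lt_irrefl v). apply le_lt_trans with f; [|apply lt_S].
      rewrite <- O. eapply le_trans; [apply cBin_gt_l|exact H].
    - apply le_refl.
    - intros i u ->. rewrite tval_bin; [|kinds|apply IsTerm_var|apply num_term].
      now rewrite tval_var, tval_num. }
  rewrite <- (Tr_sent m0) by exact S. unfold closure. rewrite Tr_all by exact FB. split.
  - intros H c. destruct (Upd_exists m0 v c) as [c' U].
    specialize (H c c' U). rewrite E in H. destruct U as [<- _]. exact H.
  - intros H x c' _. apply E, H.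
Qed.

(** ** Disjunctions over lists *)

Lemma D_FormList : Definable1 (@mFormList M).
Proof. unfold mFormList, mLfp. def. Qed.
Lemma D_Incl : Definable2 (@mIncl M).
Proof. unfold mIncl. def. Qed.
#[local] Hint Resolve D_FormList D_Incl : def.

Lemma FormList_iff l : mFormList l <-> l = m0 \/
    exists p k, l = cCons p k /\ mIsForm true p /\ mFormList k.
Proof. unfold mFormList. lfp_iff. Qed.

Lemma FormList_nil : mFormList (m0 : M).
Proof. apply FormList_iff. now left. Qed.

Lemma FormList_cons p k : mFormList (cCons p k) <-> mIsForm true p /\ mFormList k.
Proof.
  rewrite FormList_iff. split; [|right; eauto].
  intros H. destr H; inv_code; auto.
Qed.

Lemma list_ind (P : M -> Prop) : Definable1 P -> P m0 ->
  (forall p k, mIsForm true p -> mFormList k -> P k -> P (cCons p k)) ->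
  forall l, mFormList l -> P l.
Proof.
  intros D H0 Hc. apply Lfp_ind; [intro; pos|easy|].
  intros l [->|(p & k & -> & F & L & H)]; auto.
Qed.

Lemma Mem_IsForm p l : mFormList l -> mMem p l -> mIsForm true p.
Proof.
  revert l. match goal with |- forall l, _ -> @?P l => apply (list_ind P) end.
  - def.
  - intros H. now apply Mem_nil in H.
  - intros q k F _ IH H. apply Mem_cons in H as [->|H]; auto.
Qed.

Definition wrap (neg : bool) p : M := if neg then cNeg p else p.
Definition falsum : M := cEq cZero (cSucc cZero).
Definition verum : M := cEq cZero cZero.

Lemma D_wrap (neg : bool) : DefinableF (wrap neg).
Proof. unfold wrap. destruct neg; def. Qed.
#[local] Hint Resolve D_wrap : def.

Lemma IsForm_wrap (neg : bool) p : mIsForm true p -> mIsForm true (wrap neg p).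
Proof. destruct neg; [apply IsForm_neg|easy]. Qed.

Lemma IsForm_falsum : mIsForm true falsum.
Proof.
  apply IsForm_eq. split; [apply IsTerm_zero|]. apply IsTerm_succ, IsTerm_zero.
Qed.

Lemma Tr_falsum c : ~ Tr c falsum.
Proof.
  assert (Z : mIsTerm true (cZero : M)) by apply IsTerm_zero.
  assert (Z' : mIsTerm true (cSucc cZero : M)) by now apply IsTerm_succ.
  unfold falsum. rewrite Tr_eq, tval_succ, tval_zero by easy.
  intros H. symmetry in H. now apply pa_S0 in H.
Qed.

Lemma T_verum : mT verum.
Proof.
  assert (C : mClTerm (cZero : M)).
  { split; [apply IsTerm_zero|]. intros [v O]. now apply Occurs_zero in O. }
  apply ct_eq; auto. exists m0. split; now apply Val_zero.
Qed.

Definition mDisj (neg : bool) l f : Prop :=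
  mLfp (fun X r => r = mpair m0 falsum \/
    exists p k g, r = mpair (cCons p k) (cOr (wrap neg p) g) /\ X (mpair k g))
    (mpair l f).

Lemma D_Disj (neg : bool) : Definable2 (mDisj neg).
Proof. unfold mDisj, mLfp. def. Qed.
#[local] Hint Resolve D_Disj : def.

Lemma Disj_iff (neg : bool) l f : mDisj neg l f <-> mpair l f = mpair m0 falsum \/
  exists p k g, mpair l f = mpair (cCons p k) (cOr (wrap neg p) g) /\ mDisj neg k g.
Proof. unfold mDisj. lfp_iff. Qed.

Lemma Disj_nil (neg : bool) f : mDisj neg m0 f <-> f = falsum.
Proof.
  rewrite Disj_iff. split; [|intros ->; now left].
  intros [H|(p & k & g & H & _)]; apply mpair_inj in H as [H H']; auto.
  symmetry in H. inv_code.
Qed.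

Lemma Disj_cons (neg : bool) p k f : mDisj neg (cCons p k) f <->
  exists g, f = cOr (wrap neg p) g /\ mDisj neg k g.
Proof.
  rewrite Disj_iff. split.
  - intros [H|(p' & k' & g & H & D)]; inv_code. eauto.
  - intros (g & -> & D). right. now exists p, k, g.
Qed.

Definition disj (neg : bool) l : M := iota (mDisj neg l).

Lemma D_disj (neg : bool) : DefinableF (disj neg).
Proof. apply (D_iota (mDisj neg)). def. Qed.
#[local] Hint Resolve D_disj : def.

Lemma Disj_disj (neg : bool) l f : mFormList l -> (mDisj neg l f <-> f = disj neg l).
Proof.
  intros L. assert (E : exists g, forall f, mDisj neg l f <-> f = g).
  { revert l L f. match goal with |- forall l, _ -> @?P l => apply (list_ind P) end.
    - def.
    - intros _. exists falsum. exact (Disj_nil neg).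
    - intros p k _ _ IH _. destruct (IH m0) as [g Hg]. exists (cOr (wrap neg p) g).
      intros f. rewrite Disj_cons. split.
      + intros (g' & -> & D). now apply Hg in D as ->.
      + intros ->. exists g. split; [easy|]. now apply Hg. }
  destruct E as [g Hg]. rewrite Hg. replace (disj neg l) with g; [easy|].
  symmetry. apply iota_eq; [now apply Hg|]. intros z. apply Hg.
Qed.

Lemma disj_nil (neg : bool) : disj neg m0 = falsum.
Proof. symmetry. apply Disj_disj; [apply FormList_nil|]. now apply Disj_nil. Qed.

Lemma disj_cons (neg : bool) p k : mIsForm true p -> mFormList k ->
  disj neg (cCons p k) = cOr (wrap neg p) (disj neg k).
Proof.
  intros F L. symmetry. apply Disj_disj; [now apply FormList_cons|].
  apply Disj_cons. exists (disj neg k). split; [easy|]. now apply Disj_disj.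
Qed.

Lemma IsForm_disj (neg : bool) l : mFormList l -> mIsForm true (disj neg l).
Proof.
  revert l. match goal with |- forall l, _ -> @?P l => apply (list_ind P) end.
  - def.
  - rewrite disj_nil. apply IsForm_falsum.
  - intros p k F L IH. rewrite disj_cons by easy. apply IsForm_bin; [kinds|].
    auto using IsForm_wrap.
Qed.

(** Restricts an induction for T(F x) to a definable set P, by a true sentence
    outside P. *)
Definition guard (P : M -> Prop) (F : M -> M) x : M :=
  iota (fun y => (P x /\ y = F x) \/ (~ P x /\ y = verum)).

Lemma T_guard P F x : mT (guard P F x) <-> (P x -> mT (F x)).
Proof.
  unfold guard. destruct (classic (P x)) as [H|H].
  - rewrite (iota_eq _ (F x)); [tauto|tauto|]. intros z. tauto.
  - rewrite (iota_eq _ verum); [|tauto|intros z; tauto].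
    split; [tauto|]. intros _. apply T_verum.
Qed.

Lemma T_Lfp_ind_guard (G : (M -> Prop) -> M -> Prop) (P : M -> Prop) (F : M -> M) :
  (forall x, Pos (fun X => G X x)) -> Definable1 P -> DefinableF F ->
  (forall x, G (fun y => mLfp G y /\ (P y -> mT (F y))) x -> P x -> mT (F x)) ->
  forall x, mLfp G x -> P x -> mT (F x).
Proof.
  intros PG DP DF H x Hx. apply T_guard. revert x Hx.
  apply T_Lfp_ind; [easy| |].
  - apply (D_iota (fun x y => (P x /\ y = F x) \/ (~ P x /\ y = verum))). def.
  - intros x Hx. apply T_guard, H.
    eapply (Pos_mono (fun X => G X _)); [apply PG| |exact Hx].
    intros y [A B]. split; [easy|]. now apply T_guard.
Qed.

(** Disjunction correctness.  The list may have nonstandard length, so both directions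
    need induction for truth: along the list for the first, where the negations of the
    partial disjunctions are shown true, and along the derivation of p being a member
    for the second. *)
Lemma Tr_disj (neg : bool) c l : mFormList l ->
  (Tr c (disj neg l) <-> exists p, mMem p l /\ Tr c (wrap neg p)).
Proof.
  intros L. split.
  - intros T. apply NNPP. intros N.
    assert (A : forall k, mFormList k -> mIncl k l -> mT (cNeg (msub c (disj neg k)))).
    { match goal with |- forall k, _ -> @?P k -> mT (@?F k) =>
        apply (T_Lfp_ind_guard _ P F) end; [intro; pos|def|def|].
      intros k [->|(p & k' & -> & F & L' & IH)] I; [|change (mFormList k') in L'].
      - rewrite disj_nil. apply ct_neg; [apply sub_Sent, IsForm_falsum|].
        apply Tr_falsum.
      - apply ct_neg; [apply sub_Sent, IsForm_disj; now apply FormList_cons|].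
        rewrite disj_cons by easy. fold (Tr c (cOr (wrap neg p) (disj neg k'))).
        rewrite Tr_or by auto using IsForm_wrap, IsForm_disj. intros [T'|T'].
        + apply N. exists p. split; [|easy]. apply I, Mem_cons. now left.
        + assert (I' : mIncl k' l) by (intros q Hq; apply I, Mem_cons; now right).
          apply (ct_neg (msub c (disj neg k'))); auto.
          now apply sub_Sent, IsForm_disj. }
    specialize (A l L (fun p H => H)).
    apply ct_neg in A; [contradiction|]. now apply sub_Sent, IsForm_disj.
  - intros (p & H & T). revert l H L.
    match goal with |- forall l, _ -> @?P l -> _ =>
      apply (T_Lfp_ind_guard _ P (fun l => msub c (disj neg l))) end;
      [intro; pos|def|def|].
    intros l (q & k & -> & A) L. apply FormList_cons in L as [F L].
    fold (Tr c (disj neg (cCons q k))). rewrite disj_cons by easy.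
    apply Tr_or; auto using IsForm_wrap, IsForm_disj.
    destruct A as [->|[_ A]]; [now left|]. right. now apply A.
Qed.

(** ** Soundness of the calculus *)

Definition valid c G D : Prop :=
  (exists p, mMem p G /\ ~ Tr c p) \/ (exists p, mMem p D /\ Tr c p).

Lemma valid_nil c : ~ valid c m0 m0.
Proof. intros [(p & H & _)|(p & H & _)]; now apply Mem_nil in H. Qed.

Lemma valid_consL c p G D : valid c (cCons p G) D <-> ~ Tr c p \/ valid c G D.
Proof.
  unfold valid. split.
  - intros [(q & H & N)|H]; auto. apply Mem_cons in H as [->|H]; eauto.
  - intros [N|[(q & H & N)|H]]; auto; left.
    + exists p. rewrite Mem_cons. auto.
    + exists q. rewrite Mem_cons. auto.
Qed.

Lemma valid_consR c p G D : valid c G (cCons p D) <-> Tr c p \/ valid c G D.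
Proof.
  unfold valid. split.
  - intros [H|(q & H & N)]; auto. apply Mem_cons in H as [->|H]; eauto.
  - intros [N|[H|(q & H & N)]]; auto; right.
    + exists p. rewrite Mem_cons. auto.
    + exists q. rewrite Mem_cons. auto.
Qed.

Lemma valid_ext c c' G D : mFormList G -> mFormList D ->
  (forall p i, mMem p G \/ mMem p D -> mFree i p -> mE c i = mE c' i) ->
  valid c G D -> valid c' G D.
Proof.
  intros LG LD H [(p & Hp & T)|(p & Hp & T)]; [left|right]; exists p;
    (split; [easy|]); rewrite <- (Tr_ext c c'); eauto using Mem_IsForm.
Qed.

Definition sequent_truth r : M := iota (fun y => exists G D, r = mpair G D /\
  y = closure (cOr (disj true G) (disj false D))).

Lemma D_sequent_truth : DefinableF sequent_truth.
Proof.
  apply (D_iota (fun r y => exists G D, r = mpair G D /\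
    y = closure (cOr (disj true G) (disj false D)))). def.
Qed.
#[local] Hint Resolve D_sequent_truth : def.

Lemma T_sequent G D : mFormList G -> mFormList D ->
  (mT (sequent_truth (mpair G D)) <-> forall c, valid c G D).
Proof.
  intros LG LD. unfold sequent_truth.
  rewrite (iota_eq _ (closure (cOr (disj true G) (disj false D)))).
  2: now exists G, D.
  2: { intros z (G' & D' & E & ->). now apply mpair_inj in E as [-> ->]. }
  rewrite T_closure by (apply IsForm_bin; [kinds|auto using IsForm_disj]).
  assert (E : forall c, Tr c (cOr (disj true G) (disj false D)) <-> valid c G D).
  { intros c. rewrite Tr_or, !Tr_disj by auto using IsForm_disj. unfold valid, wrap.
    assert (A : (exists p, mMem p G /\ Tr c (cNeg p)) <->
                (exists p, mMem p G /\ ~ Tr c p)); [|now rewrite A].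
    split; intros (p & H & T); exists p; split; auto;
      apply Tr_neg in T || apply Tr_neg; eauto using Mem_IsForm. }
  split; intros H c; apply E, H.
Qed.

(** Used for both eigenvariable rules: giving the eigenvariable w the value x amounts
    to giving v the value x. *)
Lemma eigenvariable c c' c1 v w x p q : mIsForm true p -> mFreeFor (cVar w) v p ->
  mSubst v (cVar w) p q -> ~ (w <> v /\ mFree w p) ->
  Upd c v x c' -> Upd c w x c1 -> (Tr c1 q <-> Tr c' p).
Proof.
  intros F FF R N [Hv Ho] [Hw Hwo].
  destruct (Upd_exists c1 v x) as [c2 U2].
  rewrite (Tr_subst c1 v (cVar w) p q c2); [|easy|apply IsTerm_var|easy|easy|].
  - destruct U2 as [Uv Uo]. apply Tr_ext; [easy|]. intros i Fi.
    destruct (classic (i = v)) as [->|Ni]; [congruence|].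
    rewrite Uo, Ho, Hwo; auto. intros ->. auto.
  - now rewrite tval_var, Hw.
Qed.

Definition sound r : Prop := exists G D, r = mpair G D /\
  mFormList G /\ mFormList D /\ forall c, valid c G D.

Lemma sound_pair G D :
  sound (mpair G D) <-> mFormList G /\ mFormList D /\ forall c, valid c G D.
Proof.
  split; [|intros H; now exists G, D].
  intros (G' & D' & E & H). now apply mpair_inj in E as [-> ->].
Qed.

Lemma Pos_rule r : Pos (fun X : M -> Prop => @mRule M X r).
Proof. unfold mRule. pos. Qed.

Ltac forms :=
  repeat match goal with
  | H : mFormList (cCons _ _) |- _ => rewrite FormList_cons in H
  | H : _ /\ _ |- _ => destruct H
  | H : mIsForm true (cNeg _) |- _ => rewrite IsForm_neg in H
  | H : mIsForm true (cEq _ _) |- _ => rewrite IsForm_eq in H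
  | H : mIsForm true (cBin _ _ _) |- _ =>
      (rewrite IsForm_bin in H by kinds) || (rewrite IsForm_q in H by kinds)
  end.

Lemma rule_sound r : mRule sound r -> sound r.
Proof.
  intros (G & D & -> & LG & LD & R). apply sound_pair. split; [easy|]. split; [easy|].
  intros c. destruct R as [R|[R|[R|[R|[R|[R|[R|[R|[R|[R|[R|[R|[R|[R|[R|R]]]]]]]]]]]]]]].
  - destruct R as (p & -> & ->). rewrite valid_consL, valid_consR.
    destruct (classic (Tr c p)); auto.
  - destruct R as (p & S & T & -> & ->). rewrite valid_consR. left.
    now apply Tr_sent.
  - destruct R as (t & -> & ->). rewrite valid_consR. left. forms.
    now apply Tr_eq.
  - destruct R as (s & t & v & a & b & p & q & Sp & Sq & -> & ->).
    rewrite !valid_consL, valid_consR.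
    destruct (classic (Tr c (cEq s t))) as [E|E]; auto.
    destruct (classic (Tr c p)) as [P|P]; auto. right. right. left.
    assert (F : mIsForm true (cEq a b)).
    { forms. unfold mSubst in Sp. rewrite Rep_eq in Sp.
      destruct Sp as (a' & b' & _ & A & B). apply IsForm_eq.
      split; eapply RT_source; eauto using D_Vsub. }
    forms. apply Tr_eq in E; auto.
    destruct (Upd_exists c v (tval c s)) as [c' U].
    assert (U' : Upd c v (tval c t) c') by now rewrite <- E.
    apply (Tr_subst c v t (cEq a b) q c'); auto using FreeFor_eq.
    { now apply IsForm_eq. }
    apply (Tr_subst c v s (cEq a b) p c'); auto using FreeFor_eq.
    now apply IsForm_eq.
  - destruct R as (G' & D' & S & IG & ID). apply sound_pair in S as (_ & _ & S).
    destruct (S c) as [(p & H & T)|(p & H & T)]; [left|right]; eauto.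
  - destruct R as (p & S & S'). apply sound_pair in S as (_ & _ & S).
    apply sound_pair in S' as (_ & _ & S'). specialize (S c). specialize (S' c).
    rewrite valid_consR in S. rewrite valid_consL in S'. tauto.
  - destruct R as (H & p & -> & S). apply sound_pair in S as (_ & _ & S).
    specialize (S c). rewrite valid_consR in S. rewrite valid_consL. forms.
    rewrite Tr_neg by easy. tauto.
  - destruct R as (E & p & -> & S). apply sound_pair in S as (_ & _ & S).
    specialize (S c). rewrite valid_consL in S. rewrite valid_consR. forms.
    rewrite Tr_neg by easy. tauto.
  - destruct R as (H & p & q & -> & S). apply sound_pair in S as (_ & _ & S).
    specialize (S c). rewrite !valid_consL in S. rewrite valid_consL. forms.
    rewrite Tr_and by easy. tauto.
  - destruct R as (E & p & q & -> & S & S'). apply sound_pair in S as (_ & _ & S).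
    apply sound_pair in S' as (_ & _ & S'). specialize (S c). specialize (S' c).
    rewrite valid_consR in S, S'. rewrite valid_consR. forms.
    rewrite Tr_and by easy. tauto.
  - destruct R as (H & p & q & -> & S & S'). apply sound_pair in S as (_ & _ & S).
    apply sound_pair in S' as (_ & _ & S'). specialize (S c). specialize (S' c).
    rewrite valid_consL in S, S'. rewrite valid_consL. forms.
    rewrite Tr_or by easy. tauto.
  - destruct R as (E & p & q & -> & S). apply sound_pair in S as (_ & _ & S).
    specialize (S c). rewrite !valid_consR in S. rewrite valid_consR. forms.
    rewrite Tr_or by easy. tauto.
  - destruct R as (H & v & p & t & q & -> & T & FF & Sq & S).
    apply sound_pair in S as (_ & _ & S). specialize (S c).
    rewrite valid_consL in *. destruct S as [S|S]; auto. left. forms.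
    rewrite Tr_all by easy. intros A. apply S.
    destruct (Upd_exists c v (tval c t)) as [c' U].
    apply (Tr_subst c v t p q c'); eauto.
  - destruct R as (E & v & p & w & q & -> & FF & NG & ND & Sq & S).
    apply sound_pair in S as (_ & _ & S). rewrite valid_consR.
    destruct (classic (valid c G E)) as [V|V]; auto. left.
    assert (LD' := LD). forms. rewrite Tr_all by easy. intros x c' U.
    destruct (Upd_exists c w x) as [c1 U1].
    specialize (S c1). rewrite valid_consR in S. destruct S as [S|S].
    + apply (eigenvariable c c' c1 v w x p q); auto. intros [N Fw].
      apply ND. exists (cAll v p). rewrite Mem_cons, Free_q by kinds. auto.
    + exfalso. apply V. revert S. apply valid_ext; auto. intros r i Hr Fi.
      destruct U1 as [_ U1]. apply U1. intros ->. destruct Hr as [Hr|Hr].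
      * apply NG. eauto.
      * apply ND. exists r. rewrite Mem_cons. auto.
  - destruct R as (H & v & p & w & q & -> & FF & NG & ND & Sq & S).
    apply sound_pair in S as (_ & _ & S). rewrite valid_consL.
    destruct (classic (valid c H D)) as [V|V]; auto. left.
    assert (LG' := LG). forms. rewrite Tr_ex by easy. intros (x & c' & U & T).
    destruct (Upd_exists c w x) as [c1 U1].
    specialize (S c1). rewrite valid_consL in S. destruct S as [S|S].
    + apply S. apply (eigenvariable c c' c1 v w x p q); auto. intros [N Fw].
      apply NG. exists (cEx v p). rewrite Mem_cons, Free_q by kinds. auto.
    + apply V. revert S. apply valid_ext; auto. intros r i Hr Fi.
      destruct U1 as [_ U1]. apply U1. intros ->. destruct Hr as [Hr|Hr].
      * apply NG. exists r. rewrite Mem_cons. auto.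
      * apply ND. eauto.
  - destruct R as (E & v & p & t & q & -> & T & FF & Sq & S).
    apply sound_pair in S as (_ & _ & S). specialize (S c).
    rewrite valid_consR in *. destruct S as [S|S]; auto. left. forms.
    rewrite Tr_ex by easy.
    destruct (Upd_exists c v (tval c t)) as [c' U].
    exists (tval c t), c'. split; [easy|]. apply (Tr_subst c v t p q c'); auto.
Qed.

(** Induction along the derivation on the truth of the sentence that expresses the
    validity of the sequent under all assignments. *)
Theorem global_reflection p : mSent p -> mDerivable m0 (cCons p m0) -> mT p.
Proof.
  intros S Der.
  assert (L : mFormList (cCons p m0)).
  { apply FormList_cons. split; [apply S|apply FormList_nil]. }
  assert (T : mT (sequent_truth (mpair m0 (cCons p m0)))).
  { revert Der. apply T_Lfp_ind; [apply Pos_rule|def|]. intros r R.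
    assert (Sr : sound r).
    { apply rule_sound. revert R. apply (Pos_mono (fun X : M -> Prop => @mRule M X r)); [apply Pos_rule|].
      intros y [Y T]. apply Lfp_unfold in Y; [|apply Pos_rule].
      destruct Y as (G & D & -> & LG & LD & _). apply sound_pair.
      repeat split; auto. now apply T_sequent. }
    destruct Sr as (G & D & -> & LG & LD & V). now apply T_sequent. }
  assert (V := proj1 (T_sequent m0 (cCons p m0) FormList_nil L) T m0).
  rewrite valid_consR in V. destruct V as [V|V]; [|now apply valid_nil in V].
  now apply Tr_sent in V.
Qed.

End Reflection.

(** * Soundness of the axioms of PA in a model *)

Section AxiomSoundness.

Context {M : model} {EM : Enumerated M} {PA : PAmodel M} {CT : CTmodel M}.
Implicit Types a b v w i j m c x y z : M.

Lemma IsTerm_mono (z : M) : mIsTerm false z -> mIsTerm true z.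
Proof.
  revert z. apply Lfp_ind; [intro; pos|def|].
  intros z [[i ->]|[->|[(s & -> & _ & H)|(s & u & E & (_ & H) & (_ & K))]]].
  - apply IsTerm_var.
  - apply IsTerm_zero.
  - now apply IsTerm_succ.
  - destruct E as [->| ->]; (apply IsTerm_bin; [kinds|easy]).
Qed.

Lemma IsForm_mono (z : M) : mIsForm false z -> mIsForm true z.
Proof.
  revert z. apply Lfp_ind; [intro; pos|def|].
  intros z [(s & u & -> & H & K)|[(a & -> & _ & H)|
    [(a & b & E & (_ & H) & (_ & K))|(v & a & E & _ & H)]]].
  - apply IsForm_eq. auto using IsTerm_mono.
  - now apply IsForm_neg.
  - destruct E as [->| ->]; (apply IsForm_bin; [kinds|easy]).
  - destruct E as [->| ->]; (apply IsForm_q; [kinds|easy]).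
Qed.

(** ** Standard formulae *)

Lemma IsTerm_quote t : mIsTerm true (mquote_term t : M).
Proof.
  induction t; simpl.
  - apply IsTerm_var.
  - apply IsTerm_zero.
  - now apply IsTerm_succ.
  - apply IsTerm_bin; [kinds|easy].
  - apply IsTerm_bin; [kinds|easy].
  - apply IsTerm_bin; [kinds|easy].
Qed.

Lemma IsForm_quote p : Lplus_form p -> mIsForm true (mquote p : M).
Proof.
  induction p; simpl; intros L; try easy.
  - apply IsForm_eq. split; apply IsTerm_quote.
  - apply IsForm_neg. auto.
  - apply IsForm_bin; [kinds|tauto].
  - apply IsForm_bin; [kinds|tauto].
  - apply IsForm_q; [kinds|auto].
  - apply IsForm_q; [kinds|auto].
Qed.

Definition env_of c : nat -> M := fun i : nat => mE c (nm i).

Lemma tval_quote c t : tval c (mquote_term t) = eval (env_of c) t.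
Proof.
  induction t; simpl.
  - apply tval_var.
  - apply tval_zero.
  - rewrite tval_succ by apply IsTerm_quote. now rewrite IHt.
  - rewrite tval_bin by (kinds || apply IsTerm_quote). simpl. congruence.
  - rewrite tval_bin by (kinds || apply IsTerm_quote). simpl. congruence.
  - rewrite tval_bin by (kinds || apply IsTerm_quote). simpl. congruence.
Qed.

Lemma env_of_Upd c (v : nat) x c' p : Upd c (nm v) x c' ->
  (sat (env_of c') p <-> sat (upd (env_of c) v x) p).
Proof.
  intros [Hv Ho]. apply sat_ext. intros i _. unfold env_of, upd.
  destruct (Nat.eqb_spec i v) as [->|N]; [easy|]. apply Ho.
  intros E. now apply nm_inj in E.
Qed.

(** Disquotation: for standard formulae, Tarski's clauses determine truth by an
    induction in the metatheory. *)
Lemma Tr_quote p : Lplus_form p -> forall c, Tr c (mquote p) <-> sat (env_of c) p.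
Proof.
  induction p; simpl; intros L c; try easy.
  - rewrite Tr_eq, !tval_quote by apply IsTerm_quote. easy.
  - rewrite Tr_neg, IHp by auto using IsForm_quote. easy.
  - destruct L. rewrite Tr_and, IHp1, IHp2 by auto using IsForm_quote. easy.
  - destruct L. rewrite Tr_or, IHp1, IHp2 by auto using IsForm_quote. easy.
  - rewrite Tr_ex by auto using IsForm_quote. split.
    + intros (x & c' & U & H). exists x. apply IHp in H; [|easy].
      now rewrite <- (env_of_Upd c v x c').
    + intros [x H]. destruct (Upd_exists c (nm v) x) as [c' U].
      exists x, c'. split; [easy|]. apply IHp; [easy|]. now apply (env_of_Upd c v x c').
  - rewrite Tr_all by auto using IsForm_quote. split.
    + intros H x. destruct (Upd_exists c (nm v) x) as [c' U].
      rewrite <- (env_of_Upd c v x c') by easy. apply IHp; eauto.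
    + intros H x c' U. apply IHp; [easy|]. now apply (env_of_Upd c v x c').
Qed.

Lemma basic_sat (e : nat -> M) p : In p PA_basic -> sat e p.
Proof.
  simpl. intros H.
  repeat match type of H with _ \/ _ => destruct H as [<-|H] end; [..|easy];
    simpl; unfold upd; simpl.
  - apply pa_S0.
  - intros x y. destruct (classic (mS x = mS y)); [right|now left]. now apply pa_S_inj.
  - apply pa_add0.
  - apply pa_addS.
  - apply pa_mul0.
  - apply pa_mulS.
Qed.

Lemma basic_Lplus p : In p PA_basic -> Lplus_form p.
Proof.
  simpl. intros H.
  repeat match type of H with _ \/ _ => destruct H as [<-|H] end; simpl; tauto.
Qed.

(** ** Induction axioms *)

(** The instances of p at v = 0, 1, ..., n form a definable sequence of sentences,
    and induction for truth applies to it, although p may be nonstandard. *)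
Lemma Tr_induction v p c : mIsForm true p ->
  (forall c', Upd c v m0 c' -> Tr c' p) ->
  (forall x c' c'', Upd c v x c' -> Upd c v (mS x) c'' -> Tr c' p -> Tr c'' p) ->
  forall x c', Upd c v x c' -> Tr c' p.
Proof.
  intros F H0 HS n c' U.
  set (R := fun x y => exists c', Upd c v x c' /\ y = msub c' p).
  assert (DR : Definable2 R) by (unfold R, Upd; def).
  assert (E : forall x c', Upd c v x c' -> iota (R x) = msub c' p).
  { intros x d [Dv Do]. apply iota_eq; [now exists d|].
    intros z (d' & [Dv' Do'] & ->). apply sub_ext; [easy|]. intros i _.
    destruct (classic (i = v)) as [->|N]; [congruence|]. rewrite Do, Do'; auto. }
  destruct (seq_exists (fun x => iota (R x)) (mS n)) as (u & _ & Hu);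
    [now apply (D_iota R)|].
  unfold Tr. rewrite <- (E n c' U), <- (Hu n (lt_S n)). apply T_strong.
  intros i Hi IH. rewrite Hu by now apply S_le.
  destruct (Upd_exists c v i) as [d D]. rewrite (E i d D).
  destruct (zero_or_succ i) as [->|[j ->]]; [now apply H0|].
  destruct (Upd_exists c v j) as [d' D']. apply (HS j d' d); auto.
  unfold Tr. rewrite <- (E j d' D'), <- Hu.
  - apply IH, lt_S.
  - apply lt_trans with (mS j); [apply lt_S|now apply S_le].
Qed.

Lemma IndAxiom_form v p q : mIsForm true p -> mIndAxiom v p q ->
  exists a b, q = cImp (cAnd a (cAll v (cImp p b))) (cAll v p) /\
    mSubst v cZero p a /\ mSubst v (cSucc (cVar v)) p b /\
    mIsForm true a /\ mIsForm true b /\ mIsForm true q.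
Proof.
  intros F (a & b & A & B & ->).
  assert (Fa : mIsForm true a).
  { refine (Rep_IsForm (Vsub v cZero) m0 m0 p (D_Vsub v cZero) _ F a A).
    intros i u [[_ ->]|[_ ->]]; [apply IsTerm_zero|apply IsTerm_var]. }
  assert (Fb : mIsForm true b).
  { refine (Rep_IsForm (Vsub v (cSucc (cVar v))) m0 m0 p (D_Vsub v _) _ F b B).
    intros i u [[_ ->]|[_ ->]]; [apply IsTerm_succ|]; apply IsTerm_var. }
  exists a, b. repeat split; auto.
  apply IsForm_bin; [kinds|split]; [|now apply IsForm_q; [kinds|]].
  apply IsForm_neg, IsForm_bin; [kinds|split]; [easy|].
  apply IsForm_q; [kinds|]. apply IsForm_bin; [kinds|split]; [now apply IsForm_neg|easy].
Qed.

Lemma Tr_IndAxiom v p q c : mIsForm true p -> mIndAxiom v p q -> Tr c q.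
Proof.
  intros F I. destruct (IndAxiom_form v p q F I) as (a & b & -> & A & B & Fa & Fb & Fq).
  assert (Fi : mIsForm true (cImp p b)) by
    (apply IsForm_bin; [kinds|]; split; [now apply IsForm_neg|easy]).
  assert (Fall : mIsForm true (cAll v (cImp p b))) by (apply IsForm_q; [kinds|easy]).
  assert (Fand : mIsForm true (cAnd a (cAll v (cImp p b)))) by (apply IsForm_bin; [kinds|easy]).
  assert (Fp : mIsForm true (cAll v p)) by (apply IsForm_q; [kinds|easy]).
  assert (Fn : mIsForm true (cNeg (cAnd a (cAll v (cImp p b))))) by now apply IsForm_neg.
  rewrite Tr_or, Tr_neg, Tr_and, !Tr_all by easy.
  destruct (classic (Tr c a)) as [Ta|Na]; [|tauto].
  destruct (classic (forall x c', Upd c v x c' -> Tr c' (cImp p b))) as [Ti|Ni]; [|tauto].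
  right. apply Tr_induction; [easy| |].
  - intros c' U. apply (Tr_subst c v cZero p a c'); auto.
    + apply IsTerm_zero.
    + apply FreeFor_intro; auto. intros w _. apply Occurs_zero.
    + now rewrite tval_zero.
  - intros x c' c'' U U' T. specialize (Ti x c' U).
    assert (mIsForm true (cNeg p)) by now apply IsForm_neg.
    rewrite Tr_or, Tr_neg in Ti by easy.
    destruct Ti as [N|Ti]; [contradiction|].
    assert (TV : mIsTerm true (cSucc (cVar v))) by apply IsTerm_succ, IsTerm_var.
    apply (Tr_subst c' v (cSucc (cVar v)) p b c''); auto.
    + apply FreeFor_intro; auto. intros w N O.
      rewrite Occurs_succ, Occurs_var in O. contradiction.
    + rewrite tval_succ by apply IsTerm_var. rewrite tval_var.
      destruct U as [Uv Uo], U' as [Uv' Uo']. split; [congruence|].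
      intros i N. rewrite Uo, Uo'; auto.
Qed.

Lemma AllPrefix_form q x : mIsForm true q -> mAllPrefix q x -> mIsForm true x.
Proof.
  intros F. revert x. apply Lfp_ind; [intro; pos|def|].
  intros x [->|(v & a & -> & _ & H)]; [easy|]. apply IsForm_q; [kinds|easy].
Qed.

(** The prefix may have nonstandard length, so this is an induction for truth again;
    closures turn truth under all assignments into an atom. *)
Lemma Tr_AllPrefix q x : mIsForm true q -> (forall c, Tr c q) -> mAllPrefix q x ->
  forall c, Tr c x.
Proof.
  intros F H P. apply T_closure; [now apply (AllPrefix_form q)|].
  revert x P. apply T_Lfp_ind; [intro; pos|apply D_closure|].
  intros x [->|(v & a & -> & P & T)]; [now apply T_closure|].
  apply AllPrefix_form in P; [|easy].
  apply T_closure; [apply IsForm_q; [kinds|easy]|].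
  intros c. apply Tr_all; [easy|]. intros y c' _. now apply T_closure.
Qed.

Theorem axiom_soundness x : mSent x -> mAx_PA x -> mT x.
Proof.
  intros S A. rewrite <- (Tr_sent m0) by easy.
  destruct A as [(p & Hp & ->)|(v & p & q & F & I & P & _)].
  - apply Tr_quote; [now apply basic_Lplus|]. now apply basic_sat.
  - apply IsForm_mono in F. destruct (IndAxiom_form v p q F I) as (a & b & _ & _ & _ & _ & _ & Fq).
    apply (Tr_AllPrefix q); auto. intros c. now apply (Tr_IndAxiom v p).
Qed.

End AxiomSoundness.

(** * The meaning of the arithmetized notions *)

Section Translation.

Context {M : model} {EM : Enumerated M}.

(** The meaning of a formula in a context.  No parameters are reserved here, since the
    formulae concerned are closed. *)
Definition Means (X : ctx M) (p : fm) (P : car X -> Prop) : Prop :=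
  forall e c, ag X 0 e c -> (sat e (p (lvl X 0)) <-> P c).

Definition MeansT (X : ctx M) (t : term) (f : car X -> M) : Prop :=
  (forall v, occurs v t -> (v < lvl X 0)%nat) /\
  forall e c, ag X 0 e c -> eval e t = f c.

Lemma meansT_mor X Y t f g : MeansT X t f -> Mor Y X g -> MeansT Y t (fun c => f (g c)).
Proof.
  intros [L E] G. destruct (G 0%nat) as [LG A]. split.
  - intros v Hv. apply L in Hv. lia.
  - intros e c Ac. destruct (A e c Ac) as (e' & Ae' & Ee).
    rewrite <- (E e' _ Ae'). apply eval_ext. auto.
Qed.

Lemma meansT_var X Y g : Mor X (ext Y) g -> MeansT X (Var (lvl Y 0)) (fun c => snd (g c)).
Proof.
  intros H. apply (meansT_mor (ext Y) X _ (fun c => snd c)); [|easy]. split; simpl.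
  - intros v <-. lia.
  - intros e c [E _]. exact E.
Qed.

Lemma meansT_last X : MeansT (ext X) (Var (lvl X 0)) snd.
Proof. exact (meansT_var (ext X) X (fun c => c) (Mor_id _)). Qed.

Lemma meansT_zero X : MeansT X Zero (fun _ => m0).
Proof. now split. Qed.

Lemma meansT_succ X t f : MeansT X t f -> MeansT X (Succ t) (fun c => mS (f c)).
Proof. intros [L E]. split; [easy|]. intros e c A. simpl. now rewrite (E e c A). Qed.

Lemma meansT_add X s t f g : MeansT X s f -> MeansT X t g -> MeansT X (Add s t) (fun c => f c + g c).
Proof.
  intros [L E] [L' E']. split; [intros v [H|H]; auto|].
  intros e c A. simpl. now rewrite (E e c A), (E' e c A).
Qed.

Lemma meansT_mul X s t f g : MeansT X s f -> MeansT X t g -> MeansT X (Mul s t) (fun c => f c * g c).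
Proof.
  intros [L E] [L' E']. split; [intros v [H|H]; auto|].
  intros e c A. simpl. now rewrite (E e c A), (E' e c A).
Qed.

Lemma meansT_elt X s t f g : MeansT X s f -> MeansT X t g -> MeansT X (Elt s t) (fun c => mE (f c) (g c)).
Proof.
  intros [L E] [L' E']. split; [intros v [H|H]; auto|].
  intros e c A. simpl. now rewrite (E e c A), (E' e c A).
Qed.

Lemma meansT_pair X s t f g : MeansT X s f -> MeansT X t g ->
  MeansT X (Defs.pair s t) (fun c => mpair (f c) (g c)).
Proof. intros S T. unfold Defs.pair, mpair. auto using meansT_add, meansT_mul. Qed.

Lemma meansT_num X k : MeansT X (num k) (fun _ => nm k).
Proof. induction k; simpl; [apply meansT_zero|now apply meansT_succ]. Qed.

Lemma meansT_cUn X k t f : MeansT X t f -> MeansT X (Defs.pair (num k) t) (fun c => cUn k (f c)).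
Proof. intros T. apply meansT_pair; [apply meansT_num|easy]. Qed.

Lemma meansT_cBin X k s t f g : MeansT X s f -> MeansT X t g ->
  MeansT X (Defs.pair (num k) (Defs.pair s t)) (fun c => cBin k (f c) (g c)).
Proof. intros S T. apply meansT_pair; [apply meansT_num|now apply meansT_pair]. Qed.

Lemma meansT_quote_term X t : MeansT X (quote_term t) (fun _ => mquote_term t).
Proof.
  induction t; simpl.
  - apply meansT_cUn, meansT_num.
  - apply meansT_cUn, meansT_zero.
  - now apply meansT_cUn.
  - now apply meansT_cBin.
  - now apply meansT_cBin.
  - now apply meansT_cBin.
Qed.

Lemma meansT_quote X p : MeansT X (quote p) (fun _ => mquote p).
Proof.
  induction p; simpl.
  - apply meansT_cBin; apply meansT_quote_term.
  - apply meansT_cUn, meansT_quote_term.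
  - now apply meansT_cUn.
  - now apply meansT_cBin.
  - now apply meansT_cBin.
  - apply meansT_cBin; [apply meansT_num|easy].
  - apply meansT_cBin; [apply meansT_num|easy].
Qed.

Lemma means_eq X s t f g : MeansT X s f -> MeansT X t g -> Means X (mEq s t) (fun c => f c = g c).
Proof. intros [_ S] [_ T] e c A. simpl. now rewrite (S e c A), (T e c A). Qed.

Lemma means_tr X t f : MeansT X t f -> Means X (mTr t) (fun c => mT (f c)).
Proof. intros [_ T] e c A. simpl. now rewrite (T e c A). Qed.

Lemma means_neg X p P : Means X p P -> Means X (mNeg p) (fun c => ~ P c).
Proof. intros H e c A. simpl. now rewrite (H e c A). Qed.

Lemma means_and X p q P Q : Means X p P -> Means X q Q -> Means X (mAnd p q) (fun c => P c /\ Q c).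
Proof. intros H K e c A. simpl. now rewrite (H e c A), (K e c A). Qed.

Lemma means_or X p q P Q : Means X p P -> Means X q Q -> Means X (mOr p q) (fun c => P c \/ Q c).
Proof. intros H K e c A. simpl. now rewrite (H e c A), (K e c A). Qed.

Lemma means_imp X p q P Q : Means X p P -> Means X q Q -> Means X (mImp p q) (fun c => P c -> Q c).
Proof.
  intros H K e c A. simpl. rewrite (H e c A), (K e c A).
  destruct (classic (P c)); tauto.
Qed.

Lemma means_iff X p q P Q : Means X p P -> Means X q Q -> Means X (mIff p q) (fun c => P c <-> Q c).
Proof. intros H K. exact (means_and _ _ _ _ _ (means_imp _ _ _ _ _ H K) (means_imp _ _ _ _ _ K H)). Qed.

Lemma means_ex X p (P : car X -> M -> Prop) :
  Means (ext X) (p (Var (lvl X 0))) (fun c => P (fst c) (snd c)) ->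
  Means X (mEx p) (fun c => exists y, P c y).
Proof.
  intros H e c A. simpl.
  split; intros [y Hy]; exists y; now apply (H _ _ (ag_ext X 0 e c y A)).
Qed.

Lemma means_all X p (P : car X -> M -> Prop) :
  Means (ext X) (p (Var (lvl X 0))) (fun c => P (fst c) (snd c)) ->
  Means X (mAll p) (fun c => forall y, P c y).
Proof.
  intros H e c A. simpl.
  split; intros Hy y; now apply (H _ _ (ag_ext X 0 e c y A)).
Qed.

Definition Trans1 (D : term -> fm) (P : M -> Prop) : Prop :=
  forall X t f, MeansT X t f -> Means X (D t) (fun c => P (f c)).
Definition Trans2 (D : term -> term -> fm) (P : M -> M -> Prop) : Prop :=
  forall X s t f g, MeansT X s f -> MeansT X t g -> Means X (D s t) (fun c => P (f c) (g c)).
Definition Trans3 (D : term -> term -> term -> fm) (P : M -> M -> M -> Prop) : Prop :=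
  forall X s t u f g h, MeansT X s f -> MeansT X t g -> MeansT X u h ->
    Means X (D s t u) (fun c => P (f c) (g c) (h c)).
Definition Trans4 (D : term -> term -> term -> term -> fm)
    (P : M -> M -> M -> M -> Prop) : Prop :=
  forall X s t u v f g h k, MeansT X s f -> MeansT X t g -> MeansT X u h -> MeansT X v k ->
    Means X (D s t u v) (fun c => P (f c) (g c) (h c) (k c)).

End Translation.

Create HintDb tr discriminated.

(** Translates a formula by recursion on it; notions with a known meaning are
    looked up in the database [tr]. *)
Ltac tr_step :=
  match goal with
  | |- Means _ (mEq _ _) _ => apply means_eq
  | |- Means _ (mTr _) _ => apply means_tr
  | |- Means _ (mNeg _) _ => apply means_neg
  | |- Means _ (mAnd _ _) _ => apply means_and
  | |- Means _ (mOr _ _) _ => apply means_or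
  | |- Means _ (mImp _ _) _ => apply means_imp
  | |- Means _ (mIff _ _) _ => apply means_iff
  | |- Means _ (mEx _) _ => apply means_ex; cbv beta
  | |- Means _ (mAll _) _ => apply means_all; cbv beta
  | |- MeansT _ (Var (lvl _ 0)) snd => apply meansT_last
  | |- MeansT _ (Var (lvl _ 0)) (fun _ => snd _) => solve [eapply meansT_var; mor]
  | H : MeansT ?X ?t ?f |- MeansT ?X ?t ?f => exact H
  | H : MeansT _ ?t ?f |- MeansT _ ?t (fun _ => ?f _) => solve [eapply (meansT_mor _ _ _ _ _ H); mor]
  | |- MeansT _ Zero _ => apply meansT_zero
  | |- MeansT _ qnil _ => apply meansT_zero
  | |- MeansT _ (Succ _) _ => apply meansT_succ
  | |- MeansT _ (Add _ _) _ => apply meansT_add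
  | |- MeansT _ (Mul _ _) _ => apply meansT_mul
  | |- MeansT _ (Elt _ _) _ => apply meansT_elt
  | |- MeansT _ _ (fun _ => cBin _ _ _) => apply meansT_cBin
  | |- MeansT _ _ (fun _ => cUn _ _) => apply meansT_cUn
  | |- MeansT _ (Defs.pair _ _) _ => apply meansT_pair
  | |- Means _ (?D _ _ _ _) (fun _ => ?P _ _ _ _) =>
      apply (fun H : Trans4 D P => H _); [solve [auto with tr nocore]| | | |]
  | |- Means _ (?D _ _ _) (fun _ => ?P _ _ _) =>
      apply (fun H : Trans3 D P => H _); [solve [auto with tr nocore]| | |]
  | |- Means _ (?D _ _) (fun _ => ?P _ _) =>
      apply (fun H : Trans2 D P => H _); [solve [auto with tr nocore]| |]
  | |- Means _ (?D _) (fun _ => ?P _) =>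
      apply (fun H : Trans1 D P => H _); [solve [auto with tr nocore]|]
  end.
Ltac tr :=
  intros; lazymatch goal with |- Means _ _ _ => idtac | _ => hnf; intros end;
  cbv beta iota zeta; repeat tr_step.

Section Notions.

Context {M : model} {EM : Enumerated M}.

Lemma means_le : Trans2 le (@mle M).
Proof. unfold le, mle. tr. Qed.
#[local] Hint Resolve means_le : tr.
Lemma means_lt : Trans2 lt (@mlt M).
Proof. unfold lt, mlt. tr. Qed.
#[local] Hint Resolve means_lt : tr.
Lemma means_Lh : Trans2 Lh (@mLh M).
Proof. unfold Lh, seq_code, mLh. tr. Qed.
#[local] Hint Resolve means_Lh : tr.
Lemma means_pi : Trans3 pi (@mpi M).
Proof. unfold pi, seq_code, mpi. tr. Qed.
#[local] Hint Resolve means_pi : tr.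
Lemma means_Mem : Trans2 Mem (@mMem M).
Proof. unfold Mem, Lfp, mMem, mLfp. tr. Qed.
#[local] Hint Resolve means_Mem : tr.
Lemma means_IsNumeral : Trans2 IsNumeral (@mIsNumeral M).
Proof. unfold IsNumeral, Lfp, mIsNumeral, mLfp. tr. Qed.
#[local] Hint Resolve means_IsNumeral : tr.
Lemma means_IsTerm_in (b : bool) : Trans1 (IsTerm_in b) (@mIsTerm M b).
Proof. unfold IsTerm_in, Lfp, mIsTerm, mLfp. destruct b; tr. Qed.
#[local] Hint Resolve means_IsTerm_in : tr.
Lemma means_IsTerm : Trans1 IsTerm (@mIsTerm M true).
Proof. apply means_IsTerm_in. Qed.
#[local] Hint Resolve means_IsTerm : tr.
Lemma means_IsForm_in (b : bool) : Trans1 (IsForm_in b) (@mIsForm M b).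
Proof. unfold IsForm_in, Lfp, mIsForm, mLfp. tr. Qed.
Lemma means_IsForm : Trans1 IsForm (@mIsForm M true).
Proof. apply means_IsForm_in. Qed.
Lemma means_IsForm_PA : Trans1 IsForm_PA (@mIsForm M false).
Proof. apply means_IsForm_in. Qed.
#[local] Hint Resolve means_IsForm means_IsForm_PA : tr.
Lemma means_Occurs : Trans2 Occurs (@mOccurs M).
Proof. unfold Occurs, Lfp, mOccurs, mLfp. tr. Qed.
#[local] Hint Resolve means_Occurs : tr.
Lemma means_Free : Trans2 Free (@mFree M).
Proof. unfold Free, Lfp, mFree, mLfp. tr. Qed.
#[local] Hint Resolve means_Free : tr.
Lemma means_ClTerm : Trans1 ClTerm (@mClTerm M).
Proof. unfold ClTerm, mClTerm. tr. Qed.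
Lemma means_Sent : Trans1 Sent (@mSent M).
Proof. unfold Sent, mSent. tr. Qed.
#[local] Hint Resolve means_ClTerm means_Sent : tr.
Lemma means_Val : Trans2 Val (@mVal M).
Proof. unfold Val, Lfp, mVal, mLfp. tr. Qed.
#[local] Hint Resolve means_Val : tr.
Lemma means_TermSeq : Trans1 TermSeq (@mTermSeq M).
Proof. unfold TermSeq, mTermSeq. tr. Qed.
Lemma means_ValSeq : Trans2 ValSeq (@mValSeq M).
Proof. unfold ValSeq, mValSeq. tr. Qed.
#[local] Hint Resolve means_TermSeq means_ValSeq : tr.
Lemma means_Subst : Trans4 Subst (@mSubst M).
Proof.
  unfold Subst, Replace, ReplaceTerm, Lfp, mSubst, mRep, mRT, mUnder, Vsub, mLfp. tr.
Qed.
Lemma means_SubstSeq : Trans3 SubstSeq (@mSubstSeq M).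
Proof.
  unfold SubstSeq, Replace, ReplaceTerm, Lfp, mSubstSeq, mRep, mRT, mUnder, Vseq, mLfp.
  tr.
Qed.
#[local] Hint Resolve means_Subst means_SubstSeq : tr.
Lemma means_FreeFor : Trans3 FreeFor (@mFreeFor M).
Proof. unfold FreeFor, Lfp, mFreeFor, mLfp. tr. Qed.
Lemma means_FormList : Trans1 FormList (@mFormList M).
Proof. unfold FormList, Lfp, mFormList, mLfp. tr. Qed.
Lemma means_Incl : Trans2 Incl (@mIncl M).
Proof. unfold Incl, mIncl. tr. Qed.
Lemma means_NotFreeIn : Trans2 NotFreeIn (@mNotFreeIn M).
Proof. unfold NotFreeIn, mNotFreeIn. tr. Qed.
#[local] Hint Resolve means_FreeFor means_FormList means_Incl means_NotFreeIn : tr.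
Lemma means_Derivable : Trans2 Derivable (@mDerivable M).
Proof. unfold Derivable, Lfp, mDerivable, mRule, mLfp. tr. Qed.
Lemma means_AllPrefix : Trans2 AllPrefix (@mAllPrefix M).
Proof. unfold AllPrefix, Lfp, mAllPrefix, mLfp. tr. Qed.
Lemma means_IndAxiom : Trans3 IndAxiom (@mIndAxiom M).
Proof. unfold IndAxiom, mIndAxiom. tr. Qed.
Lemma means_T_inst : Trans3 T_inst (@mT_inst M).
Proof. unfold T_inst, mT_inst. tr. Qed.
#[local] Hint Resolve means_AllPrefix means_IndAxiom means_T_inst : tr.
Lemma means_Ax_PA : Trans1 Ax_PA (@mAx_PA M).
Proof.
  intros X t f Ht. unfold Ax_PA, mAx_PA.
  set (ind := mEx _).
  assert (Hi : Means X ind (fun c => exists v p q, mIsForm false p /\ mIndAxiom v p q /\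
    mAllPrefix q (f c) /\ mSent (f c))) by (subst ind; tr).
  clearbody ind. induction PA_basic as [|a l IH]; simpl.
  - intros e c A. rewrite (Hi e c A). split; [now right|].
    intros [(p & [] & _)|H]; easy.
  - intros e c A. cbn [mOr sat]. rewrite (IH e c A).
    assert (E := means_eq X t (quote a) f _ Ht (meansT_quote X a) e c A).
    split.
    + intros [H|[(p & Hp & H)|H]]; [left|left|now right].
      * exists a. split; [now left|]. now apply E.
      * exists p. auto.
    + intros [(p & [<-|Hp] & H)|H]; [left; now apply E|right; left; eauto|auto].
Qed.
#[local] Hint Resolve means_Ax_PA : tr.

Lemma means_closed (p : fm) (P : Prop) : Means base p (fun _ => P) ->
  forall e : nat -> M, sat e (p 0%nat) <-> P.
Proof. intros H e. apply (H e tt). intros v Hv. lia. Qed.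

End Notions.

#[export] Hint Resolve means_le means_lt means_Lh means_pi means_Mem means_IsNumeral means_IsTerm means_IsForm
  means_Occurs means_Free means_ClTerm means_Sent means_Val means_TermSeq means_ValSeq means_Subst means_SubstSeq
  means_FreeFor means_FormList means_Incl means_NotFreeIn means_Derivable means_AllPrefix means_IndAxiom
  means_T_inst means_Ax_PA : tr.

(** * Models of CT_0^+ *)

Fixpoint close (n : nat) (p : form) : form :=
  match n with 0%nat => p | S n => FAll n (close n p) end.

Lemma free_close n p v : free v (close n p) -> (n <= v)%nat /\ free v p.
Proof.
  induction n as [|n IH]; simpl; [split; [lia|easy]|].
  intros [N H]. apply IH in H as [L H]. split; [lia|easy].
Qed.

Lemma universal_closure_exists p : exists q, universal_closure p q.
Proof.
  exists (close (S (maxvar p)) p). split.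
  - generalize (S (maxvar p)). intros n. induction n; simpl; now constructor.
  - intros v H. apply free_close in H as [L H]. apply free_maxvar in H. lia.
Qed.

Lemma sat_universal_closure {M : model} p q (e : nat -> M) :
  universal_closure p q -> sat e q -> forall e' : nat -> M, sat e' p.
Proof.
  intros [A S] H.
  assert (H' : forall e' : nat -> M, sat e' q).
  { intros e'. apply (sat_ext q e e'); [|easy]. intros v F. now apply S in F. }
  clear S H. induction A as [|v q A IH]; [easy|]. apply IH. intros e'.
  specialize (H' e' (e' v)). apply (sat_ext q _ e') in H'; [easy|].
  intros i _. unfold upd. destruct (Nat.eqb_spec i v); congruence.
Qed.

Lemma free_for_intro r v p : (forall w, w <> v -> ~ occurs w r) -> free_for r v p.
Proof. intros H. induction p; simpl; auto; intros [N _]; auto. Qed.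

Lemma sat_Ind {M : model} v p (e : nat -> M) :
  sat e (Ind v p) -> sat (upd e v m0) p ->
  (forall x, sat (upd e v x) p -> sat (upd e v (mS x)) p) ->
  forall x, sat (upd e v x) p.
Proof.
  intros H H0 HS. simpl in H. destruct H as [N|H]; [|easy]. exfalso. apply N. split.
  - apply sat_subst; [|easy]. apply free_for_intro. intros w _ [].
  - intros x. destruct (classic (sat (upd e v x) p)) as [Hx|Nx]; [right|now left].
    apply sat_subst; [apply free_for_intro; simpl; congruence|]. simpl.
    rewrite upd_same. apply (sat_ext p (upd e v (mS x))); [|now apply HS].
    intros i _. unfold upd. now destruct (i =? v).
Qed.

Section Models.

Context {M : model} {EM : Enumerated M}.
Context (e0 : nat -> M) (axioms : forall q, CT0plus q -> sat e0 q).

Lemma basic_axiom (p : fm) (P : Prop) : In (p 0%nat) PA_basic ->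
  Means base p (fun _ => P) -> P.
Proof.
  intros Hp Hj. apply (means_closed p P Hj e0), axioms. now constructor; constructor.
Qed.

(** The induction formula has the parameters as its variables below K and the
    induction variable x_K. *)
Lemma model_induction (P : M -> Prop) : Definable1 P ->
  P m0 -> (forall x, P x -> P (mS x)) -> forall x, P x.
Proof.
  intros D H0 HS. destruct (D (ext base) snd (DF_last base)) as [K HK].
  destruct (HK K (le_n K)) as (p & L & S). simpl in S.
  assert (E : forall x, sat (upd rho K x) p <-> P x).
  { intros x. apply (S _ (tt, x)). split; [apply upd_same|]. exists rho.
    split; [easy|]. intros v Hv. apply upd_other. lia. }
  destruct (universal_closure_exists (Ind K p)) as [q Hq].
  assert (Hi : sat rho (Ind K p)).
  { apply (sat_universal_closure (Ind K p) q e0 Hq), axioms. constructor.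
    now apply PAplus_induction with K p. }
  intros x. apply E. apply (sat_Ind K p rho Hi).
  - now apply E.
  - intros y. rewrite !E. auto.
Qed.

Lemma model_PA : PAmodel M.
Proof.
  constructor.
  - apply (basic_axiom (mAll (fun x => mNeg (mEq (Succ x) Zero)))); [simpl; tauto|tr].
  - apply (basic_axiom (mAll (fun x => mAll (fun y =>
      mImp (mEq (Succ x) (Succ y)) (mEq x y))))); [simpl; tauto|tr].
  - apply (basic_axiom (mAll (fun x => mEq (Add x Zero) x))); [simpl; tauto|tr].
  - apply (basic_axiom (mAll (fun x => mAll (fun y =>
      mEq (Add x (Succ y)) (Succ (Add x y)))))); [simpl; tauto|tr].
  - apply (basic_axiom (mAll (fun x => mEq (Mul x Zero) Zero))); [simpl; tauto|tr].
  - apply (basic_axiom (mAll (fun x => mAll (fun y =>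
      mEq (Mul x (Succ y)) (Add (Mul x y) x))))); [simpl; tauto|tr].
  - exact model_induction.
  - refine (proj1 (means_closed _ _ _ e0) (axioms _ (CT0plus_PAplus _ PAplus_elt))). tr.
Qed.

Lemma truth_axiom (p : fm) (P : Prop) : In (p 0%nat) CT_axioms ->
  Means base p (fun _ => P) -> P.
Proof. intros Hp Hj. apply (means_closed p P Hj e0), axioms. now constructor. Qed.

Lemma model_truth_induction (u n : M) :
  let P x := forall j, j <= x -> (exists w, w <= n /\ w = j) -> mT (mE u j) in
  P m0 -> (forall x, P x -> P (mS x)) -> forall x, P x.
Proof.
  intros P H0 HS.
  (* x_0 is the induction variable, x_1 = u, x_2 = n and x_3 = j; the guard
     j <= n is written with a bounded quantifier over x_5. *)
  set (p := FAll 3 (FImp (bound 3 (Var 0) 4)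
    (FImp (FEx 5 (FAnd (bound 5 (Var 2) 4) (FEq (Var 5) (Var 3))))
          (FTr (Elt (Var 1) (Var 3)))))).
  assert (D : Delta0 p).
  { apply Delta0_all; simpl; try lia. apply Delta0_or; [|constructor].
    apply Delta0_neg, Delta0_ex; simpl; try lia. constructor. }
  set (e := upd (upd (fun _ => m0) 1 u) 2 n).
  assert (E : forall x, sat (upd e 0 x) p <-> P x).
  { intros x. unfold p, P, e, bound, FImp, upd. simpl. unfold mle.
    split; intros H j; specialize (H j); tauto. }
  destruct (universal_closure_exists (Ind 0 p)) as [q Hq].
  assert (Hi : sat e (Ind 0 p)).
  { apply (sat_universal_closure (Ind 0 p) q e0 Hq), axioms.
    now apply CT0plus_induction with 0%nat p. }
  intros x. apply E. apply (sat_Ind 0 p e Hi).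
  - now apply E.
  - intros y. rewrite !E. auto.
Qed.

Lemma model_CT : CTmodel M.
Proof.
  constructor.
  - apply (truth_axiom CT_eq); [simpl; tauto|unfold CT_eq; tr].
  - apply (truth_axiom CT_and); [simpl; tauto|unfold CT_and; tr].
  - apply (truth_axiom CT_or); [simpl; tauto|unfold CT_or; tr].
  - apply (truth_axiom CT_neg); [simpl; tauto|unfold CT_neg; tr].
  - apply (truth_axiom CT_all); [simpl; tauto|unfold CT_all; tr].
  - apply (truth_axiom CT_ex); [simpl; tauto|unfold CT_ex; tr].
  - apply (truth_axiom CT_regularity); [simpl; tauto|unfold CT_regularity; tr].
  - exact model_truth_induction.
Qed.

Lemma model_reflection : sat e0 GlobalReflection.
Proof.
  pose proof model_PA as PA. pose proof model_CT as CT.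
  refine (proj2 (means_closed _ _ _ e0) (@global_reflection M EM PA CT)). unfold Pr_T. tr.
Qed.

Lemma model_axiom_soundness : sat e0 AxiomSoundness_PA.
Proof.
  pose proof model_PA as PA. pose proof model_CT as CT.
  refine (proj2 (means_closed _ _ _ e0) (@axiom_soundness M EM PA CT)). tr.
Qed.

End Models.

Theorem theorem55 :
  proves CT0plus GlobalReflection /\ proves CT0plus AxiomSoundness_PA.
Proof.
  split; apply completeness; intros M e f Hf H.
  - exact (@model_reflection M {| rho := f; rho_surj := Hf |} e H).
  - exact (@model_axiom_soundness M {| rho := f; rho_surj := Hf |} e H).
Qed.
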